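(* Given a set $\mathcal{D}$ of $n$ disks in the plane and $\epsilon>0$, one can compute in $O(n+(1/\epsilon^3)\log(1/\epsilon))$ time two congruent disks $C_1,C_2$ of common radius $r$ such that every $D\in\mathcal{D}$ satisfies $D\subseteq C_1$ or $D\subseteq C_2$, and $r\le(1+\epsilon)r^*_{\mathrm{res}}$, where $r^*_{\mathrm{res}}$ is the smallest radius $\rho$ for which there exist two disks $E_1,E_2$ of radius $\rho$ such that every $D\in\mathcal{D}$ satisfies $D\subseteq E_1$ or $D\subseteq E_2$.
   Context: Disks are closed disks in the plane given by center and radius; computations are in the real-RAM model (with the floor function available). The paper assumes throughout that no disk of $\mathcal{D}$ contains another disk of $\mathcal{D}$. *)

(* Defs.v *)
From Stdlib Require Import Reals Lra ZArith List.
Open Scope R_scope.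

Definition disk : Type := (R * R * R)%type.
Definition dcx (D : disk) : R := fst (fst D).
Definition dcy (D : disk) : R := snd (fst D).
Definition drad (D : disk) : R := snd D.

Definition in_disk (D : disk) (p : R * R) : Prop :=
  (fst p - dcx D) ^ 2 + (snd p - dcy D) ^ 2 <= drad D ^ 2.

Definition disk_subset (D C : disk) : Prop :=
  forall p : R * R, in_disk D p -> in_disk C p.

Definition valid_input (Ds : list disk) : Prop :=
  (forall i, (i < length Ds)%nat -> 0 < drad (nth i Ds (0,0,0))) /\
  (forall i j, (i < length Ds)%nat -> (j < length Ds)%nat -> i <> j ->
     ~ disk_subset (nth i Ds (0,0,0)) (nth j Ds (0,0,0))).

Definition feasible_radius (Ds : list disk) (rho : R) : Prop :=
  0 <= rho /\
  exists e1 e2 : R * R,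
    forall D, In D Ds ->
      disk_subset D (e1, rho) \/ disk_subset D (e2, rho).

Inductive instr : Type :=
  | IConst (i : nat) (z : Z)
  | IAdd (i j k : nat)
  | ISub (i j k : nat)
  | IMul (i j k : nat)
  | IDiv (i j k : nat)
  | ISqrt (i j : nat)                   (* r_i := sqrt r_j (0 if r_j < 0)   *)
  | IFloor (i j : nat)
  | ILoad (i j : nat)
  | IStore (i j : nat)
  | IJle (i j l : nat)
  | IJmp (l : nat)
  | IHalt.

Definition program := list instr.
Definition memory := nat -> R.

Definition floorZ (x : R) : Z := (up x - 1)%Z.
Definition addr (x : R) : nat := Z.to_nat (floorZ x).

Definition upd (m : memory) (i : nat) (v : R) : memory :=
  fun k => if Nat.eqb k i then v else m k.

Definition config := (nat * memory)%type.

Definition halted (P : program) (c : config) : Prop :=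
  match nth_error P (fst c) with
  | None => True
  | Some IHalt => True
  | Some _ => False
  end.

Definition step (P : program) (c : config) : config :=
  let (pc, m) := c in
  match nth_error P pc with
  | None => c
  | Some IHalt => c
  | Some (IConst i z) => (S pc, upd m i (IZR z))
  | Some (IAdd i j k) => (S pc, upd m i (m j + m k))
  | Some (ISub i j k) => (S pc, upd m i (m j - m k))
  | Some (IMul i j k) => (S pc, upd m i (m j * m k))
  | Some (IDiv i j k) =>
      (S pc, upd m i (if Req_EM_T (m k) 0 then 0 else m j / m k))
  | Some (ISqrt i j) => (S pc, upd m i (sqrt (m j)))
  | Some (IFloor i j) => (S pc, upd m i (IZR (floorZ (m j))))
  | Some (ILoad i j) => (S pc, upd m i (m (addr (m j))))
  | Some (IStore i j) => (S pc, upd m (addr (m i)) (m j))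
  | Some (IJle i j l) => (if Rle_dec (m i) (m j) then l else S pc, m)
  | Some (IJmp l) => (l, m)
  end.

Fixpoint run (P : program) (k : nat) (c : config) : config :=
  match k with
  | O => c
  | S k' => run P k' (step P c)
  end.

(* Input encoding: r_0 = n, r_1 = eps, and disk number k (0-based) occupies
   registers 2+3k (center x), 3+3k (center y), 4+3k (radius); all other
   registers are 0. *)
Definition input_memory (Ds : list disk) (eps : R) : memory :=
  fun a =>
    match a with
    | O => INR (length Ds)
    | S O => eps
    | S (S b) =>
        let k := Nat.div b 3 in
        let r := Nat.modulo b 3 in
        match nth_error Ds k with
        | None => 0
        | Some D =>
            match r with
            | O => dcx D
            | S O => dcy D
            | _ => drad D
            end
        end
    end.

Definition out_C1 (m : memory) : disk := ((m 0%nat, m 1%nat), m 4%nat).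
Definition out_C2 (m : memory) : disk := ((m 2%nat, m 3%nat), m 4%nat).
Definition out_r (m : memory) : R := m 4%nat.

(* Time bound shape O(n + (1/eps^3) log(1/eps)); the "+1" and log(1 + 1/eps)
   keep the bound positive/meaningful also for eps >= 1. *)
Definition time_bound (n : nat) (eps : R) : R :=
  INR n + 1 + / eps ^ 3 * ln (1 + / eps).

(* Main.v *)
(* Let p be the center of the first disk, q the center farthest from p, delta the largest
   distance of a center to {p, q} and R = delta plus the largest radius: r* <= R <= 3 r*.
   Put N = K^2 of order 1/eps and measure lengths in units of w = R/N, with p as origin.
   Keeping the largest disk in every cell of two unit grids around p and q leaves O(N^2)
   disks at the cost of an error O(w).  Let u_1, ..., u_M be M = O(K) unit vectors such that
   every v satisfies max_k <v, u_k> >= (1 - 2/N) |v|; distances may then be replaced by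
   maxima over k.  A table G(k, j, t), the maximum of <c, u_j> + r over the disks with
   <c, u_k> + r >= t (t rounded to integers), has O(M^2 N) entries and is computed in time
   O(N^2 M^2).  For a trial center e_1 and a trial radius rho, the disks not covered by
   (e_1, rho) are those with <c, u_k> + r > rho + <e_1, u_k> for some k, so M^2 table
   lookups give their extent H_j in every direction u_j, and a second center exists iff
   the half-planes <e, u_j> >= H_j - rho have a common point, which is then found on one of
   the M boundary lines in time O(M^2).  Letting e_1 run through the O(N^2) grid points
   around p and lowering rho by 1 as long as the test succeeds requires O(N^2) tests, hence
   O(N^2 M^2) = O(1/eps^3) time in all. *)
Require Import Defs.
From Stdlib Require Import Reals List Lra Lia ZArith Bool Classical FunctionalExtensionality.
Import ListNotations.
Open Scope R_scope.

(** Two obstacles shape the formal argument. The time bound concerns one explicit machine program,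
    so a small imperative language is compiled to [instr] and its triples carry step counts. And the
    input fills the registers from 0 on, so no register with a fixed number is known to be free: the
    data must be moved away before any variable can exist, and packing n and eps into one number
    gains the first scratch register. Error budget in units of w: 1 for rounding thresholds to
    integers, 4 for using finitely many directions, 2 for letting the largest disk of a cell stand
    for the others; hence the output radius N - d + 7. Conversely every feasible rho exceeds N - d -
    3, where 1 is the step of the radius and 2 the distance to a grid point. The total is 10 w = 10
    R / N <= 30 r* / N, which asks for eps N >= 30. Directions are given by the tangent of the half
    angle because their coordinates are then rational functions, and the machine has no
    trigonometry. Registers never written hold 0, so 0 encodes both the empty maximum and the empty
    cell, and no array is cleared. *)

Lemma floorZ_spec (x : R) : IZR (floorZ x) <= x < IZR (floorZ x) + 1.
Proof.
  unfold floorZ. rewrite minus_IZR. destruct (archimed x). lra.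
Qed.

Lemma floorZ_unique (x : R) (z : Z) : IZR z <= x < IZR z + 1 -> floorZ x = z.
Proof.
  intros H. destruct (floorZ_spec x) as [H1 H2].
  assert (z < floorZ x + 1)%Z by (apply lt_IZR; rewrite plus_IZR; lra).
  assert (floorZ x < z + 1)%Z by (apply lt_IZR; rewrite plus_IZR; lra).
  lia.
Qed.

Lemma addr_bounds (x : R) (k : nat) : INR k <= x < INR k + 1 -> addr x = k.
Proof.
  intros H. unfold addr. rewrite (floorZ_unique x (Z.of_nat k)).
  - apply Nat2Z.id.
  - rewrite <- INR_IZR_INZ. exact H.
Qed.

Lemma addr_INR (k : nat) : addr (INR k) = k.
Proof. apply addr_bounds. lra. Qed.

Lemma upd_same (m : memory) i v : upd m i v i = v.
Proof. unfold upd. now rewrite Nat.eqb_refl. Qed.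

Lemma upd_other (m : memory) i v k : k <> i -> upd m i v k = m k.
Proof. intros H. unfold upd. now apply Nat.eqb_neq in H as ->. Qed.

Lemma run_add P k1 k2 c : run P (k1 + k2) c = run P k2 (run P k1 c).
Proof. revert c. induction k1; intros c; simpl; auto. Qed.

Definition rdiv (x y : R) : R := if Req_EM_T y 0 then 0 else x / y.

Lemma rdiv_div (x y : R) : y <> 0 -> rdiv x y = x / y.
Proof. intros H. unfold rdiv. now destruct (Req_EM_T y 0). Qed.

(** * Placement of code inside a program *)

Definition code_at (P : program) (pc : nat) (l : list instr) : Prop :=
  forall i x, nth_error l i = Some x -> nth_error P (pc + i) = Some x.

Lemma code_at_app P pc l1 l2 :
  code_at P pc (l1 ++ l2) <-> code_at P pc l1 /\ code_at P (pc + length l1) l2.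
Proof.
  split.
  - intros H; split; intros i x Hi.
    + apply H. rewrite nth_error_app1; auto. apply nth_error_Some. congruence.
    + rewrite <- Nat.add_assoc. apply H. rewrite nth_error_app2 by lia.
      now replace (length l1 + i - length l1)%nat with i by lia.
  - intros [H1 H2] i x Hi. destruct (Nat.lt_ge_cases i (length l1)) as [Hl|Hl].
    + rewrite nth_error_app1 in Hi; auto.
    + rewrite nth_error_app2 in Hi by auto.
      apply H2 in Hi. rewrite <- Hi. f_equal. lia.
Qed.

Lemma code_at_cons P pc i l :
  code_at P pc (i :: l) <-> nth_error P pc = Some i /\ code_at P (S pc) l.
Proof.
  split.
  - intros H; split.
    + rewrite <- (Nat.add_0_r pc). now apply H.
    + intros k x Hk. rewrite Nat.add_succ_comm. now apply H.
  - intros [H1 H2] [|k] x Hk; cbn in Hk.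
    + rewrite Nat.add_0_r. congruence.
    + rewrite <- Nat.add_succ_comm. now apply H2.
Qed.

Lemma code_at_pc P pc pc' l : code_at P pc l -> pc = pc' -> code_at P pc' l.
Proof. now intros H <-. Qed.

Arguments nth_error : simpl never.

(** * A structured language compiled to the machine *)

Inductive binop : Type := BAdd | BSub | BMul | BDiv.

Inductive expr : Type :=
  | EV (x : nat)
  | EC (z : Z)
  | EB (o : binop) (e1 e2 : expr)
  | ESqrt (e : expr)
  | EFloor (e : expr).

Inductive cmd : Type :=
  | Asg (x : nat) (e : expr)
  | Ld (x a : nat) (e : expr)
  | St (a : nat) (e1 e2 : expr)
  | Skip
  | Seq (c1 c2 : cmd)
  | IfLe (e1 e2 : expr) (c1 c2 : cmd)
  | WhileLt (e1 e2 : expr) (c : cmd).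

Definition env := nat -> R.
Definition arrays := nat -> nat -> R.

Definition aupd (a : arrays) (k i : nat) (v : R) : arrays :=
  fun k' => if Nat.eqb k' k then upd (a k) i v else a k'.

Definition beval (o : binop) (x y : R) : R :=
  match o with
  | BAdd => x + y | BSub => x - y | BMul => x * y | BDiv => rdiv x y
  end.

Fixpoint eval (e : expr) (s : env) : R :=
  match e with
  | EV x => s x
  | EC z => IZR z
  | EB o e1 e2 => beval o (eval e1 s) (eval e2 s)
  | ESqrt e => sqrt (eval e s)
  | EFloor e => IZR (floorZ (eval e s))
  end.

(* Registers 0..NV-1 hold the variables, register NV the base address of the
   arrays, registers NV+1..127 the intermediate values of expressions; cell i of
   array k < 8 is register base + 8 i + k. *)
Definition NV : nat := 80.
Definition tmp (d : nat) : nat := (NV + 1 + d)%nat.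

Definition binstr (o : binop) : nat -> nat -> nat -> instr :=
  match o with BAdd => IAdd | BSub => ISub | BMul => IMul | BDiv => IDiv end.

(** The temporaries form a stack: code for level d writes only [tmp d] and above. There is no move
    instruction, so a variable is copied by adding 0. *)
Fixpoint cexp (e : expr) (d : nat) : list instr :=
  match e with
  | EV x => [IConst (tmp d) 0; IAdd (tmp d) x (tmp d)]
  | EC z => [IConst (tmp d) z]
  | EB o e1 e2 => cexp e1 d ++ cexp e2 (S d) ++ [binstr o (tmp d) (tmp d) (tmp (S d))]
  | ESqrt e => cexp e d ++ [ISqrt (tmp d) (tmp d)]
  | EFloor e => cexp e d ++ [IFloor (tmp d) (tmp d)]
  end.

Fixpoint wfe (e : expr) (d : nat) : bool :=
  Nat.ltb d 40 &&
  match e with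
  | EV x => Nat.ltb x NV
  | EC _ => true
  | EB _ e1 e2 => wfe e1 d && wfe e2 (S d)
  | ESqrt e => wfe e d
  | EFloor e => wfe e d
  end.

(** Interleaving the eight arrays lets each of them be unbounded without fixing any size in advance.
    The base is read from register [NV] because it depends on n. *)
Definition caddr (d a : nat) : list instr :=
  [IConst (tmp (S d)) 8; IMul (tmp d) (tmp d) (tmp (S d)); IAdd (tmp d) (tmp d) NV;
   IConst (tmp (S d)) (Z.of_nat a); IAdd (tmp d) (tmp d) (tmp (S d))].

(** Jump targets are absolute, hence the argument [pc]. The only test is <=, so the strict loop
    guard is compiled through its negation: the loop is left when e2 <= e1, which is why [e2] goes
    to [tmp 0]. *)
Fixpoint ccmd (c : cmd) (pc : nat) : list instr :=
  match c with
  | Asg x e => cexp e 0 ++ [IConst (tmp 1) 0; IAdd x (tmp 0) (tmp 1)]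
  | Ld x a e => cexp e 0 ++ caddr 0 a ++ [ILoad x (tmp 0)]
  | St a e1 e2 => cexp e1 0 ++ caddr 0 a ++ cexp e2 1 ++ [IStore (tmp 0) (tmp 1)]
  | Skip => []
  | Seq c1 c2 => let l1 := ccmd c1 pc in l1 ++ ccmd c2 (pc + length l1)
  | IfLe e1 e2 c1 c2 =>
      let lt := cexp e1 0 ++ cexp e2 1 in
      let p2 := S (pc + length lt) in
      let l2 := ccmd c2 p2 in
      let p1 := S (p2 + length l2) in
      let l1 := ccmd c1 p1 in
      lt ++ [IJle (tmp 0) (tmp 1) p1] ++ l2 ++ [IJmp (p1 + length l1)] ++ l1
  | WhileLt e1 e2 c =>
      let lt := cexp e2 0 ++ cexp e1 1 in
      let pb := S (pc + length lt) in
      let lb := ccmd c pb in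
      lt ++ [IJle (tmp 0) (tmp 1) (S (pb + length lb))] ++ lb ++ [IJmp pc]
  end.

Fixpoint wfc (c : cmd) : bool :=
  match c with
  | Asg x e => Nat.ltb x NV && wfe e 0
  | Ld x a e => Nat.ltb x NV && Nat.ltb a 8 && wfe e 0
  | St a e1 e2 => Nat.ltb a 8 && wfe e1 0 && wfe e2 1
  | Skip => true
  | Seq c1 c2 => wfc c1 && wfc c2
  | IfLe e1 e2 c1 c2 => wfe e1 0 && wfe e2 1 && wfc c1 && wfc c2
  | WhileLt e1 e2 c => wfe e2 0 && wfe e1 1 && wfc c
  end.

(** Boolean, so that the side conditions of [frame] for concrete commands are settled by
    computation. *)
Fixpoint writes (c : cmd) (x : nat) : bool :=
  match c with
  | Asg y _ | Ld y _ _ => Nat.eqb x y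
  | St _ _ _ | Skip => false
  | Seq c1 c2 | IfLe _ _ c1 c2 => writes c1 x || writes c2 x
  | WhileLt _ _ c => writes c x
  end.

Fixpoint stores (c : cmd) (k : nat) : bool :=
  match c with
  | Asg _ _ | Ld _ _ _ | Skip => false
  | St a _ _ => Nat.eqb k a
  | Seq c1 c2 | IfLe _ _ c1 c2 => stores c1 k || stores c2 k
  | WhileLt _ _ c => stores c k
  end.

Definition rel (base : nat) (s : env) (a : arrays) (m : memory) : Prop :=
  (forall x, (x < NV)%nat -> m x = s x) /\
  (128 <= base)%nat /\ m NV = INR base /\
  (forall k i, (k < 8)%nat -> m (base + 8 * i + k)%nat = a k i).

Arguments tmp : simpl never.
Arguments upd : simpl never.

Lemma rel_upd_tmp b s a m d v : rel b s a m -> (d < 42)%nat -> rel b s a (upd m (tmp d) v).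
Proof.
  unfold tmp, NV. intros (H1 & H2 & H3 & H4) Hd. split; [|split; [|split]]; auto.
  - intros x Hx. rewrite upd_other; auto. unfold NV in *; lia.
  - intros. rewrite upd_other; auto; lia.
Qed.

Lemma rel_upd_var b s a m x v :
  rel b s a m -> (x < NV)%nat -> rel b (upd s x v) a (upd m x v).
Proof.
  intros (H1 & H2 & H3 & H4) Hx. split; [|split; [|split]]; auto.
  - intros y Hy. unfold upd. destruct (Nat.eqb y x); auto.
  - rewrite upd_other; auto. lia.
  - intros. rewrite upd_other; auto. unfold NV in *; lia.
Qed.

Lemma rel_upd_cell b s a m k i v :
  rel b s a m -> (k < 8)%nat ->
  rel b s (aupd a k i v) (upd m (b + 8 * i + k)%nat v).
Proof.
  intros (H1 & H2 & H3 & H4) Hk. split; [|split; [|split]]; auto.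
  - intros x Hx. rewrite upd_other; auto. unfold NV in *; lia.
  - rewrite upd_other; auto. unfold NV in *; lia.
  - intros k' i' Hk'. unfold aupd. destruct (Nat.eqb_spec k' k) as [->|Hne].
    + destruct (Nat.eq_dec i' i) as [->|Hi].
      * now rewrite !upd_same.
      * rewrite !upd_other by lia. auto.
    + rewrite upd_other by lia. auto.
Qed.

Lemma code_at_cons1 P pc i l : code_at P pc (i :: l) -> nth_error P pc = Some i.
Proof. now intros [H _]%code_at_cons. Qed.

Lemma code_at_cons2 P pc i l : code_at P pc (i :: l) -> code_at P (S pc) l.
Proof. now intros [_ H]%code_at_cons. Qed.

(** The last clause makes the induction work: the left operand waits in [tmp d] while the right one
    is evaluated one level higher. *)
Lemma cexp_correct P e b s a : forall d m pc,
  wfe e d = true -> rel b s a m -> code_at P pc (cexp e d) ->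
  exists m', run P (length (cexp e d)) (pc, m) = ((pc + length (cexp e d))%nat, m') /\
    rel b s a m' /\ m' (tmp d) = eval e s /\
    (forall d', (d' < d)%nat -> m' (tmp d') = m (tmp d')).
Proof.
  induction e as [x|z|o e1 IH1 e2 IH2|e IH|e IH]; intros d m pc Hw Hr Hc; simpl in Hw;
    apply andb_true_iff in Hw as [Hd Hw]; apply Nat.ltb_lt in Hd.
  - apply Nat.ltb_lt in Hw. simpl in Hc.
    pose proof (code_at_cons1 _ _ _ _ Hc) as E1. apply code_at_cons2, code_at_cons1 in Hc as E2.
    simpl. rewrite E1. simpl. rewrite E2. simpl. eexists. split; [f_equal; lia|].
    split; [|split].
    + apply rel_upd_tmp; [apply rel_upd_tmp|]; auto; lia.
    + rewrite !upd_same, upd_other by (unfold tmp; lia).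
      destruct Hr as [Hr _]. rewrite Hr by auto. lra.
    + intros d' Hd'. rewrite !upd_other; auto; unfold tmp; lia.
  - simpl in Hc. apply code_at_cons1 in Hc as E1.
    simpl. rewrite E1. eexists. split; [f_equal; lia|].
    split; [|split].
    + apply rel_upd_tmp; auto; lia.
    + now rewrite upd_same.
    + intros d' Hd'. rewrite !upd_other; auto; unfold tmp; lia.
  - apply andb_true_iff in Hw as [Hw1 Hw2].
    simpl in Hc. apply code_at_app in Hc as [Hc1 Hc]. apply code_at_app in Hc as [Hc2 Hc3].
    destruct (IH1 d m pc Hw1 Hr Hc1) as (m1 & R1 & Hr1 & V1 & T1).
    destruct (IH2 (S d) m1 _ Hw2 Hr1 Hc2) as (m2 & R2 & Hr2 & V2 & T2).
    assert (Hd2 : (S d < 40)%nat).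
    { destruct e2; simpl in Hw2; apply andb_true_iff in Hw2 as [H _]; now apply Nat.ltb_lt in H. }
    apply code_at_cons1 in Hc3.
    exists (upd m2 (tmp d) (eval (EB o e1 e2) s)). simpl. rewrite !length_app, !run_add, R1, R2.
    simpl. rewrite Hc3. split; [|split; [|split]].
    + destruct o; simpl; (f_equal; [lia|]); unfold rdiv; rewrite V2, (T2 d), V1 by lia; reflexivity.
    + apply rel_upd_tmp; auto; lia.
    + now rewrite upd_same.
    + intros d' Hd'. rewrite upd_other by (unfold tmp; lia). rewrite T2, T1; auto; lia.
  - simpl in Hc. apply code_at_app in Hc as [Hc1 Hc2].
    destruct (IH d m pc Hw Hr Hc1) as (m1 & R1 & Hr1 & V1 & T1). apply code_at_cons1 in Hc2.
    exists (upd m1 (tmp d) (eval (ESqrt e) s)). simpl. rewrite !length_app, !run_add, R1.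
    simpl. rewrite Hc2, V1. split; [f_equal; lia|split; [|split]].
    + apply rel_upd_tmp; auto; lia.
    + now rewrite upd_same.
    + intros d' Hd'. rewrite upd_other by (unfold tmp; lia). auto.
  - simpl in Hc. apply code_at_app in Hc as [Hc1 Hc2].
    destruct (IH d m pc Hw Hr Hc1) as (m1 & R1 & Hr1 & V1 & T1). apply code_at_cons1 in Hc2.
    exists (upd m1 (tmp d) (eval (EFloor e) s)). simpl. rewrite !length_app, !run_add, R1.
    simpl. rewrite Hc2, V1. split; [f_equal; lia|split; [|split]].
    + apply rel_upd_tmp; auto; lia.
    + now rewrite upd_same.
    + intros d' Hd'. rewrite upd_other by (unfold tmp; lia). auto.
Qed.

Lemma caddr_correct P b s a m pc k i :
  rel b s a m -> code_at P pc (caddr 0 k) -> m (tmp 0) = INR i ->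
  exists m', run P 5 (pc, m) = ((pc + 5)%nat, m') /\ rel b s a m' /\
    m' (tmp 0) = INR (b + 8 * i + k).
Proof.
  intros Hr Hc Hi.
  pose proof Hr as (_ & _ & Hb2 & _).
  assert (HE : INR (b + 8 * i + k) = INR b + 8 * INR i + INR k).
  { rewrite plus_INR, plus_INR, mult_INR. f_equal. simpl. lra. }
  rewrite HE.
  unfold caddr in Hc.
  repeat (let E := fresh "E" in pose proof (code_at_cons1 _ _ _ _ Hc) as E;
    apply code_at_cons2 in Hc).
  clear Hc. simpl. rewrite E. simpl. rewrite E0. simpl. rewrite E1. simpl. rewrite E2. simpl.
  rewrite E3.
  eexists. split; [f_equal; lia|].
  assert (NE : tmp 0 <> tmp 1) by (unfold tmp; lia).
  assert (NE0 : NV <> tmp 1) by (unfold tmp; lia).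
  assert (NE1 : NV <> tmp 0) by (unfold tmp; lia).
  split; [repeat apply rel_upd_tmp; auto; lia|].
  repeat first [rewrite upd_same | rewrite upd_other by auto]. rewrite Hb2, Hi.
  rewrite <- INR_IZR_INZ. lra.
Qed.

(** * Weakest preconditions with running times *)

(* The frame of [c] is part of the postcondition, so that loop invariants need not
   list what a loop leaves alone. *)
Definition frame (c : cmd) (s : env) (a : arrays) (s' : env) (a' : arrays) : Prop :=
  (forall x, writes c x = false -> s' x = s x) /\
  (forall k, stores c k = false -> a' k = a k).

(** Total correctness with a step count t. Quantifying over program, position, base and memory makes
    the triple independent of where c is placed. Well-formedness is a premise, so it is checked only
    once, by computation on the whole program. *)
Definition wp (c : cmd) (s : env) (a : arrays) (Q : env -> arrays -> nat -> Prop) : Prop :=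
  wfc c = true ->
  forall P pc b m, code_at P pc (ccmd c pc) -> rel b s a m ->
  exists t m' s' a',
    run P t (pc, m) = ((pc + length (ccmd c pc))%nat, m') /\
    rel b s' a' m' /\ frame c s a s' a' /\ Q s' a' t.

Lemma wp_conseq c s a (Q Q' : env -> arrays -> nat -> Prop) :
  wp c s a Q ->
  (forall s' a' t, frame c s a s' a' -> Q s' a' t -> Q' s' a' t) -> wp c s a Q'.
Proof.
  intros H HQ Hw P pc b m Hc Hr.
  destruct (H Hw P pc b m Hc Hr) as (t & m' & s' & a' & H1 & H2 & H3 & H4).
  exists t, m', s', a'. auto.
Qed.

(** The new value enters as a variable [v] with an equation, which keeps states small during
    symbolic execution; [wp_ld] does the same. *)
Lemma wp_asg x e s a (Q : env -> arrays -> nat -> Prop) :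
  (forall v, v = eval e s -> Q (upd s x v) a (length (cexp e 0) + 2)%nat) ->
  wp (Asg x e) s a Q.
Proof.
  intros H Hw P pc b m Hc Hr. simpl in Hw. apply andb_true_iff in Hw as [Hx He].
  apply Nat.ltb_lt in Hx. simpl in Hc. apply code_at_app in Hc as [Hc1 Hc2].
  destruct (cexp_correct P e b s a 0 m pc He Hr Hc1) as (m1 & R1 & Hr1 & V1 & _).
  pose proof (code_at_cons1 _ _ _ _ Hc2) as E1.
  apply code_at_cons2, code_at_cons1 in Hc2 as E2.
  exists (length (cexp e 0) + 2)%nat, (upd (upd m1 (tmp 1) 0) x (eval e s)), (upd s x (eval e s)),
    a.
  split; [|split; [|split]].
  - rewrite run_add, R1. simpl. rewrite E1. simpl. rewrite E2. simpl.
    rewrite upd_same, upd_other by (unfold tmp; lia). rewrite V1, Rplus_0_r, length_app. simpl.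
    f_equal. lia.
  - apply rel_upd_var; auto. apply rel_upd_tmp; auto; lia.
  - split; auto. simpl. intros y Hy. apply Nat.eqb_neq in Hy. now apply upd_other.
  - now apply H.
Qed.

Lemma wp_ld x k e s a i (Q : env -> arrays -> nat -> Prop) :
  eval e s = INR i ->
  (forall v, v = a k i -> Q (upd s x v) a (length (cexp e 0) + 6)%nat) ->
  wp (Ld x k e) s a Q.
Proof.
  intros Hi H Hw P pc b m Hc Hr. simpl in Hw. apply andb_true_iff in Hw as [Hw He].
  apply andb_true_iff in Hw as [Hx Hk].
  apply Nat.ltb_lt in Hx, Hk. simpl in Hc. apply code_at_app in Hc as [Hc1 Hc2].
  destruct (cexp_correct P e b s a 0 m pc He Hr Hc1) as (m1 & R1 & Hr1 & V1 & _).
  change (code_at P (pc + length (cexp e 0)) (caddr 0 k ++ [ILoad x (tmp 0)])) in Hc2.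
  apply code_at_app in Hc2 as [Hc2 Hc3].
  destruct (caddr_correct P b s a m1 _ k i Hr1 Hc2) as (m2 & R2 & Hr2 & Ha).
  { now rewrite V1. }
  apply code_at_cons1 in Hc3. simpl in Hc3.
  exists (length (cexp e 0) + (5 + 1))%nat, (upd m2 x (a k i)), (upd s x (a k i)), a.
  split; [|split; [|split]].
  - rewrite run_add, R1, run_add, R2. simpl. rewrite Hc3.
    rewrite Ha, addr_INR, (proj2 (proj2 (proj2 Hr2))) by auto.
    rewrite length_app. simpl. f_equal. lia.
  - apply rel_upd_var; auto.
  - split; auto. simpl. intros y Hy. apply Nat.eqb_neq in Hy. now apply upd_other.
  - now apply H.
Qed.

Lemma wp_st k e1 e2 s a i (Q : env -> arrays -> nat -> Prop) :
  eval e1 s = INR i ->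
  Q s (aupd a k i (eval e2 s)) (length (cexp e1 0) + length (cexp e2 1) + 6)%nat ->
  wp (St k e1 e2) s a Q.
Proof.
  intros Hi H Hw P pc b m Hc Hr. simpl in Hw. apply andb_true_iff in Hw as [Hw He2].
  apply andb_true_iff in Hw as [Hk He].
  apply Nat.ltb_lt in Hk. cbn [ccmd] in Hc. apply code_at_app in Hc as [Hc1 Hc2].
  destruct (cexp_correct P e1 b s a 0 m pc He Hr Hc1) as (m1 & R1 & Hr1 & V1 & _).
  apply code_at_app in Hc2 as [Hc2 Hc3].
  destruct (caddr_correct P b s a m1 _ k i Hr1 Hc2) as (m2 & R2 & Hr2 & Ha).
  { now rewrite V1. }
  apply code_at_app in Hc3 as [Hc3 Hc4]. simpl in Hc3, Hc4.
  destruct (cexp_correct P e2 b s a 1 m2 _ He2 Hr2 Hc3) as (m3 & R3 & Hr3 & V3 & T3).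
  apply code_at_cons1 in Hc4.
  exists (length (cexp e1 0) + (5 + (length (cexp e2 1) + 1)))%nat,

    (upd m3 (b + 8 * i + k)%nat (eval e2 s)), s, (aupd a k i (eval e2 s)).
  split; [|split; [|split]].
  - rewrite run_add, R1, run_add, R2, run_add, R3. simpl. rewrite Hc4.
    rewrite (T3 0%nat), Ha, addr_INR, V3 by lia.
    rewrite !length_app. simpl. rewrite length_app. simpl. f_equal. lia.
  - now apply rel_upd_cell.
  - split; auto. simpl. intros k' Hk'. unfold aupd. now rewrite Hk'.
  - replace (length (cexp e1 0) + (5 + (length (cexp e2 1) + 1)))%nat with (length (cexp e1 0) +
    length (cexp e2 1) + 6)%nat by lia. auto.
Qed.

Lemma frame_refl c s a : frame c s a s a.
Proof. split; auto. Qed.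

Lemma frame_trans c s a s1 a1 s2 a2 :
  frame c s a s1 a1 -> frame c s1 a1 s2 a2 -> frame c s a s2 a2.
Proof.
  intros [H1 H2] [H3 H4]; split; intros x Hx.
  - rewrite H3, H1; auto.
  - rewrite H4, H2; auto.
Qed.

Lemma frame_asg x e c v s a s' a' :
  frame c (upd s x v) a s' a' -> frame (Seq (Asg x e) c) s a s' a'.
Proof.
  intros [F G]. split; [|exact G]. simpl. intros y Hy. apply orb_false_iff in Hy as [Hy Hy'].
  rewrite F by exact Hy'. apply upd_other. now apply Nat.eqb_neq.
Qed.

Lemma wp_skip s a (Q : env -> arrays -> nat -> Prop) : Q s a 0%nat -> wp Skip s a Q.
Proof.
  intros H Hw P pc b m Hc Hr. exists 0%nat, m, s, a. simpl.
  rewrite Nat.add_0_r. auto using frame_refl.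
Qed.

Lemma wp_seq c1 c2 s a Q :
  wp c1 s a (fun s1 a1 t1 => wp c2 s1 a1 (fun s2 a2 t2 => Q s2 a2 (t1 + t2)%nat)) ->
  wp (Seq c1 c2) s a Q.
Proof.
  intros H Hw P pc b m Hc Hr. simpl in Hw. apply andb_true_iff in Hw as [Hw1 Hw2].
  simpl in Hc. apply code_at_app in Hc as [Hc1 Hc2].
  destruct (H Hw1 P pc b m Hc1 Hr) as (t1 & m1 & s1 & a1 & R1 & Hr1 & [F1 G1] & H1).
  destruct (H1 Hw2 P _ b m1 Hc2 Hr1) as (t2 & m2 & s2 & a2 & R2 & Hr2 & [F2 G2] & H2).
  exists (t1 + t2)%nat, m2, s2, a2. split; [|split; [|split]]; auto.
  - rewrite run_add, R1, R2. simpl. rewrite length_app. f_equal. lia.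
  - split; simpl; intros x Hx; apply orb_false_iff in Hx as [Hx1 Hx2].
    + rewrite F2, F1; auto.
    + rewrite G2, G1; auto.
Qed.

Lemma compare_correct P b s a m pc e1 e2 p :
  wfe e1 0 = true -> wfe e2 1 = true -> rel b s a m ->
  code_at P pc ((cexp e1 0 ++ cexp e2 1) ++ [IJle (tmp 0) (tmp 1) p]) ->
  exists m', rel b s a m' /\
    run P (length (cexp e1 0 ++ cexp e2 1) + 1) (pc, m) =
      (if Rle_dec (eval e1 s) (eval e2 s) then p
       else S (pc + length (cexp e1 0 ++ cexp e2 1)), m').
Proof.
  intros He1 He2 Hr Hc. apply code_at_app in Hc as [Hc Hc3].
  apply code_at_app in Hc as [Hc1 Hc2].
  destruct (cexp_correct P e1 b s a 0 m pc He1 Hr Hc1) as (m1 & R1 & Hr1 & V1 & _).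
  destruct (cexp_correct P e2 b s a 1 m1 _ He2 Hr1 Hc2) as (m2 & R2 & Hr2 & V2 & T2).
  exists m2. split; auto. apply code_at_cons1 in Hc3. rewrite length_app in *.
  rewrite !run_add, R1, R2. simpl. rewrite <- Nat.add_assoc, Hc3.
  rewrite (T2 0%nat), V1, V2 by lia. reflexivity.
Qed.

Lemma wp_if e1 e2 c1 c2 s a (Q : env -> arrays -> nat -> Prop) :
  let n := (length (cexp e1 0) + length (cexp e2 1))%nat in
  (eval e1 s <= eval e2 s -> wp c1 s a (fun s' a' t => Q s' a' (t + n + 1)%nat)) ->
  (eval e2 s < eval e1 s -> wp c2 s a (fun s' a' t => Q s' a' (t + n + 2)%nat)) ->
  wp (IfLe e1 e2 c1 c2) s a Q.
Proof.
  intros n H1 H2 Hw P pc b m Hc Hr. simpl in Hw.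
  apply andb_true_iff in Hw as [Hw Hw2]. apply andb_true_iff in Hw as [Hw Hw1].
  apply andb_true_iff in Hw as [He1 He2].
  cbn [ccmd] in Hc. cbv zeta in Hc.
  assert (Hlt : length (cexp e1 0 ++ cexp e2 1) = n) by apply length_app.
  set (lt := cexp e1 0 ++ cexp e2 1) in *.
  rewrite app_assoc in Hc. apply code_at_app in Hc as [Hc0 Hc]. apply code_at_app in Hc as [Hc2 Hc].
  apply code_at_app in Hc as [Hcj Hc1].
  destruct (compare_correct P b s a m pc e1 e2 _ He1 He2 Hr Hc0) as (m' & Hr' & R').
  fold lt in R'. rewrite length_app in Hc1, Hc2, Hcj. cbn [length] in Hc1, Hc2, Hcj.
  destruct (Rle_dec (eval e1 s) (eval e2 s)) as [Hle|Hgt].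
  - destruct (H1 Hle Hw1 P (S (S (pc + length lt) + length (ccmd c2 (S (pc + length lt))))) b m')
    as (t & m1 & s1 & a1 & R1 & Hr1 & [F1 G1] & Q1); auto.
    { apply (code_at_pc _ _ _ _ Hc1). lia. }
    exists (length lt + 1 + t)%nat, m1, s1, a1. split; [|split; [|split]]; auto.
    + rewrite run_add, R', R1. cbn [ccmd]. cbv zeta. rewrite !length_app. cbn [length]. f_equal.
      unfold lt. rewrite !length_app. lia.
    + split; simpl; intros x Hx; apply orb_false_iff in Hx as [Hx1 Hx2]; auto.
    + replace (length lt + 1 + t)%nat with (t + n + 1)%nat by lia. auto.
  - destruct (H2 ltac:(lra) Hw2 P (S (pc + length lt)) b m') as (t & m1 & s1 & a1 & R1 & Hr1 & [F1
    G1] & Q1); auto.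
    { apply (code_at_pc _ _ _ _ Hc2). lia. }
    exists (length lt + 1 + (t + 1))%nat, m1, s1, a1. split; [|split; [|split]]; auto.
    + rewrite run_add, R', run_add, R1. apply code_at_cons1 in Hcj. simpl run. simpl step.
      replace (S (pc + length lt + length (ccmd c2 (S (pc + length lt)))))%nat with (pc + (length
        lt + 1) + length (ccmd c2 (S (pc + length lt))))%nat by lia.
      rewrite Hcj. cbn [ccmd]. cbv zeta. fold lt. rewrite !length_app. cbn [length]. f_equal. lia.
    + split; simpl; intros x Hx; apply orb_false_iff in Hx as [Hx1 Hx2]; auto.
    + replace (length lt + 1 + (t + 1))%nat with (t + n + 2)%nat by lia. auto.
Qed.

(** The invariant is indexed by the iteration number, and k < N has to follow from invariant and
    guard; this yields termination and the time bound together. An iteration costs at most B for the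
    body, n for evaluating the guard, and 2 for the test and the jump back. *)
Lemma wp_while e1 e2 c s a (Q : env -> arrays -> nat -> Prop)
    (Inv : nat -> env -> arrays -> Prop) (N B : nat) :
  let n := (length (cexp e2 0) + length (cexp e1 1))%nat in
  Inv 0%nat s a ->
  (forall k s' a', Inv k s' a' -> frame c s a s' a' -> eval e1 s' < eval e2 s' ->
    (k < N)%nat /\ wp c s' a' (fun s'' a'' t => (t <= B)%nat /\ Inv (S k) s'' a'')) ->
  (forall k s' a' t, Inv k s' a' -> frame c s a s' a' -> eval e2 s' <= eval e1 s' ->
    (k <= N)%nat -> (t <= N * (B + n + 2) + n + 1)%nat -> Q s' a' t) ->
  wp (WhileLt e1 e2 c) s a Q.
Proof.
  intros n H0 HS HQ Hw P pc b m Hc Hr. simpl in Hw.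
  apply andb_true_iff in Hw as [Hw Hwc]. apply andb_true_iff in Hw as [He2 He1].
  cbn [ccmd] in Hc. cbv zeta in Hc.
  assert (Hlt : length (cexp e2 0 ++ cexp e1 1) = n) by apply length_app.
  set (lt := cexp e2 0 ++ cexp e1 1) in *.
  rewrite app_assoc in Hc. apply code_at_app in Hc as [Hc0 Hc].
  apply code_at_app in Hc as [Hcb Hcj].
  rewrite length_app in Hcb, Hcj. cbn [length] in Hcb, Hcj.
  assert (Gen : forall r k s' a' m, (k + r = N)%nat -> Inv k s' a' -> frame c s a s' a' ->
    rel b s' a' m -> exists t m' s'' a'',
      run P t (pc, m) = ((pc + length (ccmd (WhileLt e1 e2 c) pc))%nat, m') /\
      rel b s'' a'' m' /\ frame c s a s'' a'' /\ eval e2 s'' <= eval e1 s'' /\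
      exists k', (k' <= N)%nat /\ Inv k' s'' a'' /\ (t <= r * (B + n + 2) + n + 1)%nat).
  { induction r as [|r IH]; intros k s' a' m0 Hk HI HF Hr0;
    destruct (compare_correct P b s' a' m0 pc e2 e1 _ He2 He1 Hr0 Hc0) as (m' & Hr' & R');
    fold lt in R'; destruct (Rle_dec (eval e2 s') (eval e1 s')) as [Hle|Hgt].
    1,3: exists (length lt + 1)%nat, m', s', a'; split;
         [rewrite R'; cbn [ccmd]; cbv zeta; fold lt; rewrite !length_app; cbn [length]; f_equal;
           lia|];
         split; [auto|]; split; [auto|]; split; [auto|]; exists k; split; [lia|]; split; [auto|lia].
    - destruct (HS k s' a' HI HF ltac:(lra)) as [Hlt' _]. lia.
    - destruct (HS k s' a' HI HF ltac:(lra)) as [Hlt' Hb].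
      destruct (Hb Hwc P (S (pc + length lt)) b m') as (t & m1 & s1 & a1 & R1 & Hr1 & F1 & Ht &
        I1); auto.
      { apply (code_at_pc _ _ _ _ Hcb). lia. }
      destruct (IH (S k) s1 a1 m1) as (t2 & m2 & s2 & a2 & R2 & Hr2 & F2 & E2 & k' & Hk' & I2 &
        Ht2); auto; [lia|now apply (frame_trans c s a s' a')|].
      exists (length lt + 1 + (t + (1 + t2)))%nat, m2, s2, a2.
      split; [|split; [auto|split; [auto|split; [auto|exists k'; split; [auto|split; [auto|simpl;
        lia]]]]]].
      rewrite run_add, R', run_add, R1, run_add. apply code_at_cons1 in Hcj.
      rewrite <- R2. f_equal. simpl run. simpl step.
      replace (S (pc + length lt + length (ccmd c (S (pc + length lt)))))%nat with (pc + (length lt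
        + 1) + length (ccmd c (S (pc + length lt))))%nat by lia.
      now rewrite Hcj. }
  destruct (Gen N 0%nat s a m) as (t & m' & s' & a' & R1 & Hr1 & F1 & E1 & k & Hk & I1 & Ht);
    auto using frame_refl.
  exists t, m', s', a'. split; [|split; [|split]]; auto. now apply (HQ k).
Qed.

Definition For (i : nat) (e : expr) (c : cmd) : cmd :=
  Seq (Asg i (EC 0)) (WhileLt (EV i) e (Seq c (Asg i (EB BAdd (EV i) (EC 1))))).

(** The invariant must survive any change of the loop variable, whose value is supplied separately
    as [INR k]. The bound [e] is evaluated anew in each round, hence the hypothesis that it keeps
    its value in all states reachable under the frame. *)
Lemma wp_for i e c s a (Q : env -> arrays -> nat -> Prop)
    (Inv : nat -> env -> arrays -> Prop) (N B : nat) :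
  writes c i = false ->
  (forall s' a', frame (For i e c) s a s' a' -> eval e s' = INR N) ->
  Inv 0%nat s a ->
  (forall k s' a' v, Inv k s' a' -> Inv k (upd s' i v) a') ->
  (forall k s' a', (k < N)%nat -> frame (For i e c) s a s' a' -> Inv k s' a' -> s' i = INR k ->
    wp c s' a' (fun s'' a'' t => (t <= B)%nat /\ Inv (S k) s'' a'')) ->
  (forall s' a' t, frame (For i e c) s a s' a' -> Inv N s' a' ->
    (t <= (N + 1) * (B + length (cexp e 0) + 20))%nat -> Q s' a' t) ->
  wp (For i e c) s a Q.
Proof.
  intros Hi He H0 Hupd HS HQ.
  assert (FF : forall v s' a', frame (Seq c (Asg i (EB BAdd (EV i) (EC 1)))) (upd s i v) a s' a' ->
    frame (For i e c) s a s' a').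
  { intros v s' a' [F G]. split; simpl.
    - intros x Hx. apply orb_false_iff in Hx as [Hx1 Hx2]. rewrite F; [|auto].
      apply upd_other. now apply Nat.eqb_neq.
    - intros k Hk. apply G. simpl. auto. }
  apply wp_seq, wp_asg. intros v Hv. simpl in Hv.
  apply (wp_while _ _ _ _ _ _
    (fun k s' a' => (k <= N)%nat /\ s' i = INR k /\ Inv k s' a') N (B + 6)).
  - split; [lia|split; [|auto]]. now rewrite upd_same, Hv.
  - intros k s' a' (Hk & Hik & HI) F Hlt. apply FF in F. pose proof (He s' a' F) as HE.
    simpl in Hlt. rewrite HE, Hik in Hlt. apply INR_lt in Hlt. split; [auto|].
    apply wp_seq. eapply wp_conseq; [apply (HS k); auto|].
    intros s'' a'' t [F'' _] [Ht HI'']. apply wp_asg. intros w Hw. split; [simpl; lia|].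
    split; [lia|]. split; [|auto]. rewrite upd_same, Hw. simpl eval.
    rewrite F'', Hik by auto. now rewrite S_INR.
  - intros k s' a' t (Hk & Hik & HI) F Hge _ Ht. apply FF in F. pose proof (He s' a' F) as HE.
    simpl in Hge. rewrite HE, Hik in Hge. apply INR_le in Hge.
    assert (k = N) as -> by lia. apply HQ; auto. simpl in *. lia.
Qed.

(** * Plane geometry *)

Definition hyp (x y : R) : R := sqrt (x * x + y * y).

Lemma hyp_nonneg x y : 0 <= hyp x y.
Proof. apply sqrt_pos. Qed.

Lemma hyp_sq x y : hyp x y * hyp x y = x * x + y * y.
Proof. apply sqrt_sqrt. nra. Qed.

Lemma hyp_le x y h : 0 <= h -> x * x + y * y <= h * h -> hyp x y <= h.
Proof.
  intros H0 H. pose proof (hyp_nonneg x y). pose proof (hyp_sq x y). nra.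
Qed.

(** Cauchy-Schwarz, from Lagrange's identity: the squares differ by (ux y - uy x)^2. *)
Lemma dot_le_hyp ux uy x y : ux * ux + uy * uy = 1 -> ux * x + uy * y <= hyp x y.
Proof.
  intros Hu. pose proof (hyp_nonneg x y). pose proof (hyp_sq x y).
  assert ((ux * x + uy * y) * (ux * x + uy * y) <= hyp x y * hyp x y); [|nra].
  rewrite H0. pose proof (Rle_0_sqr (ux * y - uy * x)). unfold Rsqr in *.
  assert (x * x + y * y = (ux * ux + uy * uy) * (x * x + y * y)) by (rewrite Hu; ring).
  nra.
Qed.

Lemma hyp_triangle x1 y1 x2 y2 : hyp (x1 + x2) (y1 + y2) <= hyp x1 y1 + hyp x2 y2.
Proof.
  pose proof (triangle x1 y1 (- x2) (- y2) 0 0) as H. unfold dist_euc, Rsqr in H. unfold hyp.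
  replace (x1 - - x2) with (x1 + x2) in H by ring.
  replace (y1 - - y2) with (y1 + y2) in H by ring.
  replace (x1 - 0) with x1 in H by ring. replace (y1 - 0) with y1 in H by ring.
  replace (0 - - x2) with x2 in H by ring. now replace (0 - - y2) with y2 in H by ring.
Qed.

Lemma hyp_triangle_sub x y a b c d : hyp (x - a) (y - b) <= hyp (x - c) (y - d) + hyp (c - a) (d -
  b).
Proof.
  replace (x - a) with ((x - c) + (c - a)) by ring.
  replace (y - b) with ((y - d) + (d - b)) by ring. apply hyp_triangle.
Qed.

Lemma hyp_sym x y a b : hyp (x - a) (y - b) = hyp (a - x) (b - y).
Proof. unfold hyp. f_equal. ring. Qed.

Lemma hyp_small x y : -1 <= x <= 1 -> -1 <= y <= 1 -> hyp x y <= 2.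
Proof. intros. apply hyp_le; nra. Qed.

Lemma hyp_scale x y w : 0 < w -> hyp (x / w) (y / w) = hyp x y / w.
Proof.
  intros Hw. unfold hyp. apply sqrt_lem_1.
  - assert (0 <= (x / w) * (x / w)) by nra. assert (0 <= (y / w) * (y / w)) by nra. lra.
  - apply Rle_mult_inv_pos; auto using sqrt_pos.
  - replace (sqrt (x * x + y * y) / w * (sqrt (x * x + y * y) / w)) with
      (sqrt (x * x + y * y) * sqrt (x * x + y * y) / (w * w)) by (field; lra).
    rewrite sqrt_sqrt by nra. field. lra.
Qed.

Lemma abs_le_hyp x y : - hyp x y <= x <= hyp x y /\ - hyp x y <= y <= hyp x y.
Proof. pose proof (hyp_nonneg x y). pose proof (hyp_sq x y). split; split; nra. Qed.

Lemma in_disk_hyp D p : 0 <= drad D -> in_disk D p <->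
  hyp (fst p - dcx D) (snd p - dcy D) <= drad D.
Proof.
  intros H. unfold in_disk. pose proof (hyp_nonneg (fst p - dcx D) (snd p - dcy D)).
  pose proof (hyp_sq (fst p - dcx D) (snd p - dcy D)). split; intros H2; nra.
Qed.

(** For the forward direction, inclusion is tested at the point of D farthest from e, namely the
    center moved by the radius away from e; if the center is e, the direction (1,0) serves. *)
Lemma disk_subset_hyp D e rho : 0 < drad D -> 0 <= rho ->
  disk_subset D (e, rho) <-> hyp (dcx D - fst e) (dcy D - snd e) + drad D <= rho.
Proof.
  intros Hr Hrho. set (h := hyp (dcx D - fst e) (dcy D - snd e)).
  pose proof (hyp_nonneg (dcx D - fst e) (dcy D - snd e)) as Hh. fold h in Hh.
  pose proof (hyp_sq (dcx D - fst e) (dcy D - snd e)) as Hq. fold h in Hq.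
  split.
  - intros H. assert (exists ux uy, ux * ux + uy * uy = 1 /\ dcx D - fst e = h * ux /\
    dcy D - snd e = h * uy) as (ux & uy & Hu & Ex & Ey).
    { destruct (Req_dec h 0) as [E|E].
      - exists 1, 0. rewrite E in Hq |- *. rewrite Rmult_0_l in Hq.
        destruct (Rplus_sqr_eq_0 (dcx D - fst e) (dcy D - snd e)) as [-> ->]; [unfold Rsqr; lra|].
        repeat split; ring.
      - exists ((dcx D - fst e) / h), ((dcy D - snd e) / h). split; [|split; field; auto].
        replace ((dcx D - fst e) / h * ((dcx D - fst e) / h) + (dcy D - snd e) / h * ((dcy D - snd
          e) / h))
          with (((dcx D - fst e) * (dcx D - fst e) + (dcy D - snd e) * (dcy D - snd e)) / (h * h))
            by (field; auto).
        rewrite <- Hq. field. auto. }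
    assert (Hp : in_disk D (dcx D + drad D * ux, dcy D + drad D * uy)).
    { unfold in_disk; simpl. nra. }
    apply H in Hp. unfold in_disk in Hp. simpl in Hp.
    replace (dcx (e, rho)) with (fst e) in Hp by reflexivity.
    replace (dcy (e, rho)) with (snd e) in Hp by reflexivity.
    replace (drad (e, rho)) with rho in Hp by reflexivity.
    replace (dcx D + drad D * ux - fst e) with ((h + drad D) * ux) in Hp by lra.
    replace (dcy D + drad D * uy - snd e) with ((h + drad D) * uy) in Hp by lra.
    assert ((h + drad D) * (h + drad D) <= rho * rho) by nra. nra.
  - intros H p Hp. apply in_disk_hyp in Hp; [|lra]. apply in_disk_hyp; [auto|].
    unfold dcx, dcy, drad in *. simpl.
    pose proof (hyp_triangle_sub (fst p) (snd p) (fst e) (snd e) (fst (fst D)) (snd (fst D))).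
    unfold h in *. lra.
Qed.

(** * Directions *)

(* The half circle to the right of the origin is parametrised by t in [-1,1], the
   tangent of the half angle, discretised as t = i/K - 1 with i <= 2K; index
   k = i + (2K+1) f, f = 0, 1, selects (-1)^f times the i-th of these unit vectors. *)
Definition dirf (K k : R) : R := IZR (floorZ (rdiv k (2 * K + 1))).
Definition dirt (K k : R) : R := rdiv (k - (2 * K + 1) * dirf K k - K) K.
Definition dirx (K k : R) : R :=
  rdiv ((1 - 2 * dirf K k) * (1 - dirt K k * dirt K k)) (1 + dirt K k * dirt K k).
Definition diry (K k : R) : R :=
  rdiv ((1 - 2 * dirf K k) * (2 * dirt K k)) (1 + dirt K k * dirt K k).

Lemma dir_eval (K i : nat) (f : bool) : (i <= 2 * K)%nat -> (1 <= K)%nat ->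
  let k := (if f then i + (2 * K + 1) else i)%nat in
  let t := INR i / INR K - 1 in let s := if f then -1 else 1 in
  dirx (INR K) (INR k) = s * (1 - t * t) / (1 + t * t) /\
  diry (INR K) (INR k) = s * (2 * t) / (1 + t * t).
Proof.
  intros Hi HK k t s.
  assert (HK' : 1 <= INR K) by (change 1 with (INR 1); now apply le_INR).
  assert (Hi' : 0 <= INR i <= 2 * INR K).
  { split; [apply pos_INR|]. replace (2 * INR K) with (INR (2 * K)) by (rewrite mult_INR; simpl;
    ring). now apply le_INR. }
  assert (Hf : dirf (INR K) (INR k) = if f then 1 else 0).
  { unfold dirf, k. rewrite rdiv_div by lra. 
    destruct f; rewrite ?plus_INR, ?mult_INR; [rewrite (floorZ_unique _ 1)|rewrite (floorZ_unique _
      0)]; auto; simpl INR.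
    - replace ((INR i + ((1 + 1) * INR K + 1)) / (2 * INR K + 1)) with (INR i / (2 * INR K + 1) +
      1) by (field; lra).
      assert (0 <= INR i / (2 * INR K + 1) < 1); [|lra].
      split; [apply Rle_mult_inv_pos; lra|].
      apply (Rmult_lt_reg_r (2 * INR K + 1)); [lra|].
      replace (INR i / (2 * INR K + 1) * (2 * INR K + 1)) with (INR i) by (field; lra). lra.
    - assert (0 <= INR i / (2 * INR K + 1) < 1); [|lra].
      split; [apply Rle_mult_inv_pos; lra|].
      apply (Rmult_lt_reg_r (2 * INR K + 1)); [lra|].
      replace (INR i / (2 * INR K + 1) * (2 * INR K + 1)) with (INR i) by (field; lra). lra. }
  assert (Ht : dirt (INR K) (INR k) = t).
  { unfold dirt. rewrite Hf, rdiv_div by lra. unfold k, t.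
    destruct f; rewrite ?plus_INR, ?mult_INR; simpl INR; field; lra. }
  unfold dirx, diry. rewrite Hf, Ht, !rdiv_div by nra.
  unfold s. destruct f; split; f_equal; ring.
Qed.

Lemma dir_index K k : (k < 4 * K + 2)%nat ->
  exists i (f : bool), (i <= 2 * K)%nat /\ k = (if f then i + (2 * K + 1) else i)%nat.
Proof.
  intros H. destruct (Nat.le_gt_cases k (2 * K)) as [H1|H1].
  - exists k, false. auto.
  - exists (k - (2 * K + 1))%nat, true. lia.
Qed.

Lemma dir_unit K k : (1 <= K)%nat -> (k < 4 * K + 2)%nat ->
  dirx (INR K) (INR k) * dirx (INR K) (INR k) + diry (INR K) (INR k) * diry (INR K) (INR k) = 1.
Proof.
  intros HK Hk. destruct (dir_index K k Hk) as (i & f & Hi & E).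
  pose proof (dir_eval K i f Hi HK) as H. cbv zeta in H. rewrite <- E in H. destruct H as [-> ->].
  set (t := INR i / INR K - 1). assert (1 + t * t <> 0) by nra.
  destruct f; field; auto.
Qed.

(** If t and u are the tangents of two half angles, the cosine of the angle between the directions
    is 1 - 2 (t - u)^2 / ((1 + t^2)(1 + u^2)). Rounding t down to a multiple of 1/K gives |t - u| <=
    1/K, hence a cosine of at least 1 - 2/K^2. *)
Lemma dir_cover K x y : (1 <= K)%nat ->
  exists k, (k < 4 * K + 2)%nat /\
    (1 - 2 / INR (K * K)) * hyp x y <= dirx (INR K) (INR k) * x + diry (INR K) (INR k) * y.
Proof.
  intros HK.
  assert (HK' : 1 <= INR K) by (change 1 with (INR 1); now apply le_INR).
  pose proof (hyp_nonneg x y) as Hh. pose proof (hyp_sq x y) as Hq. set (h := hyp x y) in *.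
  destruct (Req_dec h 0) as [E|E].
  { exists 0%nat. split; [lia|]. assert (x = 0) by nra. assert (y = 0) by nra. subst. nra. }
  set (f := if Rle_dec 0 x then false else true). set (s := if f then -1 else 1).
  assert (Hs : s * s = 1) by (unfold s; destruct f; ring).
  assert (Hx : 0 <= s * x) by (unfold s, f; destruct (Rle_dec 0 x); lra).
  (* The sign s turns the vector into the right half plane; there tan(theta/2) = sin theta / (1 +
     cos theta) lies in [-1,1]. *)
  set (T := h + s * x). set (t := s * y / T).
  assert (HT : 0 < T) by (unfold T; lra).
  assert (Hy2 : (s * y) * (s * y) = h * h - (s * x) * (s * x)) by nra.
  assert (HtT : s * y = t * T) by (unfold t; field; lra).
  assert (H2h : 2 * h = T * (1 + t * t)).
  { apply (Rmult_eq_reg_r T); [|lra].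
    replace (T * (1 + t * t) * T) with (T * T + (t * T) * (t * T)) by ring.
    rewrite <- HtT, Hy2. unfold T. ring. }
  assert (Hsx : 2 * (s * x) = T * (1 - t * t)) by (unfold T in *; lra).
  assert (Ht2 : 0 <= 1 - t * t) by (apply (Rmult_le_reg_l T); lra).
  assert (Ht : -1 <= t <= 1) by (clearbody t; split; nra).
  destruct (floorZ_spec (t * INR K + INR K)) as [F1 F2].
  set (z := floorZ (t * INR K + INR K)) in *.
  assert (Hz0 : (-1 < z)%Z) by (apply lt_IZR; simpl; nra).
  set (i := Z.to_nat z). assert (Hiz : INR i = IZR z) by (unfold i; rewrite INR_IZR_INZ,
    Z2Nat.id by lia; auto).
  assert (Hi : (i <= 2 * K)%nat).
  { apply INR_le. rewrite mult_INR, Hiz. simpl INR. nra. }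
  exists (if f then i + (2 * K + 1) else i)%nat. split; [destruct f; lia|].
  pose proof (dir_eval K i f Hi HK) as H. cbv zeta in H. destruct H as [-> ->]. fold s.
  set (u := INR i / INR K - 1). assert (Hu : 0 <= (t - u) * INR K <= 1).
  { unfold u. rewrite Hiz. replace ((t - (IZR z / INR K - 1)) * INR K) with (t * INR K + INR K -
    IZR z) by (field; lra). lra. }
  rewrite mult_INR. 
  replace (s * (1 - u * u) / (1 + u * u) * x + s * (2 * u) / (1 + u * u) * y)
    with (((1 - u * u) * (2 * (s * x)) + 4 * u * (s * y)) / (2 * (1 + u * u))) by (field; nra).
  rewrite Hsx, HtT.
  replace h with (T * (1 + t * t) / 2) by lra.
  apply (Rmult_le_reg_r (2 * (1 + u * u) * (INR K * INR K))); [assert (0 < 1 + u * u) by nra;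
    assert (0 < INR K * INR K) by nra; nra|].
  replace (((1 - u * u) * (T * (1 - t * t)) + 4 * u * (t * T)) / (2 * (1 + u * u)) * (2 * (1 + u *
    u) * (INR K * INR K)))
    with (T * (INR K * INR K) * ((1 - u * u) * (1 - t * t) + 4 * u * t)) by (field; nra).
  replace ((1 - 2 / (INR K * INR K)) * (T * (1 + t * t) / 2) * (2 * (1 + u * u) * (INR K * INR K)))
    with (T * ((INR K * INR K - 2) * ((1 + t * t) * (1 + u * u)))) by (field; nra).
  replace (T * (INR K * INR K) * ((1 - u * u) * (1 - t * t) + 4 * u * t)) with
    (T * ((INR K * INR K) * ((1 + t * t) * (1 + u * u)) - 2 * (((t - u) * INR K) * ((t - u) * INR
      K)))) by ring.
  apply Rmult_le_compat_l; [lra|].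
  assert (((t - u) * INR K) * ((t - u) * INR K) <= 1) by nra.
  assert (1 <= (1 + t * t) * (1 + u * u)) by nra. nra.
Qed.

(** * Feasibility of a system of half-planes *)

Definition meets (M : nat) (ux uy g : nat -> R) (x y : R) : Prop :=
  forall k, (k < M)%nat -> g k <= ux k * x + uy k * y.

(* The foot point of the j-th boundary line moved by s along the line. *)
Definition linex (ux uy g : nat -> R) (j : nat) (s : R) : R := g j * ux j - s * uy j.
Definition liney (ux uy g : nat -> R) (j : nat) (s : R) : R := g j * uy j + s * ux j.

(** The ratio test of the simplex method: j minimises p / q among the indices with q > 0, with
    denominators cleared. *)
Lemma least_ratio (M : nat) (p : nat -> R) (q : nat -> R) :
  (exists k, (k < M)%nat /\ 0 < q k) ->
  exists j, (j < M)%nat /\ 0 < q j /\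
    forall k, (k < M)%nat -> 0 < q k -> p j * q k <= p k * q j.
Proof.
  induction M as [|M IH]; intros (k & Hk & Hq); [lia|].
  destruct (Rle_dec (q M) 0) as [HM|HM].
  - destruct IH as (j & Hj & Hqj & Hmin).
    { exists k. split; auto. assert (k <> M) by (intros ->; lra). lia. }
    exists j. split; [lia|split; auto]. intros i Hi Hqi. assert (i <> M) by (intros ->; lra).
    apply Hmin; auto; lia.
  - destruct (classic (exists k, (k < M)%nat /\ 0 < q k)) as [Hex|Hno].
    + destruct (IH Hex) as (j & Hj & Hqj & Hmin).
      destruct (Rle_dec (p j * q M) (p M * q j)) as [Hc|Hc].
      * exists j. split; [lia|split; auto]. intros i Hi Hqi.
        destruct (Nat.eq_dec i M) as [->|]; auto. apply Hmin; auto; lia.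
      * exists M. split; [lia|split; [lra|]]. intros i Hi Hqi.
        destruct (Nat.eq_dec i M) as [->|]; [lra|].
        specialize (Hmin i ltac:(lia) Hqi).
        apply (Rmult_le_reg_r (q j)); [auto|].
        apply Rle_trans with (p j * q i * q M); [nra|]. nra.
    + exists M. split; [lia|split; [lra|]]. intros i Hi Hqi.
      destruct (Nat.eq_dec i M) as [->|]; [lra|]. exfalso. apply Hno. exists i. split; [lia|auto].
Qed.

(* From a feasible point, move against the direction u_0 until a constraint becomes tight. *)
Lemma meets_on_boundary M ux uy g x y C :
  (0 < M)%nat -> 0 <= C ->
  (forall k, (k < M)%nat -> ux k * ux k + uy k * uy k = 1) ->
  (forall x y, exists k, (k < M)%nat /\ hyp x y / 2 <= ux k * x + uy k * y) ->
  (forall k, (k < M)%nat -> - C <= g k) ->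
  meets M ux uy g x y ->
  exists j s, (j < M)%nat /\ - (2 * C) <= s <= 2 * C /\
    meets M ux uy g (linex ux uy g j s) (liney ux uy g j s).
Proof.
  intros HM HC Hu Hcov Hg Hf.
  destruct (least_ratio M (fun k => ux k * x + uy k * y - g k) (fun k =>
    ux k * ux 0%nat + uy k * uy 0%nat))
    as (j & Hj & Hqj & Hmin).
  { exists 0%nat. split; [auto|]. specialize (Hu 0%nat HM). lra. }
  set (qj := ux j * ux 0%nat + uy j * uy 0%nat) in *.
  set (t := (ux j * x + uy j * y - g j) / qj).
  set (x' := x - t * ux 0%nat). set (y' := y - t * uy 0%nat).
  assert (Ht0 : 0 <= t).
  { unfold t. specialize (Hf j Hj). apply Rle_mult_inv_pos; lra. }
  assert (Htq : t * qj = ux j * x + uy j * y - g j) by (unfold t; field; lra).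
  assert (Hf' : meets M ux uy g x' y').
  { intros k Hk. unfold x', y'. specialize (Hmin k Hk). cbv beta in Hmin.
    set (qk := ux k * ux 0%nat + uy k * uy 0%nat) in *.
    replace (ux k * (x - t * ux 0%nat) + uy k * (y - t * uy 0%nat)) with (ux k * x + uy k * y - t *
      qk) by (unfold qk; ring).
    specialize (Hf k Hk).
    destruct (Rle_dec qk 0) as [Hle|Hgt]; [nra|].
    specialize (Hmin ltac:(lra)). rewrite <- Htq in Hmin.
    assert (t * qk <= ux k * x + uy k * y - g k); [|lra].
    apply (Rmult_le_reg_r qj); auto. lra. }
  assert (Hj' : ux j * x' + uy j * y' = g j).
  { unfold x', y'. replace (ux j * (x - t * ux 0%nat) + uy j * (y - t * uy 0%nat)) with (ux j * x +
    uy j * y - t * qj) by (unfold qj; ring). lra. }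
  pose proof (Hu j Hj) as Huj.
  (* A direction close to that of -(x', y') has inner product at most -|(x', y')| / 2 with the
     point, while its constraint demands at least -C. *)
  assert (HB : hyp x' y' <= 2 * C).
  { destruct (Hcov (- x') (- y')) as (k & Hk & Hc). specialize (Hf' k Hk). specialize (Hg k Hk).
    replace (hyp (- x') (- y')) with (hyp x' y') in Hc by (unfold hyp; f_equal; ring). lra. }
  (* The component of the point along the line, bounded in absolute value by its norm. *)
  exists j, (ux j * y' - uy j * x'). split; [auto|split].
  - pose proof (dot_le_hyp (- uy j) (ux j) x' y' ltac:(lra)).
    pose proof (dot_le_hyp (uy j) (- ux j) x' y' ltac:(lra)). lra.
  - replace (linex ux uy g j (ux j * y' - uy j * x')) with x'.
    + replace (liney ux uy g j (ux j * y' - uy j * x')) with y'; auto.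
      unfold liney. rewrite <- Hj'. 
      replace ((ux j * x' + uy j * y') * uy j + (ux j * y' - uy j * x') * ux j) with ((ux j * ux j
        + uy j * uy j) * y') by ring.
      rewrite Huj. ring.
    + unfold linex. rewrite <- Hj'. 
      replace ((ux j * x' + uy j * y') * ux j - (ux j * y' - uy j * x') * uy j) with ((ux j * ux j
        + uy j * uy j) * x') by ring.
      rewrite Huj. ring.
Qed.

(** * The decision procedure *)

(* [v] is the running maximum, started at 0, of the values satisfying [P]. *)
Definition ismax (P : R -> Prop) (v : R) : Prop :=
  (forall x, P x -> x <= v) /\ (v = 0 \/ P v).

Lemma ismax_ext (P P' : R -> Prop) v : (forall x, P x <-> P' x) -> ismax P v -> ismax P' v.
Proof.
  intros H [H1 H2]. split.
  - intros x Hx. now apply H1, H.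
  - destruct H2; [auto|]. right. now apply H.
Qed.

Lemma ismax_union (P P' Q : R -> Prop) v v' :
  (forall x, Q x <-> P x \/ P' x) -> ismax P v -> ismax P' v' ->
  ismax Q (if Rle_dec v v' then v' else v).
Proof.
  intros H [H1 H2] [H3 H4]. destruct (Rle_dec v v') as [Hle|Hgt]; split.
  - intros x Hx. apply H in Hx as [Hx|Hx]; auto. apply Rle_trans with v; auto.
  - destruct H4; auto. right. apply H. auto.
  - intros x Hx. apply H in Hx as [Hx|Hx]; auto. apply Rle_trans with v'; auto. lra.
  - destruct H2; auto. right. apply H. auto.
Qed.

Lemma ismax_single x : ismax (eq x) x.
Proof. split; auto. intros y ->. lra. Qed.

Lemma ismax_empty (P : R -> Prop) : (forall x, ~ P x) -> ismax P 0.
Proof. intros H. split; auto. intros x Hx. now apply H in Hx. Qed.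

(* A family of disks in units of the grid width w: K is the discretisation
   parameter, N = K^2 the radius trivially attained with centers 0 and q. *)
Record inst : Type := Inst {
  iK : nat; iX : nat -> R; iY : nat -> R; iR : nat -> R;
  iqx : R; iqy : R; irep : nat -> Prop }.

Definition iN (I : inst) : nat := (iK I * iK I)%nat.
Definition iM (I : inst) : nat := (4 * iK I + 2)%nat.
(** An offset exceeding the norm of every represented center, so that [ext I j i + iB I] is
    nonnegative and a maximum may start at 0. *)
Definition iB (I : inst) : R := hyp (iqx I) (iqy I) + 2 * INR (iN I).
Definition ux (I : inst) (k : nat) : R := dirx (INR (iK I)) (INR k).
Definition uy (I : inst) (k : nat) : R := diry (INR (iK I)) (INR k).
(** The support function of disk i in direction j. *)
Definition ext (I : inst) (j i : nat) : R := ux I j * iX I i + uy I j * iY I i + iR I i.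

(* For admissible arguments the thresholds lie between 1 and 6N - 1, so that clipping the
   buckets to [0, 6N - 1] leaves comparisons between the two unchanged. *)
Definition bucket (I : inst) (k i : nat) : nat :=
  Z.to_nat (Z.max 0 (Z.min (floorZ (ext I k i) + (2 * Z.of_nat (iN I) + 2)) (6 * Z.of_nat (iN I) -
    1))).

(** The shift is larger by 1 than the one in [bucket]: a disk reaching the threshold has a strictly
    larger floor and so really exceeds rho in direction k, whereas a disk below it exceeds rho by at
    most 1. *)
Definition thresh (I : inst) (a b rho : R) (k : nat) : nat :=
  Z.to_nat (floorZ (rho + ux I k * a + uy I k * b) + (2 * Z.of_nat (iN I) + 3)).

Definition rest (I : inst) (a b rho : R) (i : nat) : Prop :=
  irep I i /\ exists k, (k < iM I)%nat /\ (thresh I a b rho k <= bucket I k i)%nat.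

(** Right-hand side of the j-th half-plane for the second center; subtracting [iB I] undoes the
    offset stored in H. *)
Definition slack (I : inst) (rho : R) (H : nat -> R) (j : nat) : R := H j - iB I - rho.

Definition isH (I : inst) (a b rho : R) (H : nat -> R) : Prop :=
  forall j, (j < iM I)%nat ->
    ismax (fun v => exists i, rest I a b rho i /\ v = ext I j i + iB I) (H j).

(** rho runs through N - d - 1 for d <= N. The value -1 is included because it is the radius at
    which every test has to fail. *)
Definition in_range (I : inst) (a b rho : R) : Prop :=
  - INR (iN I) <= a <= INR (iN I) /\ - INR (iN I) <= b <= INR (iN I) /\
  -1 <= rho <= INR (iN I) - 1.

Definition good (I : inst) : Prop :=
  (8 <= iK I)%nat /\
  forall i, irep I i -> 0 < iR I i /\
    (hyp (iX I i) (iY I i) + iR I i <= INR (iN I) \/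
     hyp (iX I i - iqx I) (iY I i - iqy I) + iR I i <= INR (iN I)).

Lemma good_N I : good I -> 64 <= INR (iN I) /\ (64 <= iN I)%nat.
Proof.
  intros [HK _]. assert (64 <= iN I)%nat by (unfold iN; nia). split; auto.
  change 64 with (IZR (Z.of_nat 64)). rewrite <- INR_IZR_INZ. now apply le_INR.
Qed.

Lemma u_unit I k : good I -> (k < iM I)%nat -> ux I k * ux I k + uy I k * uy I k = 1.
Proof. intros [HK _] Hk. apply dir_unit; auto; lia. Qed.

Lemma u_cover I x y : good I ->
  exists k, (k < iM I)%nat /\ (1 - 2 / INR (iN I)) * hyp x y <= ux I k * x + uy I k * y.
Proof. intros [HK _]. apply dir_cover; lia. Qed.

Lemma thresh_range I a b rho k : good I -> in_range I a b rho -> (k < iM I)%nat ->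
  (1 <= floorZ (rho + ux I k * a + uy I k * b) + (2 * Z.of_nat (iN I) + 3)
     <= 6 * Z.of_nat (iN I) - 1)%Z.
Proof.
  intros HI (Ha & Hb & Hr) Hk. destruct (good_N I HI) as [HN HNn].
  pose proof (u_unit I k HI Hk) as Hu.
  assert (Hd : - (2 * INR (iN I)) <= ux I k * a + uy I k * b <= 2 * INR (iN I)).
  { pose proof (dot_le_hyp _ _ a b Hu). pose proof (dot_le_hyp _ _ (-a) (-b) Hu).
    assert (hyp a b <= 2 * INR (iN I)) by (apply hyp_le; nra).
    assert (hyp (-a) (-b) <= 2 * INR (iN I)) by (apply hyp_le; nra). lra. }
  destruct (floorZ_spec (rho + ux I k * a + uy I k * b)) as [F1 F2].
  rewrite INR_IZR_INZ in *. set (z := floorZ _) in *. set (n := Z.of_nat (iN I)) in *.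
  assert (-2 * n - 2 < z)%Z by (apply lt_IZR; rewrite minus_IZR, mult_IZR; lra).
  assert (z < 3 * n)%Z by (apply lt_IZR; rewrite mult_IZR; lra).
  assert (64 <= n)%Z by lia. lia.
Qed.

Lemma thresh_spec I a b rho k i : good I -> in_range I a b rho -> (k < iM I)%nat ->
  if (thresh I a b rho k <=? bucket I k i)%nat
  then rho < ux I k * (iX I i - a) + uy I k * (iY I i - b) + iR I i
  else ux I k * (iX I i - a) + uy I k * (iY I i - b) + iR I i <= rho + 1.
Proof.
  intros HI Hr Hk. pose proof (thresh_range I a b rho k HI Hr Hk) as HT.
  replace (ux I k * (iX I i - a) + uy I k * (iY I i - b) + iR I i) with
    (ext I k i - (ux I k * a + uy I k * b)) by (unfold ext; ring).
  unfold thresh, bucket.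
  destruct (floorZ_spec (rho + ux I k * a + uy I k * b)) as [F1 F2].
  destruct (floorZ_spec (ext I k i)) as [F3 F4].
  set (z := floorZ (rho + _ + _)) in *. set (z' := floorZ (ext I k i)) in *.
  destruct (Nat.leb_spec (Z.to_nat (z + (2 * Z.of_nat (iN I) + 3)))
    (Z.to_nat (Z.max 0 (Z.min (z' + (2 * Z.of_nat (iN I) + 2)) (6 * Z.of_nat (iN I) - 1))))) as
      [Hc|Hc].
  - assert (z + 1 <= z')%Z as Hz by lia. apply IZR_le in Hz. rewrite plus_IZR in Hz. lra.
  - assert (z' <= z)%Z as Hz by lia. apply IZR_le in Hz. lra.
Qed.

(** Since 1 - 2/N >= 1/2, the hypothesis gives h <= 2 c <= 2 N, so the lost term (2/N) h is at most
    4. *)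
Lemma shrink_bound I h r c : good I -> 0 <= h -> 0 < r -> c <= INR (iN I) ->
  (1 - 2 / INR (iN I)) * h + r <= c -> h + r <= c + 4.
Proof.
  intros HI Hh Hr Hc H. destruct (good_N I HI) as [HN _].
  set (d := 2 / INR (iN I)) in *. assert (Hd : d * INR (iN I) = 2) by (unfold d; field; lra).
  assert (0 <= d <= 1 / 2) by nra. assert (h <= 2 * INR (iN I)) by nra. nra.
Qed.

(** A disk outside [rest] stays below the threshold in every direction, in particular in the one
    that nearly attains the norm of the difference of centers. *)
Lemma not_rest_near I a b rho i : good I -> in_range I a b rho -> irep I i ->
  ~ rest I a b rho i -> (1 - 2 / INR (iN I)) * hyp (iX I i - a) (iY I i - b) + iR I i <= rho + 1.
Proof.
  intros HI Hr Hi Hn. destruct (u_cover I (iX I i - a) (iY I i - b) HI) as (k & Hk & Hc).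
  pose proof (thresh_spec I a b rho k i HI Hr Hk) as HT.
  destruct (Nat.leb_spec (thresh I a b rho k) (bucket I k i)) as [Hle|Hlt]; [|lra].
  exfalso. apply Hn. split; eauto.
Qed.

Lemma rest_near I a b rho H x y i : good I -> isH I a b rho H ->
  meets (iM I) (ux I) (uy I) (slack I rho H) x y -> rest I a b rho i ->
  (1 - 2 / INR (iN I)) * hyp (iX I i - x) (iY I i - y) + iR I i <= rho.
Proof.
  intros HI HH Hm Hi. destruct (u_cover I (iX I i - x) (iY I i - y) HI) as (k & Hk & Hc).
  specialize (Hm k Hk). unfold slack in Hm. destruct (HH k Hk) as [Hmax _].
  specialize (Hmax (ext I k i + iB I)). unfold ext in Hmax.
  assert (ux I k * iX I i + uy I k * iY I i + iR I i + iB I <= H k) by (apply Hmax; eauto). lra.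
Qed.

(** The 5 is made of 1 from integer thresholds and 4 from [shrink_bound]. *)
Definition covers (I : inst) (a b x y rho : R) : Prop :=
  forall i, irep I i -> hyp (iX I i - a) (iY I i - b) + iR I i <= rho + 5 \/
    hyp (iX I i - x) (iY I i - y) + iR I i <= rho + 5.

Lemma test_sound I a b rho H x y : good I -> in_range I a b rho -> isH I a b rho H ->
  meets (iM I) (ux I) (uy I) (slack I rho H) x y -> covers I a b x y rho.
Proof.
  intros HI Hr HH Hm i Hi. destruct (HI) as [_ Hg]. destruct (Hg i Hi) as [Hri _].
  destruct (Hr) as (_ & _ & Hrho).
  destruct (classic (rest I a b rho i)) as [Hc|Hc].
  - right. pose proof (rest_near I a b rho H x y i HI HH Hm Hc).
    pose proof (shrink_bound I _ _ rho HI (hyp_nonneg (iX I i - x) (iY I i - y)) Hri). lra.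
  - left. pose proof (not_rest_near I a b rho i HI Hr Hi Hc).
    pose proof (shrink_bound I _ _ (rho + 1) HI (hyp_nonneg (iX I i - a) (iY I i - b)) Hri). lra.
Qed.

(** Even with the rounding allowance the available radius is rho + 1 = 0, too small for a disk of
    positive radius. This stops the lowering of the radius after at most N successes. *)
Lemma test_nonneg I a b H x y i : good I -> in_range I a b (-1) -> isH I a b (-1) H ->
  irep I i -> ~ meets (iM I) (ux I) (uy I) (slack I (-1) H) x y.
Proof.
  intros HI Hr HH Hi Hm. destruct (HI) as [_ Hg]. destruct (Hg i Hi) as [Hri _].
  destruct (good_N I HI) as [HN _].
  assert (0 <= 1 - 2 / INR (iN I)).
  { assert (2 / INR (iN I) <= 1); [|lra]. apply (Rmult_le_reg_r (INR (iN I))); [lra|].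
    replace (2 / INR (iN I) * INR (iN I)) with 2 by (field; lra). lra. }
  destruct (classic (rest I a b (-1) i)) as [Hc|Hc].
  - pose proof (rest_near I a b (-1) H x y i HI HH Hm Hc).
    pose proof (Rmult_le_pos _ _ H0 (hyp_nonneg (iX I i - x) (iY I i - y))). lra.
  - pose proof (not_rest_near I a b (-1) i HI Hr Hi Hc).
    pose proof (Rmult_le_pos _ _ H0 (hyp_nonneg (iX I i - a) (iY I i - b))). lra.
Qed.

(** The grid point (a, b) is within distance 2 of (x1, y1), so disks in the first optimal disk lie
    within rho of (a, b) and cannot be in [rest]. All remaining disks lie in the second one, whose
    center then satisfies every half-plane. *)
Lemma test_complete I a b rho H x1 y1 x2 y2 rho0 :
  good I -> in_range I a b rho -> isH I a b rho H ->
  0 <= rho0 -> rho0 + 2 <= rho -> -1 <= a - x1 <= 1 -> -1 <= b - y1 <= 1 ->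
  (forall i, irep I i -> hyp (iX I i - x1) (iY I i - y1) + iR I i <= rho0 \/
    hyp (iX I i - x2) (iY I i - y2) + iR I i <= rho0) ->
  exists x y, meets (iM I) (ux I) (uy I) (slack I rho H) x y.
Proof.
  intros HI Hr HH H0 Hrho Ha Hb Hcov. destruct (good_N I HI) as [HN _].
  assert (HB : 0 <= iB I) by (unfold iB; pose proof (hyp_nonneg (iqx I) (iqy I)); lra).
  assert (Hrest : forall i, rest I a b rho i -> hyp (iX I i - x2) (iY I i - y2) + iR I i <= rho0).
  { intros i [Hi (k & Hk & Hle)]. destruct (Hcov i Hi) as [Hc|Hc]; auto. exfalso.
    pose proof (thresh_spec I a b rho k i HI Hr Hk) as HT.
    apply Nat.leb_le in Hle. rewrite Hle in HT.
    pose proof (dot_le_hyp _ _ (iX I i - a) (iY I i - b) (u_unit I k HI Hk)).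
    pose proof (hyp_triangle_sub (iX I i) (iY I i) a b x1 y1).
    pose proof (hyp_small (x1 - a) (y1 - b)). lra. }
  destruct (classic (exists i, rest I a b rho i)) as [(i & Hi)|Hno].
  - exists x2, y2. intros j Hj. unfold slack. destruct (HH j Hj) as [_ [E|(i' & Hi' & E)]].
    (* [ismax] also admits the starting value 0. The constraint then follows from |(x2, y2)| <= iB +
       rho, because some disk covered from (x2, y2) lies within N of 0 or of q. *)
    + rewrite E. pose proof (dot_le_hyp _ _ (- x2) (- y2) (u_unit I j HI Hj)).
      pose proof (Hrest i Hi). destruct Hi as [Hi _]. destruct HI as [_ Hg].
      destruct (Hg i Hi) as [Hri Hc]. 
      assert (hyp (0 - x2) (0 - y2) <= iB I + rho).
      { unfold iB. pose proof (hyp_nonneg (iqx I) (iqy I)). destruct (Hr) as (_ & _ & Hr').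
        pose proof (hyp_triangle_sub 0 0 x2 y2 (iX I i) (iY I i)) as T1.
        rewrite (hyp_sym 0 0 (iX I i) (iY I i)) in T1.
        pose proof (hyp_triangle_sub (iX I i) (iY I i) 0 0 (iqx I) (iqy I)) as T2.
        rewrite !Rminus_0_r in T1. rewrite !Rminus_0_r in T2. destruct Hc; lra. }
      replace (0 - x2) with (- x2) in * by ring. replace (0 - y2) with (- y2) in * by ring. lra.
    + rewrite E. unfold ext.
      pose proof (dot_le_hyp _ _ (iX I i' - x2) (iY I i' - y2) (u_unit I j HI Hj)).
      pose proof (Hrest i' Hi'). lra.
  - exists 0, 0. intros j Hj. unfold slack. destruct (HH j Hj) as [_ [E|(i' & Hi' & E)]].
    + rewrite E. lra.
    + exfalso. eauto.
Qed.

(** * Guarded assignments and concrete syntax *)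

Arguments upd m i v / k.

Definition CAsg (e1 e2 : expr) (x : nat) (e : expr) : cmd := IfLe e1 e2 (Asg x e) Skip.
Definition CSt (e1 e2 : expr) (k : nat) (e e' : expr) : cmd := IfLe e1 e2 (St k e e') Skip.

(** When the test fails the old value counts as written back, so both branches end in a state of the
    same form and symbolic execution does not fork. [wp_cst] does this for array cells. *)
Lemma wp_casg e1 e2 x e s a (Q : env -> arrays -> nat -> Prop) :
  (forall v t, v = (if Rle_dec (eval e1 s) (eval e2 s) then eval e s else s x) ->
    (t <= length (cexp e 0) + length (cexp e1 0) + length (cexp e2 1) + 4)%nat ->
    Q (upd s x v) a t) ->
  wp (CAsg e1 e2 x e) s a Q.
Proof.
  intros H. apply wp_if; intros Hc.
  - apply wp_asg. intros v Hv. apply H; [|lia]. destruct (Rle_dec (eval e1 s) (eval e2 s)); auto;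
    lra.
  - apply wp_skip. replace s with (upd s x (s x)) at 1.
    + apply H; [|lia]. destruct (Rle_dec (eval e1 s) (eval e2 s)); auto; lra.
    + apply functional_extensionality. intros y. unfold upd.
      destruct (Nat.eqb_spec y x); congruence.
Qed.

Lemma wp_cst e1 e2 k e e' s a i (Q : env -> arrays -> nat -> Prop) :
  eval e s = INR i ->
  (forall t, 
    (t <= length (cexp e 0) + length (cexp e' 1) + length (cexp e1 0) + length (cexp e2 1) + 8)%nat
      ->
    Q s (aupd a k i (if Rle_dec (eval e1 s) (eval e2 s) then eval e' s else a k i)) t) ->
  wp (CSt e1 e2 k e e') s a Q.
Proof.
  intros Hi H. apply wp_if; intros Hc.
  - apply (wp_st _ _ _ _ _ i); auto.
    destruct (Rle_dec (eval e1 s) (eval e2 s)); [|lra]. apply H. lia.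
  - apply wp_skip. destruct (Rle_dec (eval e1 s) (eval e2 s)); [lra|].
    replace a with (aupd a k i (a k i)) at 1.
    + apply H. lia.
    + apply functional_extensionality. intros y. unfold aupd, upd.
      destruct (Nat.eqb_spec y k) as [->|]; auto.
      apply functional_extensionality. intros j. destruct (Nat.eqb_spec j i); congruence.
Qed.

Declare Scope expr_scope.
Delimit Scope expr_scope with E.
Bind Scope expr_scope with expr.
Notation "a + b" := (EB BAdd a b) : expr_scope.
Notation "a - b" := (EB BSub a b) : expr_scope.
Notation "a * b" := (EB BMul a b) : expr_scope.
Notation "a / b" := (EB BDiv a b) : expr_scope.
Notation "$ x" := (EV x) (at level 5, format "$ x") : expr_scope.
Notation "# z" := (EC z) (at level 5, format "# z") : expr_scope.
Arguments Asg x%_nat_scope e%_E.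
Arguments Ld x%_nat_scope a%_nat_scope e%_E.
Arguments St a%_nat_scope (e1 e2)%_E.
Arguments IfLe (e1 e2)%_E c1 c2.
Arguments WhileLt (e1 e2)%_E c.
Arguments CAsg (e1 e2)%_E x%_nat_scope e%_E.
Arguments CSt (e1 e2)%_E k%_nat_scope (e e')%_E.
Arguments For i%_nat_scope e%_E c.
Infix "::=" := Asg (at level 60, no associativity).
Infix ";;" := Seq (at level 65, right associativity).

(* vpk: the packed input n + n / (n + eps); vM, vL, vS: numbers of directions, of grid
   columns and of buckets; (vpx, vpy), (vqx, vqy): the two approximate centers, the
   second relative to the first; vd: number of successful tests, the radius under test
   being N - vd - 1; (vsx, vsy), (vtx, vty): the centers found by the last of them. *)
Notation vpk := 0%nat. Notation vn := 5%nat. Notation vK := 6%nat. Notation vN := 7%nat.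
Notation vM := 8%nat. Notation vw := 9%nat. Notation vpx := 10%nat. Notation vpy := 11%nat.
Notation vqx := 12%nat. Notation vqy := 13%nat. Notation vB := 14%nat. Notation vL := 15%nat.
Notation vS := 16%nat. Notation vrm := 17%nat. Notation vdl := 18%nat. Notation vi := 20%nat.
Notation vx := 21%nat. Notation vy := 22%nat. Notation vr := 23%nat. Notation vd1 := 24%nat.
Notation vd2 := 25%nat. Notation vt := 26%nat. Notation vp := 27%nat. Notation vk := 30%nat.
Notation vj := 31%nat. Notation vux := 32%nat. Notation vuy := 33%nat. Notation vvx := 34%nat.
Notation vvy := 35%nat. Notation vb := 36%nat. Notation vv := 37%nat. Notation vg := 38%nat.
Notation vh := 39%nat. Notation vd := 40%nat. Notation vs := 41%nat. Notation va := 42%nat.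
Notation vc := 43%nat. Notation vrho := 44%nat. Notation vfl := 45%nat. Notation vex := 46%nat.
Notation vey := 47%nat. Notation vlo := 52%nat. Notation vhi := 53%nat. Notation vgj := 55%nat.
Notation vgk := 56%nat. Notation vA := 57%nat. Notation vC := 58%nat.
Notation vsx := 48%nat. Notation vsy := 49%nat. Notation vtx := 50%nat. Notation vty := 51%nat.

(* A nonzero entry of acell is one more than the index of a disk. *)
Notation acx := 0%nat. Notation acy := 1%nat. Notation acr := 2%nat.
Notation acell := 3%nat. Notation atab := 4%nat. Notation aH := 5%nat.

(** Term by term a copy of [dirf], so that evaluation agrees with it by conversion. Directions are
    recomputed at each use in constant time rather than tabulated. *)
Definition edirf (k : expr) : expr := EFloor (k / (#2 * $vK + #1)).
Definition edirt (k : expr) : expr := (k - (#2 * $vK + #1) * edirf k - $vK) / $vK.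
Definition edirx (k : expr) : expr :=
  ((#1 - #2 * edirf k) * (#1 - edirt k * edirt k)) / (#1 + edirt k * edirt k).
Definition ediry (k : expr) : expr :=
  ((#1 - #2 * edirf k) * (#2 * edirt k)) / (#1 + edirt k * edirt k).

Lemma eval_edirx k s : eval (edirx k) s = dirx (s vK) (eval k s).
Proof. reflexivity. Qed.

Lemma eval_ediry k s : eval (ediry k) s = diry (s vK) (eval k s).
Proof. reflexivity. Qed.

Ltac lens :=
  repeat match goal with
  | |- context [length (cexp ?e ?d)] =>
      let n := eval vm_compute in (length (cexp e d)) in change (length (cexp e d)) with n
  | H : context [length (cexp ?e ?d)] |- _ =>
      let n := eval vm_compute in (length (cexp e d)) in change (length (cexp e d)) with n in H
  end.
Ltac cost := lens; lia.
Ltac framed :=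
  split; [|auto]; let y := fresh "y" in let Hy := fresh "Hy" in
  intros y Hy; cbv beta iota zeta delta -[Nat.eqb orb] in Hy; unfold upd;
  repeat match goal with
  | |- context [Nat.eqb y ?z] => destruct (Nat.eqb y z); cbn [orb] in Hy; try discriminate
  end; rewrite ?orb_true_r in Hy; try discriminate; auto.

Ltac evalin H :=
  rewrite ?eval_edirx, ?eval_ediry in H; cbn [eval beval upd Nat.eqb] in H.

Ltac asg v H := apply wp_seq, wp_asg; intros v H; evalin H.
Ltac casg v H t Ht := apply wp_seq, wp_casg; intros v t H Ht; evalin H; lens.

Definition genv (I : inst) (s : env) : Prop :=
  s vK = INR (iK I) /\ s vN = INR (iN I) /\ s vM = INR (iM I) /\
  s vL = INR (2 * iN I + 1) /\ s vS = INR (6 * iN I) /\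
  s vqx = iqx I /\ s vqy = iqy I /\ s vB = iB I.

Lemma genv_frame I c s a s' a' :
  genv I s -> frame c s a s' a' ->
  forallb (fun x => negb (writes c x)) [vK; vN; vM; vL; vS; vqx; vqy; vB] = true ->
  genv I s'.
Proof.
  intros (H1 & H2 & H3 & H4 & H5 & H6 & H7 & H8) [F _] Hf.
  rewrite forallb_forall in Hf.
  assert (G : forall x, In x [vK; vN; vM; vL; vS; vqx; vqy; vB] -> s' x = s x).
  { intros x Hx. apply F, negb_true_iff. now apply Hf. }
  unfold genv. repeat split; rewrite G; auto; simpl; tauto.
Qed.

(** * The table of directional maxima *)

Definition cell_idx (I : inst) (k j b : nat) : nat := ((k * iM I + j) * (6 * iN I) + b)%nat.

Lemma cell_idx_inj I k j b k' j' b' :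
  (j < iM I)%nat -> (j' < iM I)%nat -> (b < 6 * iN I)%nat -> (b' < 6 * iN I)%nat ->
  cell_idx I k j b = cell_idx I k' j' b' -> k = k' /\ j = j' /\ b = b'.
Proof.
  unfold cell_idx. intros Hj Hj' Hb Hb' E.
  assert (forall m q r q' r', (r < m)%nat -> (r' < m)%nat -> (q * m + r = q' * m + r')%nat ->
    q = q' /\ r = r') as U.
  { intros m q r q' r' H1 H2 H3. rewrite !(Nat.mul_comm _ m) in H3.
    now apply Nat.div_mod_unique in H3. }
  apply U in E as [E ->]; auto. apply U in E as [-> ->]; auto.
Qed.

(** P k j i means that disk i has been entered for the pair (k, j). Entries refer to exactly one
    bucket at this stage: a disk then changes one entry per pair, and the maxima over all t' >= t
    are produced afterwards by one backward sweep. *)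
Definition table (I : inst) (P : nat -> nat -> nat -> Prop) (g : nat -> R) : Prop :=
  forall k j b, (k < iM I)%nat -> (j < iM I)%nat -> (b < 6 * iN I)%nat ->
    ismax (fun v => exists i, P k j i /\ bucket I k i = b /\
      v = ext I j i + iB I) (g (cell_idx I k j b)).

Lemma bucket_lt I k i : good I -> (bucket I k i < 6 * iN I)%nat.
Proof. intros HI. destruct (good_N I HI) as [_ HN]. unfold bucket. lia. Qed.

Lemma table_ext I (P P' : nat -> nat -> nat -> Prop) g :
  (forall k j i, (k < iM I)%nat -> (j < iM I)%nat -> P k j i <-> P' k j i) -> table I P g ->
    table I P' g.
Proof.
  intros H HT k j b Hk Hj Hb. eapply ismax_ext; [|apply (HT k j b Hk Hj Hb)].
  intros x. split; intros (i & Hi & Hx); exists i; split; auto; now apply H.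
Qed.

Lemma table_step I P g k j i v :
  good I -> (k < iM I)%nat -> (j < iM I)%nat -> v = ext I j i + iB I ->
  table I P g ->
  table I (fun k' j' i' => P k' j' i' \/ (k' = k /\ j' = j /\ i' = i))
    (upd g (cell_idx I k j (bucket I k i))
      (if Rle_dec (g (cell_idx I k j (bucket I k i))) v then v else g (cell_idx I k j (bucket I k
        i)))).
Proof.
  intros HI Hk Hj Hv HT k' j' b Hk' Hj' Hb. pose proof (bucket_lt I k i HI) as Hbl.
  destruct (Nat.eq_dec (cell_idx I k' j' b) (cell_idx I k j (bucket I k i))) as [E|E].
  - rewrite E, upd_same. apply cell_idx_inj in E as (-> & -> & ->); auto.
    eapply ismax_union; [|apply (HT k j _ Hk Hj Hbl)|apply ismax_single].
    intros x. subst v. split.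
    + intros (i' & [Hi'|(_ & _ & ->)] & H1 & ->); [left; eauto|now right].
    + intros [(i' & Hi' & H)| <-]; [exists i'; tauto|exists i; tauto].
  - rewrite upd_other by auto. eapply ismax_ext; [|apply (HT k' j' b); auto].
    intros x. split; intros (i' & Hi' & Hb' & Hx); exists i'; split; auto.
    destruct Hi' as [Hi'|(-> & -> & ->)]; auto. subst b. now elim E.
Qed.

Definition Cbucket : cmd :=
  vb ::= EFloor ($vux * $vx + $vuy * $vy + $vr) + (#2 * $vN + #2) ;;
  CAsg ($vS - #1) ($vb) vb ($vS - #1) ;;
  CAsg ($vb) (#0) vb (#0).

Lemma INR_Z_to_nat z : (0 <= z)%Z -> INR (Z.to_nat z) = IZR z.
Proof. intros H. rewrite INR_IZR_INZ, Z2Nat.id; auto. Qed.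

Lemma wp_bucket I k i s a (Q : env -> arrays -> nat -> Prop) :
  good I -> genv I s -> s vux = ux I k -> s vuy = uy I k ->
  s vx = iX I i -> s vy = iY I i -> s vr = iR I i ->
  (forall s' t, frame Cbucket s a s' a -> s' vb = INR (bucket I k i) -> (t <= 100)%nat ->
    Q s' a t) ->
  wp Cbucket s a Q.
Proof.
  intros HI (H1 & H2 & H3 & H4 & H5 & H6 & H7 & H8) E1 E2 E3 E4 E5 HQ.
  unfold Cbucket. asg b0 Hb0. casg b1 Hb1 t1 Ht1. apply wp_casg. intros b2 t2 Hb2 Ht2.
  evalin Hb2. destruct (good_N I HI) as [_ HN].
  rewrite E1, E2, E3, E4, E5 in Hb0. fold (ext I k i) in Hb0.
  rewrite H2, INR_IZR_INZ, <- mult_IZR, <- !plus_IZR in Hb0.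
  rewrite H5, INR_IZR_INZ, <- minus_IZR, Hb0 in Hb1. 
  apply HQ; [|cbn; rewrite Hb2|cost].
  - framed.
  - unfold bucket. rewrite INR_Z_to_nat by lia.
    replace (6 * Z.of_nat (iN I) - 1)%Z with (Z.of_nat (6 * iN I) - 1)%Z by lia.
    set (z := (floorZ (ext I k i) + _)%Z) in *. set (m := (Z.of_nat (6 * iN I) - 1)%Z) in *.
    assert (E : b1 = IZR (Z.min z m)).
    { rewrite Hb1. destruct (Rle_dec (IZR m) (IZR z)) as [Hl|Hl].
      - apply le_IZR in Hl. f_equal. lia.
      - assert (z < m)%Z by (apply lt_IZR; lra). f_equal. lia. }
    rewrite E. destruct (Rle_dec (IZR (Z.min z m)) 0) as [Hl|Hl].
    + apply le_IZR in Hl. f_equal. lia.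
    + assert (0 < Z.min z m)%Z by (apply lt_IZR; lra). f_equal. lia.
Qed.

Definition eidx : expr := (($vk * $vM + $vj) * $vS + $vb)%E.

Lemma eval_eidx I s k j b : genv I s -> s vk = INR k -> s vj = INR j -> s vb = INR b ->
  eval eidx s = INR (cell_idx I k j b).
Proof.
  intros (H1 & H2 & H3 & H4 & H5 & _) E1 E2 E3. unfold eidx, cell_idx. cbn [eval beval].
  rewrite E1, E2, E3, H3, H5, plus_INR, (mult_INR (k * iM I + j)), plus_INR, (mult_INR k).
  reflexivity.
Qed.

Definition Cfillj : cmd :=
  vvx ::= edirx ($vj) ;; vvy ::= ediry ($vj) ;;
  vv ::= $vvx * $vx + $vvy * $vy + $vr + $vB ;;
  Ld vg atab eidx ;; CSt ($vg) ($vv) atab eidx ($vv).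

Definition Cfillk : cmd :=
  vux ::= edirx ($vk) ;; vuy ::= ediry ($vk) ;; Cbucket ;; For vj ($vM) Cfillj.

Definition Cfill : cmd :=
  For vt (#2 * $vL * $vL)
    (Ld vp acell ($vt) ;;
     IfLe (#1) ($vp)
       (Ld vx acx ($vp - #1) ;; Ld vy acy ($vp - #1) ;; Ld vr acr ($vp - #1) ;; For vk ($vM) Cfillk)
       Skip).

Definition atdisk (I : inst) (i : nat) (s : env) : Prop :=
  s vx = iX I i /\ s vy = iY I i /\ s vr = iR I i.

Lemma atdisk_frame I i c s a s' a' :
  atdisk I i s -> frame c s a s' a' ->
  forallb (fun x => negb (writes c x)) [vx; vy; vr] = true -> atdisk I i s'.
Proof.
  intros (H1 & H2 & H3) [F _] Hf. rewrite forallb_forall in Hf.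
  assert (G : forall x, In x [vx; vy; vr] -> s' x = s x).
  { intros x Hx. apply F, negb_true_iff. now apply Hf. }
  unfold atdisk. repeat split; rewrite G; auto; simpl; tauto.
Qed.

Lemma wp_fillj I k i s a (P : nat -> nat -> nat -> Prop) (Q : env -> arrays -> nat -> Prop) :
  good I -> genv I s -> atdisk I i s -> (k < iM I)%nat -> s vk = INR k ->
  s vb = INR (bucket I k i) -> table I P (a atab) ->
  (forall s' a' t, frame (For vj ($vM) Cfillj) s a s' a' ->
    table I (fun k' j' i' => P k' j' i' \/ (k' = k /\ i' = i)) (a' atab) ->
    (t <= (iM I + 1) * 700)%nat -> Q s' a' t) ->
  wp (For vj ($vM) Cfillj) s a Q.
Proof.
  intros HI HG HD Hk Hvk Hvb HT HQ.
  apply (wp_for _ _ _ _ _ _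
    (fun j s' a' => table I (fun k' j' i' => P k' j' i' \/ (k' = k /\ (j' < j)%nat /\
      i' = i)) (a' atab))
    (iM I) 600).
  - reflexivity.
  - intros s' a' F. eapply genv_frame in HG; [|exact F|reflexivity]. apply HG.
  - eapply table_ext; [|exact HT]. intros k' j' i' _ _. split; [tauto|].
    intros [|(_ & H & _)]; [auto|lia].
  - auto.
  - intros j s' a' Hj F HI' Hvj.
    assert (HG' : genv I s') by (eapply genv_frame; eauto).
    destruct (atdisk_frame _ _ _ _ _ _ _ HD F eq_refl) as (Ex & Ey & Er).
    assert (Hvk' : s' vk = INR k) by (rewrite (proj1 F); auto).
    assert (Hvb' : s' vb = INR (bucket I k i)) by (rewrite (proj1 F); auto).
    asg v1 H1. asg v2 H2. asg v3 H3. apply wp_seq.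
    apply (wp_ld _ _ _ _ _ (cell_idx I k j (bucket I k i))); [now apply eval_eidx|].
    intros v4 H4. apply (wp_cst _ _ _ _ _ _ _ (cell_idx I k j (bucket I k i)));
      [now apply eval_eidx|].
    intros t Ht. split; [cost|].
    cbn [eval upd Nat.eqb]. unfold aupd. cbn [Nat.eqb]. rewrite H4.
    eapply table_ext; [|apply table_step; eauto].
    + intros k' j' i' _ _. cbv beta. split; intros [H|H]; auto.
      * destruct H as [H|H]; [auto|]. right. intuition lia.
      * right. intuition lia.
      * destruct (Nat.eq_dec j' j) as [->|]; [right; tauto|left; right; intuition lia].
    + rewrite H3, H1, H2, Ex, Ey, Er, Hvj. destruct HG' as (-> & _ & _ & _ & _ & _ & _ & ->).
      reflexivity.
  - intros s' a' t F HT' Ht. apply HQ; auto.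
    + eapply table_ext; [|exact HT']. intros k' j' i' _ Hj'. cbv beta. intuition.
    + cost.
Qed.

Lemma wp_fillk I i s a (P : nat -> nat -> nat -> Prop) (Q : env -> arrays -> nat -> Prop) :
  good I -> genv I s -> atdisk I i s -> table I P (a atab) ->
  (forall s' a' t, frame (For vk ($vM) Cfillk) s a s' a' ->
    table I (fun k' j' i' => P k' j' i' \/ i' = i) (a' atab) ->
    (t <= (iM I + 1) * ((iM I + 1) * 700 + 700))%nat -> Q s' a' t) ->
  wp (For vk ($vM) Cfillk) s a Q.
Proof.
  intros HI HG HD HT HQ.
  apply (wp_for _ _ _ _ _ _
    (fun k s' a' => table I (fun k' j' i' => P k' j' i' \/ ((k' < k)%nat /\ i' = i)) (a' atab))
    (iM I) ((iM I + 1) * 700 + 600)).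
  - reflexivity.
  - intros s' a' F. eapply genv_frame in HG; [|exact F|reflexivity]. apply HG.
  - eapply table_ext; [|exact HT]. intros k' j' i' _ _. split; [tauto|].
    intros [|(H & _)]; [auto|lia].
  - auto.
  - intros k s' a' Hk F HI' Hvk.
    assert (HG' : genv I s') by (eapply genv_frame; eauto).
    assert (HD' : atdisk I i s') by (eapply atdisk_frame; eauto).
    pose proof HD' as (Ex & Ey & Er). pose proof HG' as (EK & _).
    asg v1 H1. asg v2 H2. rewrite EK, Hvk in H1, H2. apply wp_seq.
    apply (wp_bucket I k i); auto.
    intros s1 t1 F1 Hb Ht1.
    apply (wp_fillj I k i _ _ (fun k' j' i' => P k' j' i' \/ ((k' < k)%nat /\ i' = i))); auto.
    + eapply genv_frame; [|exact F1|reflexivity]. exact HG'.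
    + eapply atdisk_frame; [|exact F1|reflexivity]. exact HD'.
    + rewrite (proj1 F1); auto.
    + intros s2 a2 t2 F2 HT2 Ht2. split; [cost|].
      eapply table_ext; [|exact HT2]. intros k' j' i' _ _. cbv beta.
      split.
      * intros [[H|H]|H]; [auto|right; intuition lia|right; intuition lia].
      * intros [H|[H ->]]; [auto|]. destruct (Nat.eq_dec k' k) as [->|]; [right; auto|left; right;
        intuition lia].
  - intros s' a' t F HT' Ht. apply HQ; auto.
    + eapply table_ext; [|exact HT']. intros k' j' i' Hk' _. cbv beta. intuition.
    + cost.
Qed.

Definition ncells (I : inst) : nat := (2 * (2 * iN I + 1) * (2 * iN I + 1))%nat.

Definition coords (I : inst) (a : arrays) : Prop :=
  forall i, irep I i -> a acx i = iX I i /\ a acy i = iY I i /\ a acr i = iR I i.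

Definition pointers (I : inst) (a : arrays) : Prop :=
  (forall c, (c < ncells I)%nat -> a acell c = 0 \/ exists i, a acell c = INR (S i)) /\
  (forall i, irep I i <-> exists c, (c < ncells I)%nat /\ a acell c = INR (S i)).

(** The hypothesis that the table is 0 is met by untouched memory, and 0 is a correct maximum of the
    empty set. Each occupied cell costs O(M^2). *)
Lemma wp_fill I s a (Q : env -> arrays -> nat -> Prop) :
  good I -> genv I s -> coords I a -> pointers I a -> (forall x, a atab x = 0) ->
  (forall s' a' t, frame Cfill s a s' a' ->
    table I (fun _ _ i => irep I i) (a' atab) ->
    (t <= (ncells I + 1) * ((iM I + 1) * ((iM I + 1) * 700 + 700) + 200))%nat -> Q s' a' t) ->
  wp Cfill s a Q.
Proof.
  intros HI HG HC [HP1 HP2] H0 HQ.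
  assert (Hcell : forall i c, (c < ncells I)%nat -> a acell c = INR (S i) -> irep I i).
  { intros i c Hc E. apply HP2. eauto. }
  apply (wp_for _ _ _ _ _ _
    (fun c s' a' => table I (fun k' j' i' => exists c', (c' < c)%nat /\
      a acell c' = INR (S i')) (a' atab))
    (ncells I) ((iM I + 1) * ((iM I + 1) * 700 + 700) + 100)).
  - reflexivity.
  - intros s' a' F. eapply genv_frame in HG; [|exact F|reflexivity].
    destruct HG as (_ & _ & _ & HL & _). cbn [eval beval]. rewrite HL.
    unfold ncells. now rewrite !(mult_INR _ (2 * iN I + 1)).
  - intros k j b _ _ _. rewrite H0. apply ismax_empty. intros x (i & (c & Hc & _) & _). lia.
  - auto.
  - intros c s' a' Hc F HI' Hvt.
    assert (HG' : genv I s') by (eapply genv_frame; eauto).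
    assert (Ax : a' acx = a acx) by (apply F; reflexivity).
    assert (Ay : a' acy = a acy) by (apply F; reflexivity).
    assert (Ar : a' acr = a acr) by (apply F; reflexivity).
    assert (Ac : a' acell = a acell) by (apply F; reflexivity).
    apply wp_seq, (wp_ld _ _ _ _ _ c); [exact Hvt|]. intros v1 H1. rewrite Ac in H1.
    apply wp_if; cbn [eval upd Nat.eqb]; intros Hif.
    + destruct (HP1 c Hc) as [E|(i & E)]; [rewrite H1, E in Hif; lra|].
      assert (Hi : irep I i) by eauto. destruct (HC i Hi) as (Ex & Ey & Er).
      assert (Ev : v1 - 1 = INR i) by (rewrite H1, E, S_INR; ring).
      apply wp_seq, (wp_ld _ _ _ _ _ i); [exact Ev|]. intros v2 H2. rewrite Ax, Ex in H2.
      apply wp_seq, (wp_ld _ _ _ _ _ i); [exact Ev|]. intros v3 H3. rewrite Ay, Ey in H3.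
      apply wp_seq, (wp_ld _ _ _ _ _ i); [exact Ev|]. intros v4 H4. rewrite Ar, Er in H4.
      eapply (wp_fillk I i); [auto|exact HG'|now repeat split|exact HI'|].
      intros s2 a2 t2 F2 HT2 Ht2. split; [cost|].
      eapply table_ext; [|exact HT2]. intros k' j' i' _ _. cbv beta. split.
      * intros [(c' & Hc' & E')| ->]; [exists c'; split; [lia|auto]|exists c; split; [lia|auto]].
      * intros (c' & Hc' & E'). destruct (Nat.eq_dec c' c) as [->|]; [right|left; exists c'; split;
        [lia|auto]].
        rewrite E in E'. apply INR_eq in E'. lia.
    + apply wp_skip. split; [cost|].
      eapply table_ext; [|exact HI']. intros k' j' i' _ _. split.
      * intros (c' & Hc' & E'); exists c'; split; [lia|auto].
      * intros (c' & Hc' & E'). destruct (Nat.eq_dec c' c) as [->|]; [|exists c'; split;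
        [lia|auto]].
        rewrite H1, E', S_INR in Hif. pose proof (pos_INR i'). lra.
  - intros s' a' t F HT' Ht. apply HQ; auto.
    + eapply table_ext; [|exact HT']. intros k' j' i' Hk' _. cbv beta. symmetry. apply HP2.
    + cost.
Qed.

(* Entries in [D], given by row and column, have been replaced by suffix maxima. *)
Definition partial_suffix (I : inst) (D : nat -> nat -> Prop) (g : nat -> R) : Prop :=
  forall k j b, (k < iM I)%nat -> (j < iM I)%nat -> (b < 6 * iN I)%nat ->
    (D (k * iM I + j)%nat b -> ismax (fun v => exists i, irep I i /\ (b <= bucket I k i)%nat /\
      v = ext I j i + iB I)
       (g (cell_idx I k j b))) /\
    (~ D (k * iM I + j)%nat b -> ismax (fun v => exists i, irep I i /\ bucket I k i = b /\
      v = ext I j i + iB I)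
       (g (cell_idx I k j b))).

Definition suffix_table (I : inst) (g : nat -> R) : Prop := partial_suffix I (fun _ _ => True) g.

Lemma partial_suffix_ext I (D D' : nat -> nat -> Prop) g :
  (forall p b, (p < iM I * iM I)%nat -> (b < 6 * iN I)%nat -> D p b <-> D' p b) ->
  partial_suffix I D g -> partial_suffix I D' g.
Proof.
  intros H HT k j b Hk Hj Hb. destruct (HT k j b Hk Hj Hb) as [H1 H2].
  assert (Hp : (k * iM I + j < iM I * iM I)%nat) by nia.
  rewrite (H _ _ Hp Hb) in H1, H2. auto.
Qed.

(** The buckets from b on are bucket b together with those from b + 1 on; the neighbouring entry
    already holds the maximum over the latter. *)
Lemma partial_suffix_step I (D : nat -> nat -> Prop) g p b :
  good I -> (p < iM I * iM I)%nat -> (S b < 6 * iN I)%nat -> ~ D p b -> D p (S b) ->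
  partial_suffix I D g ->
  partial_suffix I (fun p' b' => D p' b' \/ (p' = p /\ b' = b))
    (upd g (p * (6 * iN I) + b)
      (if Rle_dec (g (p * (6 * iN I) + b)%nat) (g (S (p * (6 * iN I) + b)))
       then g (S (p * (6 * iN I) + b)) else g (p * (6 * iN I) + b)%nat)).
Proof.
  intros HI Hp Hb HD HDS HT.
  assert (HM : (iM I <> 0)%nat) by (unfold iM; lia).
  set (k := (p / iM I)%nat). set (j := (p mod iM I)%nat).
  assert (Hj : (j < iM I)%nat) by now apply Nat.mod_upper_bound.
  assert (Hk : (k < iM I)%nat) by now apply Nat.Div0.div_lt_upper_bound.
  assert (Ep : p = (k * iM I + j)%nat) by (rewrite (Nat.div_mod_eq p (iM I)); fold k j; lia).
  assert (E0 : (p * (6 * iN I) + b)%nat = cell_idx I k j b) by (unfold cell_idx; rewrite <- Ep;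
    auto).
  assert (E1 : S (p * (6 * iN I) + b)%nat = cell_idx I k j (S b)) by (unfold cell_idx;
    rewrite <- Ep; lia).
  rewrite E1, E0.
  intros k' j' b' Hk' Hj' Hb'.
  destruct (HT k' j' b' Hk' Hj' Hb') as [H1 H2].
  destruct (Nat.eq_dec (cell_idx I k' j' b') (cell_idx I k j b)) as [E|E].
  - rewrite E, upd_same. apply cell_idx_inj in E as (-> & -> & ->); auto; [|lia].
    rewrite <- Ep in *. split; [intros _|intros Hn; exfalso; apply Hn; auto].
    specialize (H2 HD). destruct (HT k j (S b) Hk Hj Hb) as [H3 _]. rewrite <- Ep in H3.
    specialize (H3 HDS).
    eapply ismax_union; [|exact H2|exact H3].
    intros x. split.
    + intros (i & Hi & Hle & Hx). destruct (Nat.eq_dec (bucket I k i) b); [left|right]; exists i;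
      repeat split; auto; lia.
    + intros [(i & Hi & Hle & Hx)|(i & Hi & Hle & Hx)]; exists i; repeat split; auto; lia.
  - rewrite upd_other by auto. split.
    + intros [H|[H ->]]; auto. exfalso. apply E. unfold cell_idx. now rewrite <- Ep, H.
    + intros H. apply H2. tauto.
Qed.

(** The last bucket of a row is its own suffix maximum, so each row needs S - 1 steps, downwards
    from index S - 2. *)
Definition Csuffix : cmd :=
  For vk ($vM * $vM) (For vj ($vS - #1)
    (vt ::= $vk * $vS + ($vS - #2 - $vj) ;;
     Ld vg atab ($vt) ;; Ld vv atab ($vt + #1) ;; CSt ($vg) ($vv) atab ($vt) ($vv))).

Lemma wp_suffix I s a (Q : env -> arrays -> nat -> Prop) :
  good I -> genv I s -> table I (fun _ _ i => irep I i) (a atab) ->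
  (forall s' a' t, frame Csuffix s a s' a' -> suffix_table I (a' atab) ->
    (t <= (iM I * iM I + 1) * (6 * iN I * 400 + 200))%nat -> Q s' a' t) ->
  wp Csuffix s a Q.
Proof.
  intros HI HG HT HQ. destruct (good_N I HI) as [_ HN].
  apply (wp_for _ _ _ _ _ _
    (fun p s' a' => partial_suffix I (fun p' b => (p' < p)%nat \/
      (6 * iN I - 1 <= b)%nat) (a' atab))
    (iM I * iM I) (6 * iN I * 400)).
  - reflexivity.
  - intros s' a' F. eapply genv_frame in HG; [|exact F|reflexivity].
    destruct HG as (_ & _ & HM & _). cbn [eval beval]. now rewrite HM, mult_INR.
  - intros k j b Hk Hj Hb. split.
    + intros [H|H]; [lia|]. eapply ismax_ext; [|apply (HT k j b Hk Hj Hb)].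
      intros x. split; intros (i & Hi & Hle & Hx); exists i; repeat split; auto; [lia|].
      pose proof (bucket_lt I k i HI). lia.
    + intros _. apply (HT k j b Hk Hj Hb).
  - auto.
  - intros p s' a' Hp F HI' Hvk.
    assert (HG' : genv I s') by (eapply genv_frame; eauto).
    apply (wp_for _ _ _ _ _ _
      (fun q s' a' => partial_suffix I (fun p' b => (p' < p)%nat \/ (6 * iN I - 1 <= b)%nat \/
         (p' = p /\ (6 * iN I - 1 - q <= b)%nat)) (a' atab))
      (6 * iN I - 1) 300).
    + reflexivity.
    + intros s1 a1 F1. eapply genv_frame in HG'; [|exact F1|reflexivity].
      destruct HG' as (_ & _ & _ & _ & HS & _). cbn [eval beval]. rewrite HS, minus_INR by lia.
      reflexivity.
    + eapply partial_suffix_ext; [|exact HI']. intros p' b _ Hb. cbv beta. split; [tauto|].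
      intros [H|[H|[_ H]]]; auto. lia.
    + auto.
    + intros q s1 a1 Hq F1 HI1 Hvj.
      assert (HG1 : genv I s1) by (eapply genv_frame; eauto).
      assert (Hvk1 : s1 vk = INR p) by (rewrite (proj1 F1); auto).
      destruct HG1 as (_ & _ & _ & _ & HS & _).
      asg v1 H1. rewrite Hvk1, HS, Hvj in H1.
      set (b := (6 * iN I - 2 - q)%nat).
      assert (E1 : v1 = INR (p * (6 * iN I) + b)).
      { rewrite H1, plus_INR, (mult_INR p). unfold b. rewrite !minus_INR by lia. reflexivity. }
      apply wp_seq, (wp_ld _ _ _ _ _ (p * (6 * iN I) + b)); [exact E1|]. intros v2 H2.
      apply wp_seq, (wp_ld _ _ _ _ _ (S (p * (6 * iN I) + b))).
      { rewrite S_INR, <- E1. reflexivity. }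
      intros v3 H3.
      apply (wp_cst _ _ _ _ _ _ _ (p * (6 * iN I) + b)); [exact E1|].
      intros t Ht. split; [cost|].
      cbn [eval upd Nat.eqb]. unfold aupd. cbn [Nat.eqb]. rewrite H2, H3.
      eapply partial_suffix_ext; [|apply partial_suffix_step; [exact HI|exact Hp| | | |exact HI1]].
      * intros p' b' _ Hb'. cbv beta. unfold b. lia.
      * unfold b; lia.
      * unfold b; lia.
      * unfold b; lia.
    + intros s1 a1 t F1 HI1 Ht. split; [cost|].
      eapply partial_suffix_ext; [|exact HI1]. intros p' b' _ Hb'. cbv beta. lia.
  - intros s' a' t F HT' Ht. apply HQ; auto.
    + eapply partial_suffix_ext; [|exact HT']. intros p' b' Hp' Hb'. cbv beta. tauto.
    + cost.
Qed.

(** * The test *)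

(** [rest] is the union over k of the disks reaching threshold k, so H_j is the maximum over k of
    one table entry each. *)
Definition CH : cmd :=
  For vj ($vM)
    (vh ::= #0 ;;
     For vk ($vM)
       (vux ::= edirx ($vk) ;; vuy ::= ediry ($vk) ;;
        vb ::= EFloor ($vrho + $vux * $va + $vuy * $vc) + (#2 * $vN + #3) ;;
        Ld vg atab eidx ;; CAsg ($vh) ($vg) vh ($vg)) ;;
     St aH ($vj) ($vh)).

Lemma wp_H I a0 b0 rho s a (Q : env -> arrays -> nat -> Prop) :
  good I -> genv I s -> in_range I a0 b0 rho -> s va = a0 -> s vc = b0 -> s vrho = rho ->
  suffix_table I (a atab) ->
  (forall s' a' t, frame CH s a s' a' -> isH I a0 b0 rho (a' aH) ->
    (t <= (iM I + 1) * ((iM I + 1) * 600 + 200))%nat -> Q s' a' t) ->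
  wp CH s a Q.
Proof.
  intros HI HG Hr Ea Ec Erho HT HQ.
  apply (wp_for _ _ _ _ _ _
    (fun j s' a' => forall j', (j' < j)%nat ->
      ismax (fun v => exists i, rest I a0 b0 rho i /\ v = ext I j' i + iB I) (a' aH j'))
    (iM I) ((iM I + 1) * 600 + 100)).
  - reflexivity.
  - intros s' a' F. eapply genv_frame in HG; [|exact F|reflexivity]. apply HG.
  - intros j' H. lia.
  - auto.
  - intros j s' a' Hj F HI' Hvj.
    assert (HG' : genv I s') by (eapply genv_frame; eauto).
    assert (Ea' : s' va = a0) by (rewrite (proj1 F); auto).
    assert (Ec' : s' vc = b0) by (rewrite (proj1 F); auto).
    assert (Er' : s' vrho = rho) by (rewrite (proj1 F); auto).
    assert (At : a' atab = a atab) by (apply F; reflexivity).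
    asg v0 H0. apply wp_seq.
    apply (wp_for _ _ _ _ _ _
      (fun k s2 a2 => ismax (fun v => exists i, irep I i /\ (exists k', (k' < k)%nat /\
          (thresh I a0 b0 rho k' <= bucket I k' i)%nat) /\ v = ext I j i + iB I) (s2 vh))
      (iM I) 550).
    + reflexivity.
    + intros s1 a1 F1. assert (HG1 : genv I s1) by (eapply genv_frame; [|exact F1|reflexivity];
      exact HG'). apply HG1.
    + cbn [upd Nat.eqb]. rewrite H0. apply ismax_empty. intros x (i & _ & (k' & Hk' & _) & _). lia.
    + auto.
    + intros k s1 a1 Hk F1 HI1 Hvk.
      assert (HG1 : genv I s1) by (eapply genv_frame; [|exact F1|reflexivity]; exact HG').
      assert (Ea1 : s1 va = a0) by (rewrite (proj1 F1); auto).
      assert (Ec1 : s1 vc = b0) by (rewrite (proj1 F1); auto).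
      assert (Er1 : s1 vrho = rho) by (rewrite (proj1 F1); auto).
      assert (Ej1 : s1 vj = INR j) by (rewrite (proj1 F1); auto).
      assert (At1 : a1 atab = a atab) by (rewrite (proj2 F1); auto).
      pose proof HG1 as (EK & EN & _).
      asg v1 H1. asg v2 H2. asg v3 H3. rewrite EK, Hvk in H1, H2.
      rewrite H1, H2, Ea1, Ec1, Er1, EN in H3. fold (ux I k) (uy I k) in H3.
      destruct (thresh_range I a0 b0 rho k HI Hr Hk) as [HR1 HR2].
      assert (E3 : v3 = INR (thresh I a0 b0 rho k)).
      { unfold thresh. rewrite INR_Z_to_nat by lia.
        rewrite H3, INR_IZR_INZ, <- mult_IZR, <- !plus_IZR. reflexivity. }
      assert (Hlt : (thresh I a0 b0 rho k < 6 * iN I)%nat) by (unfold thresh; lia).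
      apply wp_seq, (wp_ld _ _ _ _ _ (cell_idx I k j (thresh I a0 b0 rho k))).
      { apply eval_eidx; auto. }
      intros v4 H4. rewrite At1 in H4. apply wp_casg. intros v5 t5 H5 Ht5. evalin H5.
      split; [cost|].
      cbn [upd Nat.eqb]. rewrite H5.
      destruct (HT k j (thresh I a0 b0 rho k) Hk Hj Hlt) as [HT1 _]. specialize (HT1 Logic.I).
      rewrite <- H4 in HT1.
      eapply ismax_union; [|exact HI1|exact HT1]. intros x. split.
      * intros (i & Hi & (k' & Hk' & Hle) & Hx). destruct (Nat.eq_dec k' k) as [->|].
        -- right. eauto.
        -- left. exists i. repeat split; auto. exists k'. split; [lia|auto].
      * intros [(i & Hi & (k' & Hk' & Hle) & Hx)|(i & Hi & Hle & Hx)]; exists i; repeat split; auto.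
        -- exists k'. split; [lia|auto].
        -- exists k. split; [lia|auto].
    + intros s1 a1 t F1 HI1 Ht. apply (wp_st _ _ _ _ _ j).
      { cbn [eval]. rewrite (proj1 F1); auto. }
      split; [cost|]. intros j' Hj'. unfold aupd. cbn [Nat.eqb eval].
      destruct (Nat.eq_dec j' j) as [->|].
      * rewrite upd_same. eapply ismax_ext; [|exact HI1]. unfold rest. intros x.
        split; intros (i & H); exists i; tauto.
      * rewrite upd_other by auto. replace (a1 aH) with (a' aH) by (symmetry; apply F1;
        reflexivity).
        apply HI'. lia.
  - intros s' a' t F HT' Ht. apply HQ; auto. cost.
Qed.

(** On the j-th line the k-th constraint reads c <= s A, where A is the determinant of u_j and u_k.
    It bounds s from below if A > 0 and from above if A < 0; for A = 0 it is vacuous or empties the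
    interval by setting [vhi] below [vlo]. *)
Definition Cclip : cmd :=
  vux ::= edirx ($vk) ;; vuy ::= ediry ($vk) ;;
  Ld vgk aH ($vk) ;;
  vgk ::= $vgk - $vB - $vrho - $vgj * ($vvx * $vux + $vvy * $vuy) ;;
  vA ::= $vvx * $vuy - $vvy * $vux ;;
  vC ::= $vgk / $vA ;;
  IfLe ($vA) (#0)
    (IfLe (#0) ($vA) (IfLe ($vgk) (#0) Skip (vhi ::= $vlo - #1))
       (CAsg ($vC) ($vhi) vhi ($vC)))
    (CAsg ($vlo) ($vC) vlo ($vC)).

(** With C = iB + N, which bounds the negative part of all right-hand sides, [meets_on_boundary]
    yields a solution with parameter in [-2C, 2C]; these are the initial ends of the interval on
    every line. *)
Definition CLP : cmd :=
  vfl ::= #0 ;;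
  For vj ($vM)
    (vvx ::= edirx ($vj) ;; vvy ::= ediry ($vj) ;;
     Ld vgj aH ($vj) ;; vgj ::= $vgj - $vB - $vrho ;;
     vhi ::= #2 * ($vB + $vN) ;; vlo ::= #0 - $vhi ;;
     For vk ($vM) Cclip ;;
     IfLe ($vlo) ($vhi)
       (vfl ::= #1 ;; vex ::= $vgj * $vvx - $vlo * $vvy ;; vey ::= $vgj * $vvy + $vlo * $vvx)
       Skip).

Lemma wp_clip I rho H j k s a (P : R -> Prop) (Q : env -> arrays -> nat -> Prop) :
  good I -> genv I s -> s vrho = rho -> a aH = H -> s vk = INR k ->
  s vvx = ux I j -> s vvy = uy I j -> s vgj = slack I rho H j ->
  (forall x, P x <-> s vlo <= x <= s vhi) ->
  (forall s' t, frame Cclip s a s' a ->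
    (forall x, P x /\ slack I rho H k <= ux I k * linex (ux I) (uy I) (slack I rho H) j x +
        uy I k * liney (ux I) (uy I) (slack I rho H) j x <-> s' vlo <= x <= s' vhi) ->
    (t <= 700)%nat -> Q s' a t) ->
  wp Cclip s a Q.
Proof.
  intros HI HG Er EH Ek Ex Ey Eg HP HQ. pose proof HG as (EK & EN & _ & _ & _ & _ & _ & EB).
  asg v1 H1. asg v2 H2. apply wp_seq, (wp_ld _ _ _ _ _ k); [exact Ek|]. intros v3 H3.
  asg v4 H4. asg v5 H5. asg v6 H6.
  rewrite EK, Ek in H1, H2. fold (ux I k) in H1. fold (uy I k) in H2.
  rewrite H3, EH, EB, Er, Eg, Ex, Ey, H1, H2 in H4. rewrite Ex, Ey, H1, H2 in H5.
  fold (slack I rho H k) in H4.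
  assert (HC : forall x, slack I rho H k <= ux I k * linex (ux I) (uy I) (slack I rho H) j x +
        uy I k * liney (ux I) (uy I) (slack I rho H) j x <-> v4 <= x * v5).
  { intros x. rewrite H4, H5. unfold linex, liney, slack. split; intros; lra. }
  assert (FR : forall x v s', s' = upd (upd (upd (upd (upd (upd (upd s vux v1) vuy v2) vgk v3) vgk
    v4) vA v5) vC v6) x v ->
     (x = vlo \/ x = vhi) -> frame Cclip s a s' a).
  { intros x v s' -> Hx; destruct Hx as [-> | ->]; framed. }
  apply wp_if; cbn [eval upd Nat.eqb]; intros C1; [apply wp_if; cbn [eval upd Nat.eqb]; intros C2;
    [apply wp_if; cbn [eval upd Nat.eqb]; intros C3|]|].
  - assert (E5 : v5 = 0) by lra. apply wp_skip. apply HQ; [|intros x; cbn [upd Nat.eqb];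
    rewrite HC, HP, E5, Rmult_0_r; tauto|cost].
    framed.
  - assert (E5 : v5 = 0) by lra. apply wp_asg. intros v7 H7. evalin H7.
    apply HQ; [eapply FR; [reflexivity|auto]| |cost].
    intros x. cbn [upd Nat.eqb]. rewrite HC, HP, E5, Rmult_0_r, H7. lra.
  - rewrite rdiv_div in H6 by lra. apply wp_casg. intros v7 t7 H7 Ht7. evalin H7.
    apply HQ; [eapply FR; [reflexivity|auto]| |cost].
    assert (HC' : forall x, v4 <= x * v5 <-> x <= v6).
    { intros x. assert (E4 : v4 = v6 * v5) by (rewrite H6; field; lra). rewrite E4.
      split; intros; nra. }
    intros x. cbn [upd Nat.eqb]. rewrite HC, HP, HC', H7. destruct (Rle_dec v6 (s vhi)); lra.
  - rewrite rdiv_div in H6 by lra. apply wp_casg. intros v7 t7 H7 Ht7. evalin H7.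
    apply HQ; [eapply FR; [reflexivity|auto]| |cost].
    assert (HC' : forall x, v4 <= x * v5 <-> v6 <= x).
    { intros x. assert (E4 : v4 = v6 * v5) by (rewrite H6; field; lra). rewrite E4.
      split; intros; nra. }
    intros x. cbn [upd Nat.eqb]. rewrite HC, HP, HC', H7. destruct (Rle_dec (s vlo) v6); lra.
Qed.

(** A represented center has norm at most N + |q| <= iB, so every value that can occur in H is
    nonnegative. This is the lower bound required by [meets_on_boundary]. *)
Lemma isH_nonneg_slack I a0 b0 rho H j : good I -> isH I a0 b0 rho H -> (j < iM I)%nat ->
  - (iB I + rho) <= slack I rho H j.
Proof.
  intros HI HH Hj. unfold slack. assert (0 <= H j); [|lra].
  destruct (HH j Hj) as [_ [->|(i & [Hi _] & ->)]]; [lra|].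
  destruct (good_N I HI) as [HN _].
  destruct HI as [HK Hg]. destruct (Hg i Hi) as [Hr Hc]. unfold ext, iB.
  pose proof (dot_le_hyp _ _ (- iX I i) (- iY I i) (dir_unit (iK I) j ltac:(lia) Hj)) as Hd.
  fold (ux I j) (uy I j) in Hd.
  pose proof (hyp_triangle_sub (iX I i) (iY I i) 0 0 (iqx I) (iqy I)) as T.
  rewrite !Rminus_0_r in T.
  replace (hyp (iqx I - 0) (iqy I - 0)) with (hyp (iqx I) (iqy I)) in T by (f_equal; ring).
  replace (hyp (- iX I i) (- iY I i)) with (hyp (iX I i) (iY I i)) in Hd by (unfold hyp; f_equal;
    ring).
  pose proof (hyp_nonneg (iqx I) (iqy I)). destruct Hc; lra.
Qed.

Lemma wp_LP I a0 b0 rho H s a (Q : env -> arrays -> nat -> Prop) :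
  good I -> genv I s -> in_range I a0 b0 rho -> isH I a0 b0 rho H -> s vrho = rho -> a aH = H ->
  (forall s' t, frame CLP s a s' a ->
    (s' vfl = 1 /\ meets (iM I) (ux I) (uy I) (slack I rho H) (s' vex) (s' vey)) \/
    (s' vfl = 0 /\ forall x y, ~ meets (iM I) (ux I) (uy I) (slack I rho H) x y) ->
    (t <= (iM I + 1) * ((iM I + 1) * 800 + 800))%nat -> Q s' a t) ->
  wp CLP s a Q.
Proof.
  intros HI HG Hr HH Er EH HQ. destruct (good_N I HI) as [HN _].
  assert (HB : 0 <= iB I) by (unfold iB; pose proof (hyp_nonneg (iqx I) (iqy I)); lra).
  set (C := 2 * (iB I + INR (iN I))).
  apply wp_seq, wp_asg. intros v0 H0. evalin H0.
  apply (wp_for _ _ _ _ _ _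
    (fun j s' a' => (s' vfl = 1 /\ meets (iM I) (ux I) (uy I) (slack I rho H) (s' vex) (s' vey)) \/
      (s' vfl = 0 /\ forall j' x, (j' < j)%nat -> - C <= x <= C ->
        ~ meets (iM I) (ux I) (uy I) (slack I rho H) (linex (ux I) (uy I) (slack I rho H) j' x)
          (liney (ux I) (uy I) (slack I rho H) j' x)))
    (iM I) ((iM I + 1) * 800 + 700)).
  - reflexivity.
  - intros s' a' F. assert (HG' : genv I s') by (eapply genv_frame; [|exact F|reflexivity];
    exact HG). apply HG'.
  - right. split; [exact H0|]. intros; lia.
  - auto.
  - intros j s' a' Hj F HI' Hvj.
    assert (HG' : genv I s') by (eapply genv_frame; [|exact F|reflexivity]; exact HG).
    assert (Er' : s' vrho = rho) by (rewrite (proj1 F); auto).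
    assert (EH' : a' aH = H) by (rewrite (proj2 F); auto).
    pose proof HG' as (EK & EN & _ & _ & _ & _ & _ & EB).
    asg v1 H1. asg v2 H2. apply wp_seq, (wp_ld _ _ _ _ _ j); [exact Hvj|]. intros v3 H3.
    asg v4 H4. asg v5 H5. asg v6 H6.
    rewrite EK, Hvj in H1, H2. rewrite H3, EH', EB, Er' in H4. fold (slack I rho H j) in H4.
    rewrite EB, EN in H5. fold C in H5. rewrite H5 in H6.
    apply wp_seq.
    apply (wp_for _ _ _ _ _ _
      (fun k s1 a1 => forall x, (- C <= x <= C /\ forall k', (k' < k)%nat ->
         slack I rho H k' <= ux I k' * linex (ux I) (uy I) (slack I rho H) j x +
          uy I k' * liney (ux I) (uy I) (slack I rho H) j x) <-> s1 vlo <= x <= s1 vhi)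
      (iM I) 700).
    + reflexivity.
    + intros s1 a1 F1. assert (HG1 : genv I s1) by (eapply genv_frame; [|exact F1|reflexivity];
      exact HG'). apply HG1.
    + intros x. cbn [upd Nat.eqb]. rewrite H5, H6. split; [lra|]. intros Hx. split; [lra|].
      intros; lia.
    + auto.
    + intros k s1 a1 Hk F1 HI1 Hvk.
      assert (HG1 : genv I s1) by (eapply genv_frame; [|exact F1|reflexivity]; exact HG').
      eapply (wp_clip I rho H j k); [exact HI|exact HG1| | |exact Hvk| | | |exact HI1|].
      1, 3-5: rewrite (proj1 F1); [auto|reflexivity].
      { rewrite (proj2 F1); [auto|reflexivity]. }
      intros s2 t2 F2 HC2 Ht2. split; [auto|]. intros x. rewrite <- HC2. split.
      * intros [Hx Hall]. split; [split|]; auto.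
      * intros [[Hx Hall] Hk']. split; auto. intros k' Hlt.
        destruct (Nat.eq_dec k' k) as [->|]; auto. apply Hall. lia.
    + intros s1 a1 t1 F1 HI1 Ht1.
      assert (E1 : s1 vvx = ux I j) by (rewrite (proj1 F1); [auto|reflexivity]).
      assert (E2 : s1 vvy = uy I j) by (rewrite (proj1 F1); [auto|reflexivity]).
      assert (E4 : s1 vgj = slack I rho H j) by (rewrite (proj1 F1); [auto|reflexivity]).
      apply wp_if; cbn [eval]; intros Hc.
      * asg v7 H7. asg v8 H8. apply wp_asg. intros v9 H9. evalin H9. split; [cost|].
        left. cbn [upd Nat.eqb]. split; [exact H7|].
        rewrite E1, E2, E4 in H8, H9. 
        assert (Hlo : s1 vlo <= s1 vlo <= s1 vhi) by lra. apply HI1 in Hlo as [_ Hall].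
        rewrite H8, H9. exact Hall.
      * apply wp_skip. split; [cost|].
        rewrite !(proj1 F1) by reflexivity. cbn [upd Nat.eqb].
        destruct HI' as [HI'|[Hf HI']]; [left; auto|right]. split; auto.
        intros j' x Hj' Hx Hm. destruct (Nat.eq_dec j' j) as [->|]; [|apply (HI' j' x); auto; lia].
        assert (Hx' : s1 vlo <= x <= s1 vhi) by (apply HI1; split; auto). lra.
  - intros s' a' t F HI' Ht.
    assert (Ea : a' = a). { apply functional_extensionality. intros k. apply F. reflexivity. }
    subst a'. apply HQ.
    + eapply frame_asg. exact F.
    + destruct HI' as [HI'|[Hf HI']]; [left; auto|right]. split; auto.
      intros x y Hm. destruct Hr as (_ & _ & Hr).
      destruct (meets_on_boundary (iM I) (ux I) (uy I) (slack I rho H) x y (iB I + INR (iN I))) as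
        (j & z & Hj & Hz & Hmz); auto.
      * unfold iM; lia.
      * lra.
      * intros k Hk. now apply u_unit.
      * intros x' y'. destruct (u_cover I x' y' HI) as (k & Hk & Hc). exists k. split; auto.
        pose proof (hyp_nonneg x' y'). set (h := hyp x' y') in *.
        assert (Hd : (2 / INR (iN I)) * INR (iN I) = 2) by (field; lra).
        set (d := 2 / INR (iN I)) in *.
        assert (0 <= d <= 1 / 2) by nra. nra.
      * intros k Hk. pose proof (isH_nonneg_slack I a0 b0 rho H k HI HH Hk). lra.
      * apply (HI' j z); auto. 
    + cost.
Qed.

(** * The search *)

Definition Ctry : cmd :=
  va ::= EFloor ($vs / $vL) - $vN ;;
  vc ::= $vs - $vL * EFloor ($vs / $vL) - $vN ;;
  vrho ::= $vN - $vd - #1 ;;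
  CH ;; CLP ;;
  IfLe (#1) ($vfl)
    (vd ::= $vd + #1 ;; vsx ::= $va ;; vsy ::= $vc ;; vtx ::= $vex ;; vty ::= $vey)
    (vs ::= $vs + #1).

(** No test precedes the start: the centers 0 and q reach all represented disks with radius N by
    [good]. *)
Definition Csearch : cmd :=
  vd ::= #0 ;; vs ::= #0 ;; vsx ::= #0 ;; vsy ::= #0 ;; vtx ::= $vqx ;; vty ::= $vqy ;;
  WhileLt ($vs) ($vL * $vL) Ctry.

Lemma floorZ_div (p q L : nat) : (q < L)%nat -> floorZ (rdiv (INR (p * L + q)) (INR L)) = Z.of_nat
  p.
Proof.
  intros H. assert (HL : 0 < INR L) by (apply lt_0_INR; lia).
  rewrite rdiv_div by lra. apply floorZ_unique. rewrite <- INR_IZR_INZ.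
  rewrite plus_INR, mult_INR. apply lt_INR in H. pose proof (pos_INR q).
  replace ((INR p * INR L + INR q) / INR L) with (INR p + INR q / INR L) by (field; lra).
  assert (0 <= INR q / INR L < 1); [|lra]. split; [apply Rle_mult_inv_pos; lra|].
  apply (Rmult_lt_reg_r (INR L)); [auto|]. replace (INR q / INR L * INR L) with (INR q) by (field;
    lra). lra.
Qed.

Definition exact_cover (I : inst) (x1 y1 x2 y2 rho : R) : Prop :=
  forall i, irep I i -> hyp (iX I i - x1) (iY I i - y1) + iR I i <= rho \/
    hyp (iX I i - x2) (iY I i - y2) + iR I i <= rho.

Definition near (I : inst) (p q : nat) (x y : R) : Prop :=
  -1 <= INR p - INR (iN I) - x <= 1 /\ -1 <= INR q - INR (iN I) - y <= 1.

(** Stated for d so that it stays true when d grows: a grid point at which the test failed need not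
    be visited again for smaller radii. *)
Definition refuted (I : inst) (p q : nat) (d : nat) : Prop :=
  forall x1 y1 x2 y2 rho, 0 <= rho -> near I p q x1 y1 -> exact_cover I x1 y1 x2 y2 rho ->
    INR (iN I) - INR d - 1 < rho + 2.

(** Each test advances exactly one of the two counters, the grid position g after a failure and d
    after a success. Their sum therefore counts the tests and never exceeds L^2 + N. *)
Lemma wp_try I g d i s a (Q : env -> arrays -> nat -> Prop) :
  good I -> genv I s -> suffix_table I (a atab) -> irep I i ->
  (g < (2 * iN I + 1) * (2 * iN I + 1))%nat -> (d <= iN I)%nat ->
  s vs = INR g -> s vd = INR d ->
  covers I (s vsx) (s vsy) (s vtx) (s vty) (INR (iN I) - INR d) ->
  (forall s' a' t g' d', (g' + d' = S (g + d))%nat -> (g <= g')%nat -> (d <= d')%nat ->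
    (d' <= iN I)%nat ->
    s' vs = INR g' -> s' vd = INR d' ->
    covers I (s' vsx) (s' vsy) (s' vtx) (s' vty) (INR (iN I) - INR d') ->
    (g' = S g -> refuted I (g / (2 * iN I + 1)) (g mod (2 * iN I + 1)) d') ->
    (t <= 2 * (iM I + 1) * ((iM I + 1) * 800 + 1000))%nat -> Q s' a' t) ->
  wp Ctry s a Q.
Proof.
  intros HI HG HT Hi Hg Hd Es Ed Hc HQ. pose proof HG as (EK & EN & _ & EL & _).
  set (L := (2 * iN I + 1)%nat) in *. set (p := (g / L)%nat). set (q := (g mod L)%nat).
  assert (Hq : (q < L)%nat) by (apply Nat.mod_upper_bound; lia).
  assert (Eg : g = (p * L + q)%nat) by (rewrite (Nat.div_mod_eq g L); fold p q; lia).
  assert (Hp : (p < L)%nat) by (apply Nat.Div0.div_lt_upper_bound; auto).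
  asg v1 H1. asg v2 H2. asg v3 H3.
  rewrite Es, EL, Eg, floorZ_div, <- INR_IZR_INZ, EN in H1, H2 by auto.
  assert (E2 : v2 = INR q - INR (iN I)) by (rewrite H2, plus_INR, mult_INR; lra).
  rewrite EN, Ed in H3.
  assert (HpR : 0 <= INR p <= 2 * INR (iN I)).
  { split; [apply pos_INR|]. replace (2 * INR (iN I)) with (INR (2 * iN I)) by (rewrite mult_INR;
    simpl; ring). apply le_INR. lia. }
  assert (HqR : 0 <= INR q <= 2 * INR (iN I)).
  { split; [apply pos_INR|]. replace (2 * INR (iN I)) with (INR (2 * iN I)) by (rewrite mult_INR;
    simpl; ring). apply le_INR. lia. }
  pose proof (le_INR _ _ Hd) as HdR. pose proof (pos_INR d).
  assert (Hr : in_range I v1 v2 v3) by (unfold in_range; lra).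
  set (s3 := upd (upd (upd s va v1) vc v2) vrho v3) in *.
  assert (HG3 : genv I s3) by exact HG.
  apply wp_seq. apply (wp_H I v1 v2 v3); auto.
  intros s4 a4 t4 F4 HH Ht4. apply wp_seq.
  assert (E4 : s4 vrho = v3) by (rewrite (proj1 F4); reflexivity).
  apply (wp_LP I v1 v2 v3 (a4 aH)); auto.
  { eapply genv_frame; [exact HG3|exact F4|reflexivity]. }
  intros s5 t5 F5 Hfl Ht5.
  assert (K : forall x, writes CH x = false -> writes CLP x = false -> s5 x = s3 x).
  { intros x Hx Hx'. rewrite (proj1 F5), (proj1 F4); auto. }
  assert (K1 : s5 vs = INR g) by (rewrite K; auto).
  assert (K2 : s5 vd = INR d) by (rewrite K; auto).
  assert (K3 : s5 va = v1) by (rewrite K; auto).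
  assert (K4 : s5 vc = v2) by (rewrite K; auto).
  assert (Htot : (forall n, n <= 200 -> t4 + t5 + n <= 2 * (iM I + 1) * ((iM I + 1) * 800 +
    1000))%nat) by (intros; lia).
  apply wp_if; cbn [eval]; intros Hif; (destruct Hfl as [[Hf Hm]|[Hf Hm]]; [|]); try lra.
  - asg v6 H6. asg v7 H7. asg v8 H8. asg v9 H9. apply wp_asg. intros v10 H10. evalin H10.
    (* For d = N the radius tested would be -1, where success is impossible. *)
    assert (HdN : (d < iN I)%nat).
    { destruct (Nat.eq_dec d (iN I)) as [Edn|]; [|lia]. exfalso.
      assert (E3 : v3 = -1) by (rewrite H3, Edn; ring). rewrite E3 in *.
      now apply (test_nonneg I v1 v2 (a4 aH) (s5 vex) (s5 vey) i). }
    apply (HQ _ _ _ g (S d)); try lia; cbn [upd Nat.eqb]; auto.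
    + now rewrite H6, K2, S_INR.
    + rewrite H7, H8, H9, H10, K3, K4. rewrite S_INR.
      replace (INR (iN I) - (INR d + 1)) with v3 by lra.
      now apply (test_sound I v1 v2 v3 (a4 aH)).
    + lens. specialize (Htot 200%nat). lia.
  - apply wp_asg. intros v6 H6. evalin H6.
    apply (HQ _ _ _ (S g) d); try lia; cbn [upd Nat.eqb]; auto.
    + now rewrite H6, K1, S_INR.
    + rewrite !K by reflexivity. exact Hc.
    + intros _ x1 y1 x2 y2 rho Hrho [N1 N2] Hex. fold p in N1. fold q in N2.
      destruct (Rlt_dec (INR (iN I) - INR d - 1) (rho + 2)) as [|Hge]; auto. exfalso.
      destruct (test_complete I v1 v2 v3 (a4 aH) x1 y1 x2 y2 rho) as (x & y & Hm'); auto; try lra.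
      now apply (Hm x y).
    + lens. specialize (Htot 200%nat). lia.
Qed.

Lemma wp_search I i s a (Q : env -> arrays -> nat -> Prop) :
  good I -> genv I s -> suffix_table I (a atab) -> irep I i ->
  (forall s' a' t d, frame Csearch s a s' a' -> s' vd = INR d -> (d <= iN I)%nat ->
    covers I (s' vsx) (s' vsy) (s' vtx) (s' vty) (INR (iN I) - INR d) ->
    (forall x1 y1 x2 y2 rho, 0 <= rho -> - INR (iN I) <= x1 <= INR (iN I) ->
       - INR (iN I) <= y1 <= INR (iN I) -> exact_cover I x1 y1 x2 y2 rho ->
       INR (iN I) - INR d - 1 < rho + 2) ->
    (t <= (ncells I + iN I + 1) * (2 * (iM I + 1) * ((iM I + 1) * 800 + 1000) + 100))%nat ->
      Q s' a' t) ->
  wp Csearch s a Q.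
Proof.
  intros HI HG HT Hi HQ. set (L := (2 * iN I + 1)%nat).
  asg v1 H1. asg v2 H2. asg v3 H3. asg v4 H4. asg v5 H5. asg v6 H6.
  set (s6 := upd (upd _ _ _) _ _).
  assert (HG6 : genv I s6) by exact HG.
  apply (wp_while _ _ _ _ _ _
    (fun k s' a' => exists g d, (g + d = k)%nat /\ (g <= L * L)%nat /\ (d <= iN I)%nat /\
       s' vs = INR g /\ s' vd = INR d /\
       covers I (s' vsx) (s' vsy) (s' vtx) (s' vty) (INR (iN I) - INR d) /\
       forall g', (g' < g)%nat -> refuted I (g' / L) (g' mod L) d)
    (L * L + iN I) (2 * (iM I + 1) * ((iM I + 1) * 800 + 1000))).
  - exists 0%nat, 0%nat. cbn. rewrite H1, H2, H3, H4, H5, H6.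
    destruct HG as (_ & _ & _ & _ & _ & -> & -> & _).
    repeat split; auto; try lia. intros j Hj. destruct HI as [_ Hg]. destruct (Hg j Hj) as [_ Hc].
    rewrite !Rminus_0_r. destruct Hc; [left|right]; lra.
  - intros k s' a' (g & d & Hk & Hg & Hd & Es & Ed & Hc & Hv) F Hlt.
    assert (HG' : genv I s') by (eapply genv_frame; [exact HG6|exact F|reflexivity]).
    pose proof HG' as (_ & _ & _ & EL & _). cbn [eval beval] in Hlt.
    rewrite Es, EL, <- mult_INR in Hlt.
    apply INR_lt in Hlt. fold L in Hlt. split; [lia|].
    apply (wp_try I g d i); auto.
    { rewrite (proj2 F) by reflexivity. exact HT. }
    intros s2 a2 t2 g2 d2 Hsum Hg2 Hd2 Hd2N Es2 Ed2 Hc2 Hr2 Ht2. split; auto.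
    exists g2, d2. repeat split; auto; [lia|lia|].
    intros g' Hg'. destruct (Nat.eq_dec g' g) as [->|].
    + apply Hr2. lia.
    + pose proof (Hv g' ltac:(lia)) as Hv'. intros x1 y1 x2 y2 rho Hrho Hn Hx.
      specialize (Hv' x1 y1 x2 y2 rho Hrho Hn Hx).
      apply le_INR in Hd2. lra.
  - intros k s' a' t (g & d & Hk & Hg & Hd & Es & Ed & Hc & Hv) F Hge HkN Ht.
    assert (HG' : genv I s') by (eapply genv_frame; [exact HG6|exact F|reflexivity]).
    pose proof HG' as (_ & _ & _ & EL & _). cbn [eval beval] in Hge.
    rewrite Es, EL, <- mult_INR in Hge.
    apply INR_le in Hge. fold L in Hge.
    apply (HQ _ _ _ d); auto.
    + do 6 eapply frame_asg. exact F.
    + intros x1 y1 x2 y2 rho Hrho Hx1 Hy1 Hex.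
      (* Rounding both coordinates down gives a grid point that differs by at most 1 in each, and at
         the end every grid point is refuted. *)
      destruct (floorZ_spec x1) as [Fx1 Fx2]. destruct (floorZ_spec y1) as [Fy1 Fy2].
      set (zx := floorZ x1) in *. set (zy := floorZ y1) in *.
      rewrite INR_IZR_INZ in Hx1, Hy1. set (n := Z.of_nat (iN I)) in *.
      assert (- n - 1 < zx)%Z by (apply lt_IZR; rewrite minus_IZR, opp_IZR; lra).
      assert (- n - 1 < zy)%Z by (apply lt_IZR; rewrite minus_IZR, opp_IZR; lra).
      assert (zx <= n)%Z by (apply le_IZR; lra). assert (zy <= n)%Z by (apply le_IZR; lra).
      set (p := Z.to_nat (zx + n)). set (q := Z.to_nat (zy + n)).
      assert (Hp : (p < L)%nat) by (unfold p, L; lia).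
      assert (Hq : (q < L)%nat) by (unfold q, L; lia).
      assert (Hgl : (p * L + q < g)%nat) by nia.
      apply (Hv (p * L + q)%nat Hgl x1 y1 x2 y2 rho); auto.
      rewrite Nat.div_add_l, Nat.div_small, Nat.add_0_r, Nat.add_comm, Nat.Div0.mod_add,
        Nat.mod_small by lia.
      unfold near, p, q. rewrite !INR_Z_to_nat, !plus_IZR by lia. rewrite (INR_IZR_INZ (iN I)).
      fold n. lra.
    + lens. unfold ncells. fold L. 
      set (B := (2 * (iM I + 1) * ((iM I + 1) * 800 + 1000))%nat) in *. nia.
Qed.

(** * Preprocessing *)

(* The discretisation parameter K: the final error of 10 R / K^2, where R <= 3 r*, must be
   at most eps r*, and the running time is O(n + K^6). *)
Definition kappa (eps : R) : nat :=
  S (Z.to_nat (floorZ (rdiv 7 (sqrt (if Rle_dec 1 eps then 1 else eps))))).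

(** K lies between 7 / sqrt e and 7 / sqrt e + 1, so e K^2 is between 49 and 64. Cutting eps off at
    1 ensures K >= 8. *)
Lemma kappa_spec eps : 0 < eps ->
  let e := if Rle_dec 1 eps then 1 else eps in
  0 < e <= 1 /\ e <= eps /\ (8 <= kappa eps)%nat /\
  INR (kappa eps) = IZR (floorZ (rdiv 7 (sqrt e))) + 1 /\
  30 <= e * (INR (kappa eps) * INR (kappa eps)) /\
  e * (INR (kappa eps) * INR (kappa eps)) <= 64.
Proof.
  intros He e. assert (E1 : 0 < e <= 1 /\ e <= eps) by (unfold e; destruct (Rle_dec 1 eps); lra).
  destruct E1 as [E1 E2]. split; auto. split; auto.
  assert (Hs : 0 < sqrt e) by (apply sqrt_lt_R0; lra).
  assert (Hss : sqrt e * sqrt e = e) by (apply sqrt_sqrt; lra).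
  assert (Hs1 : sqrt e <= 1) by nra.
  unfold kappa. fold e. rewrite rdiv_div by lra.
  assert (Hq : 7 / sqrt e * sqrt e = 7) by (field; lra).
  destruct (floorZ_spec (7 / sqrt e)) as [F1 F2]. set (z := floorZ (7 / sqrt e)) in *.
  set (q := 7 / sqrt e) in *. assert (H7 : 7 <= q) by nra.
  assert (Hz : (6 < z)%Z) by (apply lt_IZR; lra).
  assert (EK : INR (S (Z.to_nat z)) = IZR z + 1) by (rewrite S_INR, INR_Z_to_nat by lia; auto).
  split; [lia|split; [auto|]]. rewrite EK.
  set (K := IZR z + 1) in *. assert (HK : K = IZR z + 1) by reflexivity.
  assert (A1 : 7 <= K * sqrt e).
  { rewrite <- Hq. apply Rmult_le_compat_r; lra. }
  assert (A2 : K * sqrt e <= 8).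
  { apply Rle_trans with ((q + 1) * sqrt e); [apply Rmult_le_compat_r; lra|lra]. }
  assert (A3 : e * (K * K) = (K * sqrt e) * (K * sqrt e)) by (rewrite <- Hss at 1; ring).
  rewrite A3. split; nra.
Qed.

(** If f is the fractional part of the packed input, then f = n / (n + eps), so eps = n / f - n. *)
Definition Cinit : cmd :=
  vn ::= EFloor ($vpk) ;;
  vd1 ::= $vn / ($vpk - $vn) - $vn ;;
  CAsg (#1) ($vd1) vd1 (#1) ;;
  vK ::= EFloor (#7 / ESqrt ($vd1)) + #1 ;;
  vN ::= $vK * $vK ;; vM ::= #4 * $vK + #2 ;; vL ::= #2 * $vN + #1 ;; vS ::= #6 * $vN ;;
  Ld vpx acx (#0) ;; Ld vpy acy (#0).

Definition env0 (n K : nat) (px py : R) (s : env) : Prop :=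
  s vn = INR n /\ s vK = INR K /\ s vN = INR (K * K) /\ s vM = INR (4 * K + 2) /\
  s vL = INR (2 * (K * K) + 1) /\ s vS = INR (6 * (K * K)) /\ s vpx = px /\ s vpy = py.

Lemma env0_frame n K px py c s a s' a' :
  env0 n K px py s -> frame c s a s' a' ->
  forallb (fun x => negb (writes c x)) [vn; vK; vN; vM; vL; vS; vpx; vpy] = true ->
  env0 n K px py s'.
Proof.
  intros (H1 & H2 & H3 & H4 & H5 & H6 & H7 & H8) [F _] Hf.
  rewrite forallb_forall in Hf.
  assert (G : forall x, In x [vn; vK; vN; vM; vL; vS; vpx; vpy] -> s' x = s x).
  { intros x Hx. apply F, negb_true_iff. now apply Hf. }
  unfold env0. repeat split; rewrite G; auto; simpl; tauto.
Qed.

Lemma wp_init n eps s a (Q : env -> arrays -> nat -> Prop) :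
  (1 <= n)%nat -> 0 < eps -> s vpk = INR n + INR n / (INR n + eps) ->
  (forall s' t, env0 n (kappa eps) (a acx 0%nat) (a acy 0%nat) s' -> (t <= 300)%nat -> Q s' a t) ->
  wp Cinit s a Q.
Proof.
  intros Hn He E0 HQ. assert (Hn' : 1 <= INR n) by (change 1 with (INR 1); now apply le_INR).
  assert (Hf : 0 < INR n / (INR n + eps) < 1).
  { split; [apply Rdiv_lt_0_compat; lra|]. apply (Rmult_lt_reg_r (INR n + eps)); [lra|].
    replace (INR n / (INR n + eps) * (INR n + eps)) with (INR n) by (field; lra). lra. }
  destruct (kappa_spec eps He) as (_ & _ & _ & EK & _).
  asg v1 H1. asg v2 H2. casg v3 H3 t3 Ht3. asg v4 H4. asg v5 H5. asg v6 H6. asg v7 H7. asg v8 H8.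
  apply wp_seq, (wp_ld _ _ _ _ _ 0); [reflexivity|]. intros v9 H9.
  apply (wp_ld _ _ _ _ _ 0); [reflexivity|]. intros v10 H10.
  assert (A1 : v1 = INR n).
  { rewrite H1, E0, (floorZ_unique _ (Z.of_nat n)), <- INR_IZR_INZ; auto. rewrite <- INR_IZR_INZ.
    lra. }
  assert (A2 : v2 = eps).
  { rewrite H2, A1, E0, rdiv_div by lra. field. split; [lra|]. 
    replace (INR n + INR n / (INR n + eps) - INR n) with (INR n / (INR n + eps)) by ring. lra. }
  rewrite A2 in H3. rewrite H3, <- EK in H4.
  rewrite H4 in H5, H6. rewrite <- mult_INR in H5. rewrite H5 in H7, H8.
  apply HQ; [|cost]. unfold env0. cbn [upd Nat.eqb]. repeat split; auto.
  - rewrite H6, plus_INR, (mult_INR 4). simpl INR. lra.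
  - rewrite H7, plus_INR, (mult_INR 2). simpl INR. lra.
  - rewrite H8, (mult_INR 6). simpl INR. lra.
Qed.

Definition Cfar : cmd :=
  vrm ::= #0 ;; vdl ::= #0 ;; vqx ::= #0 ;; vqy ::= #0 ;;
  For vi ($vn)
    (Ld vx acx ($vi) ;; vx ::= $vx - $vpx ;; Ld vy acy ($vi) ;; vy ::= $vy - $vpy ;;
     Ld vr acr ($vi) ;; CAsg ($vrm) ($vr) vrm ($vr) ;;
     vd1 ::= ESqrt ($vx * $vx + $vy * $vy) ;;
     IfLe ($vdl) ($vd1) (vdl ::= $vd1 ;; vqx ::= $vx ;; vqy ::= $vy) Skip).

Lemma wp_far n K px py s a (Q : env -> arrays -> nat -> Prop) :
  env0 n K px py s ->
  (forall s' t, frame Cfar s a s' a ->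
    (forall i, (i < n)%nat -> a acr i <= s' vrm) ->
    (s' vrm = 0 \/ exists i, (i < n)%nat /\ s' vrm = a acr i) ->
    s' vdl = hyp (s' vqx) (s' vqy) ->
    (forall i, (i < n)%nat -> hyp (a acx i - px) (a acy i - py) <= s' vdl) ->
    ((s' vqx = 0 /\ s' vqy = 0) \/
      exists i, (i < n)%nat /\ s' vqx = a acx i - px /\ s' vqy = a acy i - py) ->
    (t <= (n + 1) * 300)%nat -> Q s' a t) ->
  wp Cfar s a Q.
Proof.
  intros HE HQ. unfold Cfar. asg v1 H1. asg v2 H2. asg v3 H3. asg v4 H4.
  set (s4 := upd (upd _ _ _) _ _).
  assert (HE4 : env0 n K px py s4) by exact HE.
  apply (wp_for _ _ _ _ _ _
    (fun k s' a' =>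
      (forall i, (i < k)%nat -> a acr i <= s' vrm) /\
      (s' vrm = 0 \/ exists i, (i < k)%nat /\ s' vrm = a acr i) /\
      s' vdl = hyp (s' vqx) (s' vqy) /\
      (forall i, (i < k)%nat -> hyp (a acx i - px) (a acy i - py) <= s' vdl) /\
      ((s' vqx = 0 /\ s' vqy = 0) \/
        exists i, (i < k)%nat /\ s' vqx = a acx i - px /\ s' vqy = a acy i - py)) n 200).
  - reflexivity.
  - intros s' a' F. assert (env0 n K px py s') as HE' by (eapply env0_frame;
    [exact HE4|exact F|reflexivity]). apply HE'.
  - cbn. rewrite H1, H2, H3, H4. split; [intros; lia|]. split; [auto|].
    split; [|split; [intros; lia|auto]].
    unfold hyp. rewrite Rmult_0_l, Rplus_0_r. now rewrite sqrt_0.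
  - auto.
  - intros k s' a' Hk F (I1 & I2 & I3 & I4 & I5) Hvi.
    assert (HE' : env0 n K px py s') by (eapply env0_frame; [exact HE4|exact F|reflexivity]).
    destruct HE' as (_ & _ & _ & _ & _ & _ & Epx & Epy).
    assert (Ea : a' = a). { apply functional_extensionality. intros j. apply F. reflexivity. }
    subst a'.
    apply wp_seq, (wp_ld _ _ _ _ _ k); [exact Hvi|]. intros w1 W1. asg w2 W2.
    apply wp_seq, (wp_ld _ _ _ _ _ k); [exact Hvi|]. intros w3 W3. asg w4 W4.
    apply wp_seq, (wp_ld _ _ _ _ _ k); [exact Hvi|]. intros w5 W5. casg w6 W6 t6 Ht6. asg w7 W7.
    rewrite W1, Epx in W2. rewrite W3, Epy in W4. fold (hyp w2 w4) in W7.
    assert (R1 : forall i, (i < S k)%nat -> a acr i <= w6).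
    { intros i Hi. rewrite W6, W5. destruct (Nat.eq_dec i k) as [->|].
      - destruct (Rle_dec (s' vrm) (a acr k)); lra.
      - pose proof (I1 i ltac:(lia)). destruct (Rle_dec (s' vrm) (a acr k)); lra. }
    assert (R2 : w6 = 0 \/ exists i, (i < S k)%nat /\ w6 = a acr i).
    { rewrite W6, W5. destruct (Rle_dec (s' vrm) (a acr k)); [right; exists k; auto|].
      destruct I2 as [I2|(i & Hi & I2)]; [auto|right; exists i; split; [lia|auto]]. }
    apply wp_if; cbn [eval upd Nat.eqb]; intros C.
    + asg w8 W8. asg w9 W9. apply wp_asg. intros w10 W10. evalin W10. split; [cost|].
      cbn [upd Nat.eqb]. split; [exact R1|split; [exact R2|]]. rewrite W8, W9, W10.
      split; [auto|split].
      * intros i Hi. destruct (Nat.eq_dec i k) as [->|]; [rewrite W7, W2, W4; lra|].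
        pose proof (I4 i ltac:(lia)). lra.
      * right. exists k. auto.
    + apply wp_skip. split; [cost|]. cbn [upd Nat.eqb]. split; [exact R1|split; [exact R2|]].
      split; [auto|split].
      * intros i Hi. destruct (Nat.eq_dec i k) as [->|]; [rewrite <- W2, <- W4; lra|].
        apply I4. lia.
      * destruct I5 as [I5|(i & Hi & I5)]; [auto|right; exists i; split; [lia|auto]].
  - intros s' a' t F (I1 & I2 & I3 & I4 & I5) Ht.
    assert (Ea : a' = a). { apply functional_extensionality. intros j. apply F. reflexivity. }
    subst a'. apply HQ; auto; [|cost].
    do 4 eapply frame_asg. exact F.
Qed.

(** [vdl] still holds |q|, which is saved in [vB] before [vdl] is reused for delta. *)
Definition Cdelta : cmd :=
  vB ::= $vdl ;; vdl ::= #0 ;;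
  For vi ($vn)
    (Ld vx acx ($vi) ;; vx ::= $vx - $vpx ;; Ld vy acy ($vi) ;; vy ::= $vy - $vpy ;;
     vd1 ::= ESqrt ($vx * $vx + $vy * $vy) ;;
     vd2 ::= ESqrt (($vx - $vqx) * ($vx - $vqx) + ($vy - $vqy) * ($vy - $vqy)) ;;
     CAsg ($vd2) ($vd1) vd1 ($vd2) ;; CAsg ($vdl) ($vd1) vdl ($vd1)).

Lemma wp_delta n K px py s a (Q : env -> arrays -> nat -> Prop) :
  env0 n K px py s ->
  let h1 i := hyp (a acx i - px) (a acy i - py) in
  let h2 i := hyp (a acx i - px - s vqx) (a acy i - py - s vqy) in
  (forall s' t, frame Cdelta s a s' a -> s' vB = s vdl ->
    (forall i, (i < n)%nat -> h1 i <= s' vdl \/ h2 i <= s' vdl) ->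
    (s' vdl = 0 \/ exists i, (i < n)%nat /\ s' vdl <= h1 i /\ s' vdl <= h2 i) ->
    (t <= (n + 1) * 300)%nat -> Q s' a t) ->
  wp Cdelta s a Q.
Proof.
  intros HE h1 h2 HQ. unfold Cdelta. asg v1 H1. asg v2 H2.
  set (s4 := upd (upd _ _ _) _ _).
  assert (HE4 : env0 n K px py s4) by exact HE.
  apply (wp_for _ _ _ _ _ _
    (fun k s' a' =>
      (forall i, (i < k)%nat -> h1 i <= s' vdl \/ h2 i <= s' vdl) /\
      (s' vdl = 0 \/ exists i, (i < k)%nat /\ s' vdl <= h1 i /\ s' vdl <= h2 i)) n 200).
  - reflexivity.
  - intros s' a' F. assert (env0 n K px py s') as HE' by (eapply env0_frame;
    [exact HE4|exact F|reflexivity]). apply HE'.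
  - cbn. split; [intros; lia|auto].
  - auto.
  - intros k s' a' Hk F (I1 & I2) Hvi.
    assert (HE' : env0 n K px py s') by (eapply env0_frame; [exact HE4|exact F|reflexivity]).
    destruct HE' as (_ & _ & _ & _ & _ & _ & Epx & Epy).
    assert (Ea : a' = a). { apply functional_extensionality. intros j. apply F. reflexivity. }
    assert (Eqx : s' vqx = s vqx) by (rewrite (proj1 F); reflexivity).
    assert (Eqy : s' vqy = s vqy) by (rewrite (proj1 F); reflexivity).
    subst a'.
    apply wp_seq, (wp_ld _ _ _ _ _ k); [exact Hvi|]. intros w1 W1. asg w2 W2.
    apply wp_seq, (wp_ld _ _ _ _ _ k); [exact Hvi|]. intros w3 W3. asg w4 W4.
    asg w5 W5. asg w6 W6. casg w7 W7 t7 Ht7. apply wp_casg. intros w8 t8 W8 Ht8. evalin W8.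
    rewrite W1, Epx in W2. rewrite W3, Epy in W4.
    rewrite W2, W4 in W5. fold (hyp (a acx k - px) (a acy k - py)) in W5. fold (h1 k) in W5.
    rewrite W2, W4, Eqx, Eqy in W6. fold (hyp (a acx k - px - s vqx) (a acy k - py - s vqy)) in W6.
    fold (h2 k) in W6.
    split; [cost|]. cbn [upd Nat.eqb].
    assert (Hm : (w7 = h1 k \/ w7 = h2 k) /\ w7 <= h1 k /\ w7 <= h2 k).
    { rewrite W7, W5, W6. destruct (Rle_dec (h2 k) (h1 k)); split; auto; lra. }
    destruct Hm as (Hm1 & Hm2 & Hm3). split.
    + intros i Hi. rewrite W8. destruct (Nat.eq_dec i k) as [->|].
      * destruct (Rle_dec (s' vdl) w7); destruct Hm1 as [<- | <-]; [left|right|left|right]; lra.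
      * destruct (Rle_dec (s' vdl) w7); [|apply I1; lia].
        destruct (I1 i ltac:(lia)); [left|right]; lra.
    + rewrite W8. destruct (Rle_dec (s' vdl) w7); [right; exists k; auto|].
      destruct I2 as [I2|(i & Hi & I2)]; [auto|right; exists i; split; [lia|auto]].
  - intros s' a' t F (I1 & I2) Ht.
    assert (Ea : a' = a). { apply functional_extensionality. intros j. apply F. reflexivity. }
    subst a'. apply HQ; auto; [| |cost].
    + do 2 eapply frame_asg. exact F.
    + rewrite (proj1 F) by reflexivity. subst s4. cbn. auto.
Qed.

(* Of three points at pairwise distance at least dl, two lie in the same disk. *)
Lemma farthest_point_bound n (x y r : nat -> R) px py qx qy rm dl e1x e1y e2x e2y rho :
  (1 <= n)%nat -> x 0%nat = px -> y 0%nat = py -> (forall i, (i < n)%nat -> 0 < r i) ->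
  (rm = 0 \/ exists i, (i < n)%nat /\ rm = r i) ->
  (forall i, (i < n)%nat -> hyp (x i - px) (y i - py) <= hyp qx qy) ->
  ((qx = 0 /\ qy = 0) \/ exists i, (i < n)%nat /\ qx = x i - px /\ qy = y i - py) ->
  (dl = 0 \/ exists i, (i < n)%nat /\ dl <= hyp (x i - px) (y i - py) /\
     dl <= hyp (x i - px - qx) (y i - py - qy)) ->
  (forall i, (i < n)%nat -> hyp (x i - e1x) (y i - e1y) + r i <= rho \/
     hyp (x i - e2x) (y i - e2y) + r i <= rho) ->
  dl + rm <= 3 * rho.
Proof.
  intros Hn Ex Ey Hr Hrm Hfar Hq Hdl Hc.
  assert (H0 : 0 <= rho).
  { pose proof (Hr 0%nat ltac:(lia)). pose proof (hyp_nonneg (x 0%nat - e1x) (y 0%nat - e1y)).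
    pose proof (hyp_nonneg (x 0%nat - e2x) (y 0%nat - e2y)). destruct (Hc 0%nat ltac:(lia)); lra. }
  assert (H1 : rm <= rho).
  { destruct Hrm as [->|(i & Hi & ->)]; auto.
    pose proof (hyp_nonneg (x i - e1x) (y i - e1y)).
    pose proof (hyp_nonneg (x i - e2x) (y i - e2y)).
    destruct (Hc i Hi); lra. }
  assert (H2 : dl <= 2 * rho); [|lra].
  destruct Hdl as [->|(i & Hi & D1 & D2)]; [lra|].
  assert (Hq' : exists j, (j < n)%nat /\ qx = x j - px /\ qy = y j - py).
  { destruct Hq as [[-> ->]|Hq]; auto. exists 0%nat. rewrite Ex, Ey. split; [lia|split; ring]. }
  destruct Hq' as (j & Hj & Eqx & Eqy). pose proof (Hfar i Hi) as D3. rewrite Eqx, Eqy in D2, D3.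
  replace (x i - px - (x j - px)) with (x i - x j) in D2 by ring.
  replace (y i - py - (y j - py)) with (y i - y j) in D2 by ring.
  assert (Two : forall k l ex ey, (k < n)%nat -> (l < n)%nat ->
    hyp (x k - ex) (y k - ey) + r k <= rho ->
    hyp (x l - ex) (y l - ey) + r l <= rho -> hyp (x k - x l) (y k - y l) <= 2 * rho).
  { intros k l ex ey Hk Hl A1 A2. pose proof (hyp_triangle_sub (x k) (y k) (x l) (y l) ex ey) as T.
    rewrite (hyp_sym ex ey) in T. pose proof (Hr k Hk). pose proof (Hr l Hl). lra. }
  (* Pigeonhole for the disks 0, i and j: i is at distance at least dl from both others, and q,
     being farthest from p, is no nearer to p than i. *)
  pose proof (Hc 0%nat ltac:(lia)) as C0. pose proof (Hc i Hi) as Ci. pose proof (Hc j Hj) as Cj.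
  rewrite <- Ex, <- Ey in D1, D3.
  destruct Ci as [Ci|Ci]; destruct Cj as [Cj|Cj];
    try (pose proof (Two i j _ _ Hi Hj Ci Cj); lra);
    destruct C0 as [C0|C0];
    try (pose proof (Two i 0%nat _ _ Hi ltac:(lia) Ci C0); lra);
    try (pose proof (Two j 0%nat _ _ Hj ltac:(lia) Cj C0); lra).
Qed.

(* Grid cell of a center: a square of side 1 around the nearer of 0 and q. *)
Definition cell (N : nat) (qx qy x y : R) : nat :=
  let L := (2 * N + 1)%nat in
  let pos u := Z.to_nat (floorZ u + Z.of_nat N) in
  if Rle_dec (x * x + y * y) ((x - qx) * (x - qx) + (y - qy) * (y - qy))
  then (pos x * L + pos y)%nat
  else (L * L + (pos (x - qx)%R * L + pos (y - qy)%R))%nat.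

Definition in_grid (N : nat) (qx qy x y : R) : Prop :=
  hyp x y <= INR N \/ hyp (x - qx) (y - qy) <= INR N.

Lemma pos_range N u : - INR N <= u <= INR N ->
  (0 <= floorZ u + Z.of_nat N)%Z /\ (Z.to_nat (floorZ u + Z.of_nat N) < 2 * N + 1)%nat.
Proof.
  intros H. destruct (floorZ_spec u) as [F1 F2]. rewrite INR_IZR_INZ in H.
  assert (- Z.of_nat N - 1 < floorZ u)%Z by (apply lt_IZR; rewrite minus_IZR, opp_IZR; lra).
  assert (floorZ u <= Z.of_nat N)%Z by (apply le_IZR; lra). lia.
Qed.

(** Whichever of 0 and q is within N of the point, the nearer one is. *)
Lemma in_grid_nearer N qx qy x y : in_grid N qx qy x y ->
  if Rle_dec (x * x + y * y) ((x - qx) * (x - qx) + (y - qy) * (y - qy))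
  then (- INR N <= x <= INR N) /\ (- INR N <= y <= INR N)
  else (- INR N <= x - qx <= INR N) /\ (- INR N <= y - qy <= INR N).
Proof.
  intros H. pose proof (hyp_sq x y). pose proof (hyp_sq (x - qx) (y - qy)).
  pose proof (hyp_nonneg x y). pose proof (hyp_nonneg (x - qx) (y - qy)).
  destruct (Rle_dec _ _) as [C|C].
  - assert (hyp x y <= INR N) by (destruct H; [auto|nra]).
    pose proof (abs_le_hyp x y). lra.
  - assert (hyp (x - qx) (y - qy) <= INR N) by (destruct H; [nra|auto]).
    pose proof (abs_le_hyp (x - qx) (y - qy)). lra.
Qed.

Lemma cell_lt N qx qy x y : in_grid N qx qy x y ->
  (cell N qx qy x y < 2 * (2 * N + 1) * (2 * N + 1))%nat.
Proof.
  intros H. apply in_grid_nearer in H. unfold cell. cbv zeta.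
  destruct (Rle_dec _ _); destruct H as [H1 H2]; apply pos_range in H1 as [_ H1];
    apply pos_range in H2 as [_ H2]; nia.
Qed.

Lemma same_floor N u v : - INR N <= u <= INR N -> - INR N <= v <= INR N ->
  Z.to_nat (floorZ u + Z.of_nat N) = Z.to_nat (floorZ v + Z.of_nat N) -> -1 <= u - v <= 1.
Proof.
  intros Hu Hv E. apply pos_range in Hu as [Hu _], Hv as [Hv _].
  assert (E' : floorZ u = floorZ v) by lia.
  destruct (floorZ_spec u) as [F1 F2], (floorZ_spec v) as [F3 F4]. rewrite E' in *. lra.
Qed.

Lemma cell_inj N qx qy x y x' y' : in_grid N qx qy x y -> in_grid N qx qy x' y' ->
  cell N qx qy x y = cell N qx qy x' y' -> -1 <= x - x' <= 1 /\ -1 <= y - y' <= 1.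
Proof.
  intros H H' E. apply in_grid_nearer in H, H'. unfold cell in E. cbv zeta in E.
  assert (U : forall m q r q' r', (r < m)%nat -> (r' < m)%nat -> (q * m + r = q' * m + r')%nat ->
    q = q' /\ r = r').
  { intros m q r q' r' H1 H2 H3. rewrite !(Nat.mul_comm _ m) in H3.
    now apply Nat.div_mod_unique in H3. }
  destruct (Rle_dec (x * x + y * y) _), (Rle_dec (x' * x' + y' * y') _); destruct H as [H1 H2],
    H' as [H3 H4];
    pose proof (proj2 (pos_range _ _ H1)) as P1; pose proof (proj2 (pos_range _ _ H2)) as P2;
    pose proof (proj2 (pos_range _ _ H3)) as P3; pose proof (proj2 (pos_range _ _ H4)) as P4.
  - apply U in E as [E1 E2]; auto. eapply same_floor in E1, E2; eauto.
  (* Mixed cases: cell numbers of the first grid stay below L^2, those of the second begin there. *)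
  - exfalso. nia.
  - exfalso. nia.
  - apply Nat.add_cancel_l, U in E as [E1 E2]; auto. eapply same_floor in E1, E2; eauto. lra.
Qed.

Definition Ccell : cmd :=
  IfLe ($vx * $vx + $vy * $vy) (($vx - $vqx) * ($vx - $vqx) + ($vy - $vqy) * ($vy - $vqy))
    (vt ::= (EFloor ($vx) + $vN) * $vL + (EFloor ($vy) + $vN))
    (vt ::= $vL * $vL + ((EFloor ($vx - $vqx) + $vN) * $vL + (EFloor ($vy - $vqy) + $vN))).

Lemma wp_cell N qx qy x y s a (Q : env -> arrays -> nat -> Prop) :
  s vN = INR N -> s vL = INR (2 * N + 1) -> s vqx = qx -> s vqy = qy -> s vx = x -> s vy = y ->
  in_grid N qx qy x y ->
  (forall t, (t <= 100)%nat -> Q (upd s vt (INR (cell N qx qy x y))) a t) ->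
  wp Ccell s a Q.
Proof.
  intros EN EL Eqx Eqy Ex Ey H HQ. apply in_grid_nearer in H. unfold cell in HQ. cbv zeta in HQ.
  apply wp_if; cbn [eval beval]; rewrite Ex, Ey, Eqx, Eqy; intros C; apply wp_asg; intros v Hv;
    evalin Hv;
    rewrite Ex, Ey, EN, EL, ?Eqx, ?Eqy, (INR_IZR_INZ N), <- !plus_IZR in Hv.
  - destruct (Rle_dec _ _) in H, HQ; [|lra]. destruct H as [H1 H2].
    apply pos_range in H1 as [H1 _], H2 as [H2 _].
    rewrite <- !INR_Z_to_nat, <- mult_INR, <- plus_INR in Hv by auto. rewrite Hv. apply HQ. cost.
  - destruct (Rle_dec _ _) in H, HQ; [lra|]. destruct H as [H1 H2].
    apply pos_range in H1 as [H1 _], H2 as [H2 _].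
    rewrite <- !INR_Z_to_nat, <- !mult_INR, <- !plus_INR in Hv by auto. rewrite Hv. apply HQ. cost.
Qed.

(** Normalisation is done in place. The representative already stored in a cell has a smaller index,
    so its radius is in units of w when it is compared with the new one. *)
Definition Cnorm : cmd :=
  For vi ($vn)
    (Ld vx acx ($vi) ;; vx ::= ($vx - $vpx) / $vw ;; St acx ($vi) ($vx) ;;
     Ld vy acy ($vi) ;; vy ::= ($vy - $vpy) / $vw ;; St acy ($vi) ($vy) ;;
     Ld vr acr ($vi) ;; vr ::= $vr / $vw ;; St acr ($vi) ($vr) ;;
     Ccell ;;
     Ld vp acell ($vt) ;;
     IfLe ($vp) (#0)
       (St acell ($vt) ($vi + #1))
       (Ld vd1 acr ($vp - #1) ;; CSt ($vd1) ($vr) acell ($vt) ($vi + #1))).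

Definition normalised (n k : nat) (a0 a : nat -> R) (f : R -> R) : Prop :=
  forall i, (i < n)%nat -> a i = if (i <? k)%nat then f (a0 i) else a0 i.

Lemma normalised_step n k a0 a f v :
  normalised n k a0 a f -> (k < n)%nat -> v = f (a0 k) -> normalised n (S k) a0 (upd a k v) f.
Proof.
  intros H Hk -> i Hi. destruct (Nat.eq_dec i k) as [->|].
  - rewrite upd_same. destruct (Nat.ltb_spec k (S k)); auto; lia.
  - rewrite upd_other, H by auto. destruct (Nat.ltb_spec i k), (Nat.ltb_spec i (S k)); auto; lia.
Qed.

Lemma wp_norm n K px py w qx qy s a (Q : env -> arrays -> nat -> Prop) :
  env0 n K px py s -> s vw = w -> 0 < w -> s vqx = qx -> s vqy = qy ->
  let X i := (a acx i - px) / w in let Y i := (a acy i - py) / w in let r i := a acr i / w in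
  let c i := cell (K * K) qx qy (X i) (Y i) in
  (forall i, (i < n)%nat -> in_grid (K * K) qx qy (X i) (Y i)) ->
  (forall i, a acell i = 0) ->
  (forall s' a' t, frame Cnorm s a s' a' ->
    (forall i, (i < n)%nat -> a' acx i = X i /\ a' acy i = Y i /\ a' acr i = r i) ->
    (forall b, a' acell b = 0 \/ exists i, (i < n)%nat /\ a' acell b = INR (S i) /\ c i = b) ->
    (forall i, (i < n)%nat -> exists i', (i' < n)%nat /\ a' acell (c i) = INR (S i') /\
      r i <= r i') ->
    (t <= (n + 1) * 500)%nat -> Q s' a' t) ->
  wp Cnorm s a Q.
Proof.
  intros HE Ew Hw Eqx Eqy X Y r c Hgrid H0 HQ.
  set (fx := fun u => (u - px) / w). set (fy := fun u => (u - py) / w). set (fr := fun u => u / w).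
  apply (wp_for _ _ _ _ _ _
    (fun k s' a' => normalised n k (a acx) (a' acx) fx /\ normalised n k (a acy) (a' acy) fy /\
       normalised n k (a acr) (a' acr) fr /\
       (forall b, a' acell b = 0 \/ exists i, (i < k)%nat /\ a' acell b = INR (S i) /\ c i = b) /\
       (forall i, (i < k)%nat -> exists i', (i' < k)%nat /\ a' acell (c i) = INR (S i') /\
         r i <= r i')) n 450).
  - reflexivity.
  - intros s' a' F. assert (env0 n K px py s') as HE' by (eapply env0_frame;
    [exact HE|exact F|reflexivity]). apply HE'.
  - split; [|split; [|split; [|split]]]; auto; try (intros i Hi; reflexivity). intros; lia.
  - auto.
  - intros k s' a' Hk F (I1 & I2 & I3 & I4 & I5) Hvi.
    assert (HE' : env0 n K px py s') by (eapply env0_frame; [exact HE|exact F|reflexivity]).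
    destruct HE' as (_ & _ & EN & _ & EL & _ & Epx & Epy).
    assert (Ew' : s' vw = w) by (rewrite (proj1 F); auto).
    assert (Eqx' : s' vqx = qx) by (rewrite (proj1 F); auto).
    assert (Eqy' : s' vqy = qy) by (rewrite (proj1 F); auto).
    assert (V1 : a' acx k = a acx k) by (rewrite I1 by auto; destruct (Nat.ltb_spec k k); auto;
      lia).
    assert (V2 : a' acy k = a acy k) by (rewrite I2 by auto; destruct (Nat.ltb_spec k k); auto;
      lia).
    assert (V3 : a' acr k = a acr k) by (rewrite I3 by auto; destruct (Nat.ltb_spec k k); auto;
      lia).
    apply wp_seq, (wp_ld _ _ _ _ _ k); [exact Hvi|]. intros w1 W1. asg w2 W2.
    rewrite W1, V1, Epx, Ew', rdiv_div in W2 by lra. fold (X k) in W2.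
    apply wp_seq, (wp_st _ _ _ _ _ k); [exact Hvi|]. cbn [eval upd Nat.eqb].
    apply wp_seq, (wp_ld _ _ _ _ _ k); [exact Hvi|]. intros w3 W3. asg w4 W4.
    unfold aupd at 1 in W3; cbn [Nat.eqb] in W3.
    rewrite W3, V2, Epy, Ew', rdiv_div in W4 by lra. fold (Y k) in W4.
    apply wp_seq, (wp_st _ _ _ _ _ k); [exact Hvi|]. cbn [eval upd Nat.eqb].
    apply wp_seq, (wp_ld _ _ _ _ _ k); [exact Hvi|]. intros w5 W5. asg w6 W6.
    unfold aupd in W5; cbn [Nat.eqb] in W5.
    rewrite W5, V3, Ew', rdiv_div in W6 by lra. fold (r k) in W6.
    apply wp_seq, (wp_st _ _ _ _ _ k); [exact Hvi|]. cbn [eval upd Nat.eqb].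
    apply wp_seq, (wp_cell (K * K) qx qy (X k) (Y k)); auto.
    intros t7 Ht7. fold (c k).
    apply wp_seq, (wp_ld _ _ _ _ _ (c k)); [reflexivity|]. intros w8 W8.
    unfold aupd in W8; cbn [Nat.eqb] in W8.
    assert (N1 : normalised n (S k) (a acx) (upd (a' acx) k w2) fx) by (apply normalised_step;
      auto).
    assert (N2 : normalised n (S k) (a acy) (upd (a' acy) k w4) fy) by (apply normalised_step;
      auto).
    assert (N3 : normalised n (S k) (a acr) (upd (a' acr) k w6) fr) by (apply normalised_step;
      auto).
    assert (Ek : s' vi + 1 = INR (S k)) by (rewrite Hvi, S_INR; auto).
    assert (Old : forall i, (i < k)%nat -> c i <> c k ->
       exists i', (i' < S k)%nat /\ a' acell (c i) = INR (S i') /\ r i <= r i').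
    { intros i Hi _. destruct (I5 i Hi) as (i' & Hi' & H5). exists i'. split; [lia|auto]. }
    assert (OldB : forall b, a' acell b = 0 \/ exists i, (i < S k)%nat /\ a' acell b = INR (S i) /\
      c i = b).
    { intros b. destruct (I4 b) as [Hb|(i & Hi & Hb)]; [auto|right; exists i; split; [lia|auto]]. }
    apply wp_if; cbn [eval upd Nat.eqb]; intros C.
    + apply (wp_st _ _ _ _ _ (c k)); [reflexivity|].
      split; [cost|]. unfold aupd. cbn [eval beval upd Nat.eqb]. rewrite Ek.
      change (fun k0 : nat => if (k0 =? k)%nat then ?v else ?m k0) with (upd m k v).
      split; [exact N1|split; [exact N2|split; [exact N3|split]]].
      * intros b. destruct (Nat.eqb_spec b (c k)) as [->|]; [|apply OldB].
        right. exists k. auto.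
      * intros i Hi. destruct (Nat.eqb_spec (c i) (c k)) as [Ec|Ec].
        -- exists k. split; [auto|split; [auto|]]. destruct (Nat.eq_dec i k) as [->|]; [lra|].
           destruct (I5 i ltac:(lia)) as (i' & _ & H5 & _). rewrite Ec, <- W8 in H5.
           rewrite H5, S_INR in C. pose proof (pos_INR i'). lra.
        -- apply Old; auto. destruct (Nat.eq_dec i k); [congruence|lia].
    + destruct (I4 (c k)) as [Hb|(i0 & Hi0 & Hb & Hc0)]; [lra|].
      assert (Ev : w8 - 1 = INR i0) by (rewrite W8, Hb, S_INR; ring).
      apply wp_seq, (wp_ld _ _ _ _ _ i0); [exact Ev|]. intros w9 W9.
      unfold aupd in W9; cbn [Nat.eqb] in W9.
      assert (E9 : w9 = r i0).
      { rewrite W9, upd_other, I3 by lia.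
        destruct (Nat.ltb_spec i0 k); [reflexivity|lia]. }
      apply (wp_cst _ _ _ _ _ _ _ (c k)); [reflexivity|]. intros t10 Ht10.
      split; [cost|]. cbn [eval beval upd Nat.eqb]. unfold aupd. cbn [Nat.eqb]. rewrite Ek, E9, W6.
      rewrite W6 in N3.
      split; [exact N1|split; [exact N2|split; [exact N3|split]]].
      * intros b. unfold upd. destruct (Nat.eqb_spec b (c k)) as [->|]; [|apply OldB].
        destruct (Rle_dec (r i0) (r k)); [right; exists k; auto|apply OldB].
      * intros i Hi. unfold upd. destruct (Nat.eqb_spec (c i) (c k)) as [Ec|Ec].
        -- assert (Hi0' : r i <= r i0 \/ i = k).
           { destruct (Nat.eq_dec i k); [auto|left].
             destruct (I5 i ltac:(lia)) as (i' & _ & H5 & H6). rewrite Ec, Hb in H5.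
             apply INR_eq in H5. injection H5 as ->. auto. }
           destruct (Rle_dec (r i0) (r k)).
           ++ exists k. split; [auto|split; [auto|]]. destruct Hi0' as [| ->]; lra.
           ++ exists i0. split; [lia|split; [auto|]]. destruct Hi0' as [| ->]; lra.
        -- apply Old; auto. destruct (Nat.eq_dec i k); [congruence|lia].
  - intros s' a' t F (I1 & I2 & I3 & I4 & I5) Ht. apply HQ; auto; [|cost].
    intros i Hi. rewrite I1, I2, I3 by auto. destruct (Nat.ltb_spec i n); [auto|lia].
Qed.

(** * Assembly of the main program and its approximation guarantee *)

Definition Cscale : cmd :=
  vw ::= ($vdl + $vrm) / $vN ;; vqx ::= $vqx / $vw ;; vqy ::= $vqy / $vw ;;
  vB ::= $vB / $vw + #2 * $vN.

(** The 7 is the 5 of [covers] plus 2 for passing from a cell's representative to the other disks of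
    the cell. *)
Definition Cout : cmd :=
  Asg 0 ($vsx * $vw + $vpx) ;; Asg 1 ($vsy * $vw + $vpy) ;;
  Asg 2 ($vtx * $vw + $vpx) ;; Asg 3 ($vty * $vw + $vpy) ;;
  Asg 4 ($vw * ($vN - $vd + #7)).

Definition Cmain : cmd :=
  Cinit ;; Cfar ;; Cdelta ;; Cscale ;; Cnorm ;; Cfill ;; Csuffix ;; Csearch ;; Cout.

Lemma hyp_unscale x y px py u v w : 0 < w ->
  hyp (x - (u * w + px)) (y - (v * w + py)) = w * hyp ((x - px) / w - u) ((y - py) / w - v).
Proof.
  intros Hw. replace ((x - px) / w - u) with ((x - (u * w + px)) / w) by (field; lra).
  replace ((y - py) / w - v) with ((y - (v * w + py)) / w) by (field; lra).
  rewrite hyp_scale by auto. field. lra.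
Qed.

(** All factors are compared with powers of N = K^2: the number of cells is O(N^2) and M^2 is O(N).
    K >= 8 absorbs the lower-order terms. *)
Lemma cost_bound (K n nc N M : Z) : (8 <= K)%Z -> N = (K * K)%Z -> M = (4 * K + 2)%Z ->
  nc = (2 * (2 * N + 1) * (2 * N + 1))%Z ->
  (1500 * (n + 1) +
   (nc + 1) * ((M + 1) * ((M + 1) * 700 + 700) + 200) + (M * M + 1) * (6 * N * 400 + 200) +
   (nc + N + 1) * (2 * (M + 1) * ((M + 1) * 800 + 1000) + 100)
   <= 1500 * (n + 1) + 900000 * (N * N * N))%Z.
Proof.
  intros HK HN HM Hnc.
  assert (HKK : (8 * K <= K * K)%Z) by (apply Z.mul_le_mono_nonneg_r; lia).
  assert (HN64 : (64 <= N)%Z) by lia.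
  assert (HNN : (64 * N <= N * N)%Z) by (apply Z.mul_le_mono_nonneg_r; lia).
  assert (A1 : (0 <= nc /\ nc + N + 1 <= 9 * (N * N))%Z) by (rewrite Hnc; lia).
  assert (A4 : (0 <= (M + 1) * ((M + 1) * 700 + 700) + 200 <= 14900 * N)%Z) by (rewrite HM; lia).
  assert (A5 : (0 <= 2 * (M + 1) * ((M + 1) * 800 + 1000) + 100 <= 34100 * N)%Z) by (rewrite HM;
    lia).
  assert (A6 : (0 <= M * M + 1 <= 20 * N)%Z) by (rewrite HM; lia).
  assert (A7 : (0 <= 6 * N * 400 + 200 <= 2600 * N)%Z) by lia.
  assert (B1 : ((nc + 1) * ((M + 1) * ((M + 1) * 700 + 700) + 200) <= (9 * (N * N)) * (14900 *
    N))%Z) by (apply Z.mul_le_mono_nonneg; lia).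
  assert (B2 : ((nc + N + 1) * (2 * (M + 1) * ((M + 1) * 800 + 1000) + 100) <= (9 * (N * N)) *
    (34100 * N))%Z) by (apply Z.mul_le_mono_nonneg; lia).
  assert (B3 : ((M * M + 1) * (6 * N * 400 + 200) <= (20 * N) * (2600 * N))%Z) by (apply
    Z.mul_le_mono_nonneg; lia).
  assert (B4 : (1 * (N * N) <= N * (N * N))%Z) by (apply Z.mul_le_mono_nonneg_r; lia).
  replace (N * (N * N))%Z with (N * N * N)%Z in B4 by ring. set (P3 := (N * N * N)%Z) in *.
  replace (9 * (N * N) * (14900 * N))%Z with (134100 * P3)%Z in B1 by (unfold P3; ring).
  replace (9 * (N * N) * (34100 * N))%Z with (306900 * P3)%Z in B2 by (unfold P3; ring).
  replace (20 * N * (2600 * N))%Z with (52000 * (N * N))%Z in B3 by ring.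
  lia.
Qed.

Definition covered (n : nat) (x y r : nat -> R) (c1x c1y c2x c2y rho : R) : Prop :=
  forall i, (i < n)%nat -> hyp (x i - c1x) (y i - c1y) + r i <= rho \/
    hyp (x i - c2x) (y i - c2y) + r i <= rho.

(* In units of w the radius produced exceeds an arbitrary feasible one by at most 10. *)
Lemma radius_bound n x y r px py eps N d w e1x e1y e2x e2y rho :
  (1 <= n)%nat -> 0 < eps -> x 0%nat = px -> y 0%nat = py -> 0 < r 0%nat -> 0 < w -> 0 < N ->
    0 <= d ->
  30 <= eps * N ->
  (forall a1 b1 a2 b2 rho', covered n x y r a1 b1 a2 b2 rho' -> w * N <= 3 * rho') ->
  (forall x1 y1 x2 y2 rho', 0 <= rho' -> - N <= x1 <= N -> - N <= y1 <= N ->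
     covered n (fun i => (x i - px) / w) (fun i => (y i - py) / w) (fun i =>
       r i / w) x1 y1 x2 y2 rho' ->
     N - d - 1 < rho' + 2) ->
  covered n x y r e1x e1y e2x e2y rho ->
  w * (N - d + 7) <= (1 + eps) * rho.
Proof.
  intros Hn He Ex Ey Hr Hw HN Hd HeN H3 Hopt Hc.
  assert (H3' : w * N <= 3 * rho) by eauto.
  assert (H0 : 0 < rho) by nra.
  assert (Hmain : w * (N - d + 7) <= rho + 10 * w).
  (* If rho > w N, the output radius is at most w (N + 7) and nothing remains. Otherwise the disk
     containing the first input disk is named first: its center is within rho <= w N of p, hence
     inside the grid around p. *)
  { destruct (Rle_dec rho (w * N)) as [Hle|Hgt]; [|nra].
    assert (Swap : exists a1 b1 a2 b2, covered n x y r a1 b1 a2 b2 rho /\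
      hyp (px - a1) (py - b1) <= rho).
    { destruct (Hc 0%nat ltac:(lia)) as [C|C]; rewrite Ex, Ey in C.
      - exists e1x, e1y, e2x, e2y. split; [auto|lra].
      - exists e2x, e2y, e1x, e1y. split; [|lra]. intros i Hi. destruct (Hc i Hi); auto. }
    destruct Swap as (a1 & b1 & a2 & b2 & Hc' & Hn1).
    assert (Hs : forall u v u' v', hyp ((u - px) / w - (u' - px) / w) ((v - py) / w - (v' - py) /
      w) = hyp (u - u') (v - v') / w).
    { intros u v u' v'. rewrite <- hyp_scale by auto. f_equal; field; lra. }
    assert (Hb : forall c u, - (w * N) <= c - u <= w * N -> - N <= (u - c) / w <= N).
    { intros c u Hu. split; apply (Rmult_le_reg_r w); auto;
      replace ((u - c) / w * w) with (u - c) by (field; lra); lra. }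
    pose proof (abs_le_hyp (px - a1) (py - b1)) as [Ha1 Hb1].
    assert (Ha2 : - N <= (a1 - px) / w <= N) by (apply Hb; lra).
    assert (Hb2 : - N <= (b1 - py) / w <= N) by (apply Hb; lra).
    assert (Hrw : 0 <= rho / w) by (apply Rle_mult_inv_pos; lra).
    assert (Hlt : N - d - 1 < rho / w + 2).
    { apply (Hopt _ _ ((a2 - px) / w) ((b2 - py) / w) _ Hrw Ha2 Hb2).
      intros i Hi. rewrite !Hs. destruct (Hc' i Hi) as [C|C]; [left|right];
        (apply (Rmult_le_reg_r w); [auto|]; rewrite Rmult_plus_distr_r;
         unfold Rdiv; rewrite !Rmult_assoc, Rinv_l, !Rmult_1_r by lra; exact C). }
    apply (Rmult_lt_compat_l w) in Hlt; [|auto].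
    replace (w * (rho / w + 2)) with (rho + 2 * w) in Hlt by (field; lra). nra. }
  assert (10 * w <= eps * rho); [|lra].
  assert (30 * w <= eps * (w * N)) by nra. nra.
Qed.

Lemma wp_scale s a (Q : env -> arrays -> nat -> Prop) :
  (forall s' t, frame Cscale s a s' a ->
    s' vw = rdiv (s vdl + s vrm) (s vN) -> s' vqx = rdiv (s vqx) (s' vw) ->
    s' vqy = rdiv (s vqy) (s' vw) -> s' vB = rdiv (s vB) (s' vw) + 2 * s vN ->
    (t <= 100)%nat -> Q s' a t) ->
  wp Cscale s a Q.
Proof.
  intros HQ. asg v1 H1. asg v2 H2. asg v3 H3. apply wp_asg. intros v4 H4. evalin H4.
  apply HQ; try (cbn [upd Nat.eqb]; assumption); [framed|cost].
Qed.

Lemma wp_out s a (Q : env -> arrays -> nat -> Prop) :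
  (forall s' t, s' 0%nat = s vsx * s vw + s vpx -> s' 1%nat = s vsy * s vw + s vpy ->
    s' 2%nat = s vtx * s vw + s vpx -> s' 3%nat = s vty * s vw + s vpy ->
    s' 4%nat = s vw * (s vN - s vd + 7) -> (t <= 100)%nat -> Q s' a t) ->
  wp Cout s a Q.
Proof.
  intros HQ. asg v1 H1. asg v2 H2. asg v3 H3. asg v4 H4. apply wp_asg. intros v5 H5. evalin H5.
  apply HQ; try (cbn [upd Nat.eqb]; assumption). cost.
Qed.

Lemma wp_main n eps s a (Q : env -> arrays -> nat -> Prop) :
  (1 <= n)%nat -> 0 < eps -> s vpk = INR n + INR n / (INR n + eps) ->
  (forall i, (i < n)%nat -> 0 < a acr i) -> (forall i, a acell i = 0) -> (forall i, a atab i = 0) ->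
  (forall s' a' t, 0 <= s' 4%nat ->
    covered n (a acx) (a acy) (a acr) (s' 0%nat) (s' 1%nat) (s' 2%nat) (s' 3%nat) (s' 4%nat) ->
    (forall e1x e1y e2x e2y rho, covered n (a acx) (a acy) (a acr) e1x e1y e2x e2y rho ->
       s' 4%nat <= (1 + eps) * rho) ->
    (Z.of_nat t <= 1500 * (Z.of_nat n + 1) +
       900000 * (Z.of_nat (kappa eps) * Z.of_nat (kappa eps)) ^ 3)%Z -> Q s' a' t) ->
  wp Cmain s a Q.
Proof.
  intros Hn He E0 Hpos Hcell0 Htab0 HQ.
  destruct (kappa_spec eps He) as (He1 & He2 & HK & _ & HK30 & _).
  set (e := if Rle_dec 1 eps then 1 else eps) in *. clearbody e.
  remember (kappa eps) as K eqn:EK. rewrite <- mult_INR in HK30.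
  assert (HN64 : (64 <= K * K)%nat) by nia.
  assert (HN : 64 <= INR (K * K)).
  { change 64 with (IZR (Z.of_nat 64)). rewrite <- INR_IZR_INZ. now apply le_INR. }
  set (px := a acx 0%nat). set (py := a acy 0%nat).
  unfold Cmain. apply wp_seq, (wp_init n eps); auto.
  rewrite <- EK. fold px py. intros s1 t1 HE1 Ht1.
  apply wp_seq, (wp_far n K px py); auto.
  intros s2 t2 F2 Hrm Hrm' Edl Hfar Hfar' Ht2.
  assert (HE2 : env0 n K px py s2) by (eapply env0_frame; [exact HE1|exact F2|reflexivity]).
  apply wp_seq, (wp_delta n K px py); auto.
  intros s3 t3 F3 EB3 Hdl Hdl' Ht3.
  assert (HE3 : env0 n K px py s3) by (eapply env0_frame; [exact HE2|exact F3|reflexivity]).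
  assert (Erm3 : s3 vrm = s2 vrm) by (rewrite (proj1 F3); reflexivity).
  assert (Eqx3 : s3 vqx = s2 vqx) by (rewrite (proj1 F3); reflexivity).
  assert (Eqy3 : s3 vqy = s2 vqy) by (rewrite (proj1 F3); reflexivity).
  apply wp_seq, wp_scale. intros s4 t4 F4 Ew Eqx4 Eqy4 EB4 Ht4.
  assert (HE4 : env0 n K px py s4) by (eapply env0_frame; [exact HE3|exact F4|reflexivity]).
  set (dl := s3 vdl) in *. set (rm := s2 vrm) in *. set (qx0 := s2 vqx) in *.
  set (qy0 := s2 vqy) in *.
  assert (EN3 : s3 vN = INR (K * K)) by apply HE3.
  rewrite Erm3, EN3, rdiv_div in Ew by lra. set (w := s4 vw) in *.
  assert (Hdl0 : 0 <= dl).
  { pose proof (hyp_nonneg (a acx 0%nat - px) (a acy 0%nat - py)).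
    pose proof (hyp_nonneg (a acx 0%nat - px - qx0) (a acy 0%nat - py - qy0)).
    destruct (Hdl 0%nat ltac:(lia)); lra. }
  assert (Hrm0 : 0 < rm).
  { pose proof (Hpos 0%nat ltac:(lia)). pose proof (Hrm 0%nat ltac:(lia)). lra. }
  assert (Hw : 0 < w) by (rewrite Ew; apply Rdiv_lt_0_compat; lra).
  assert (HwN : w * INR (K * K) = dl + rm) by (rewrite Ew; field; lra).
  rewrite Eqx3, rdiv_div in Eqx4 by lra. rewrite Eqy3, rdiv_div in Eqy4 by lra.
  rewrite EB3, Edl, EN3, rdiv_div, <- hyp_scale in EB4 by lra.
  set (qx := qx0 / w) in *. set (qy := qy0 / w) in *.
  set (X := fun i => (a acx i - px) / w). set (Y := fun i => (a acy i - py) / w).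
  set (r := fun i => a acr i / w).
  assert (Hw' : forall u v, u <= v -> u / w <= v / w).
  { intros. apply Rmult_le_compat_r; [|auto]. apply Rlt_le, Rinv_0_lt_compat. auto. }
  assert (Hr : forall i, (i < n)%nat -> 0 < r i) by (intros; apply Rdiv_lt_0_compat; auto).
  assert (EN : INR (K * K) = dl / w + rm / w).
  { replace (dl / w + rm / w) with ((dl + rm) / w) by (field; lra). rewrite <- HwN. field. lra. }
  assert (Hin : forall i, (i < n)%nat -> hyp (X i) (Y i) + r i <= INR (K * K) \/
     hyp (X i - qx) (Y i - qy) + r i <= INR (K * K)).
  { intros i Hi. unfold X, Y, r, qx, qy. pose proof (Hw' _ _ (Hrm i Hi)).
    replace ((a acx i - px) / w - qx0 / w) with ((a acx i - px - qx0) / w) by (field; lra).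
    replace ((a acy i - py) / w - qy0 / w) with ((a acy i - py - qy0) / w) by (field; lra).
    rewrite !hyp_scale by auto. destruct (Hdl i Hi) as [C|C]; apply Hw' in C; [left|right]; lra. }
  assert (Hgrid : forall i, (i < n)%nat -> in_grid (K * K) qx qy (X i) (Y i)).
  { intros i Hi. pose proof (Hr i Hi). destruct (Hin i Hi); [left|right]; lra. }
  apply wp_seq, (wp_norm n K px py w qx qy); auto.
  intros s5 a5 t5 F5 Hnorm Hcells Hrep Ht5.
  fold (X) (Y) (r) in Hnorm, Hcells, Hrep.
  (* All n disks keep their indices; only those recorded in some cell count as represented. *)
  set (I := Inst K X Y r qx qy
    (fun j => exists c, (c < 2 * (2 * (K * K) + 1) * (2 * (K * K) + 1))%nat /\
      a5 acell c = INR (S j))).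
  assert (HIn : forall j, irep I j -> (j < n)%nat).
  { intros j (c & _ & Ec). destruct (Hcells c) as [E|(j' & Hj' & E & _)]; rewrite Ec in E.
    - rewrite S_INR in E. pose proof (pos_INR j). lra.
    - apply INR_eq in E. injection E as ->. auto. }
  assert (HI : good I).
  { split; [exact HK|]. intros j Hj. apply HIn in Hj. split; [now apply Hr|now apply Hin]. }
  assert (HE5 : env0 n K px py s5) by (eapply env0_frame; [exact HE4|exact F5|reflexivity]).
  assert (HG5 : genv I s5).
  { destruct HE5 as (A1 & A2 & A3 & A4 & A5 & A6 & A7 & A8).
    unfold genv. repeat split; auto; rewrite (proj1 F5) by reflexivity; auto. }
  assert (Ew5 : s5 vw = w) by (rewrite (proj1 F5); reflexivity).
  apply wp_seq, (wp_fill I); auto.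
  { intros j Hj. apply Hnorm. auto. }
  { split; [|reflexivity]. intros c _. destruct (Hcells c) as [E|(j & _ & E & _)]; eauto. }
  { intros x. rewrite (proj2 F5) by reflexivity. auto. }
  intros s6 a6 t6 F6 HT6 Ht6.
  assert (HG6 : genv I s6) by (eapply genv_frame; [exact HG5|exact F6|reflexivity]).
  apply wp_seq, (wp_suffix I); auto. intros s7 a7 t7 F7 HT7 Ht7.
  assert (HG7 : genv I s7) by (eapply genv_frame; [exact HG6|exact F7|reflexivity]).
  (* One represented disk is enough for [test_nonneg]. *)
  destruct (Hrep 0%nat ltac:(lia)) as (i0 & Hi0 & Hc0 & _).
  assert (Hi0r : irep I i0) by (exists (cell (K * K) qx qy (X 0%nat) (Y 0%nat)); split;
    [apply cell_lt; apply Hgrid; lia|exact Hc0]).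
  apply wp_seq, (wp_search I i0); auto.
  intros s8 a8 t8 d F8 Ed HdN Hcov Hopt Ht8.
  assert (KP : forall x, writes Csearch x = false -> writes Csuffix x = false ->
    writes Cfill x = false -> s8 x = s5 x).
  { intros x Hx Hx' Hx''. rewrite (proj1 F8), (proj1 F7), (proj1 F6); auto. }
  assert (Ew8 : s8 vw = w) by (rewrite KP; auto).
  assert (Epx8 : s8 vpx = px) by (rewrite KP by reflexivity; apply HE5).
  assert (Epy8 : s8 vpy = py) by (rewrite KP by reflexivity; apply HE5).
  assert (EN8 : s8 vN = INR (K * K)) by (rewrite KP by reflexivity; apply HE5).
  apply wp_out. intros s9 t9 E90 E91 E92 E93 E94 Ht9.
  rewrite Ew8, Epx8, Epy8 in *. rewrite EN8, Ed in E94.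
  change (iN I) with (K * K)%nat in *. pose proof (le_INR _ _ HdN) as HdR.
  pose proof (pos_INR d) as Hd0.
  apply HQ.
  - rewrite E94. apply Rmult_le_pos; lra.
  - intros i Hi. rewrite E90, E91, E92, E93, E94, !hyp_unscale by auto.
    fold (X i) (Y i). replace (a acr i) with (w * r i) by (unfold r; field; lra).
    rewrite <- !Rmult_plus_distr_l.
    (* Disk i is compared with the representative j of its cell: r i <= r j, and the centers are at
       distance at most 2, which turns 5 into 7. *)
    destruct (Hrep i Hi) as (j & Hj & Ej & Hrj).
    assert (Hjr : irep I j) by (exists (cell (K * K) qx qy (X i) (Y i)); split; [apply cell_lt;
      auto|exact Ej]).
    assert (Hcj : cell (K * K) qx qy (X j) (Y j) = cell (K * K) qx qy (X i) (Y i)).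
    { destruct (Hcells (cell (K * K) qx qy (X i) (Y i))) as [E|(j' & Hj' & E & Ec)]; unfold X,
      Y in *; rewrite Ej in E.
      - rewrite S_INR in E. pose proof (pos_INR j). lra.
      - apply INR_eq in E. injection E as ->. exact Ec. }
    destruct (cell_inj _ _ _ _ _ _ _ (Hgrid j Hj) (Hgrid i Hi) Hcj) as [Dx Dy].
    pose proof (hyp_small _ _ Dx Dy) as HD. rewrite hyp_sym in HD.
    destruct (Hcov j Hjr) as [C|C]; [left|right]; cbn [iX iY iR I] in C;
      (apply Rmult_le_compat_l; [lra|]).
    + pose proof (hyp_triangle_sub (X i) (Y i) (s8 vsx) (s8 vsy) (X j) (Y j)). unfold r in *. lra.
    + pose proof (hyp_triangle_sub (X i) (Y i) (s8 vtx) (s8 vty) (X j) (Y j)). unfold r in *. lra.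
  - intros e1x e1y e2x e2y rho Hc. rewrite E94.
    apply (radius_bound n (a acx) (a acy) (a acr) px py eps (INR (K * K)) (INR d) w e1x e1y e2x e2y
      rho); auto; try lra.
    + nra.
    + intros a1 b1 a2 b2 rho' Hc'. rewrite HwN.
      eapply (farthest_point_bound n (a acx) (a acy) (a acr) px py qx0 qy0 rm dl); eauto.
      intros i Hi. rewrite <- Edl. auto.
    (* A cover of all disks covers the represented ones, so the lower bound for the thinned family
       carries over. *)
    + intros x1 y1 x2 y2 rho' Hr0 Hx1 Hy1 Hc'. apply (Hopt x1 y1 x2 y2 rho'); auto.
      intros j Hj. apply HIn in Hj. exact (Hc' j Hj).
  - unfold ncells, iM in *. cbn [iK iN I] in *. change (iN I) with (K * K)%nat in *.
    change (iK I) with K in *.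
    pose proof (cost_bound (Z.of_nat K) (Z.of_nat n) _ _ _ ltac:(lia) eq_refl eq_refl eq_refl) as
      HCB.
    nia.
Qed.

(** * Relocation of the input *)

(* The input occupies an initial segment of the registers.  Packing n and eps into
   n + n / (n + eps) frees register 1; disks 0 and 1 are then moved by straight-line
   code, which frees registers 2 to 7 for the loop that moves the others.  The base
   address is the integer part of 128 times the packed number. *)
Definition relocation : list instr :=
  [ IAdd 1 0 1; IDiv 1 0 1; IJle 0 1 46; IAdd 0 0 1;
    IAdd 1 0 0; IAdd 1 1 1; IAdd 1 1 1; IAdd 1 1 1; IAdd 1 1 1; IAdd 1 1 1; IAdd 1 1 1;
    IFloor 1 1;
    IStore 1 2; IConst 2 1; IAdd 1 1 2; IStore 1 3; IAdd 1 1 2; IStore 1 4;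
    IConst 3 6; IAdd 1 1 3;
    IStore 1 5; IAdd 1 1 2; IStore 1 6; IAdd 1 1 2; IStore 1 7;
    IConst 3 8; IFloor 4 0; IConst 5 3; IMul 4 4 5; IAdd 4 4 2; IAdd 4 4 2;
    IJle 4 3 47;
    IConst 5 6; IAdd 1 1 5;
    ILoad 5 3; IStore 1 5; IAdd 3 3 2; IAdd 1 1 2;
    ILoad 5 3; IStore 1 5; IAdd 3 3 2; IAdd 1 1 2;
    ILoad 5 3; IStore 1 5; IAdd 3 3 2;
    IJmp 31;
    IHalt;
    IAdd NV 0 0; IAdd NV NV NV; IAdd NV NV NV; IAdd NV NV NV; IAdd NV NV NV; IAdd NV NV NV;
    IAdd NV NV NV; IFloor NV NV ].

(** Counterpart of [wp] for hand-written code: before the relocation there is no layout of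
    variables, so assertions speak of the bare memory. *)
Definition ev (P : program) (T pc : nat) (m : memory) (Post : nat -> memory -> Prop) : Prop :=
  exists t pc' m', (t <= T)%nat /\ run P t (pc, m) = (pc', m') /\ Post pc' m'.

Lemma ev_step P T pc m pc1 m1 Post :
  step P (pc, m) = (pc1, m1) -> ev P T pc1 m1 Post -> ev P (S T) pc m Post.
Proof.
  intros E (t & pc' & m' & Ht & R & HP). exists (S t), pc', m'.
  split; [lia|split; auto]. cbn [run]. now rewrite E.
Qed.

Lemma ev_done (P : program) T pc m (Post : nat -> memory -> Prop) : Post pc m -> ev P T pc m Post.
Proof. intros H. exists 0%nat, pc, m. split; [lia|auto]. Qed.

Lemma ev_bind P T1 T2 pc m (Post1 Post2 : nat -> memory -> Prop) :
  ev P T1 pc m Post1 -> (forall pc' m', Post1 pc' m' -> ev P T2 pc' m' Post2) ->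
  ev P (T1 + T2) pc m Post2.
Proof.
  intros (t & pc' & m' & Ht & R & H1) H. destruct (H pc' m' H1) as (t2 & pc2 & m2 & Ht2 & R2 & H2).
  exists (t + t2)%nat, pc2, m2. split; [lia|split; auto]. now rewrite run_add, R.
Qed.

Fixpoint setl (l : list R) (i : nat) (v : R) : list R :=
  match l, i with
  | [], _ => []
  | _ :: l, O => v :: l
  | x :: l, S i => x :: setl l i v
  end.

Lemma setl_length l i v : length (setl l i v) = length l.
Proof. revert i. induction l; intros [|i]; simpl; auto. Qed.

Lemma setl_nth l i v x : (i < length l)%nat -> nth x (setl l i v) 0 = if Nat.eqb x i then v else
  nth x l 0.
Proof.
  revert i x. induction l as [|y l IH]; intros i x H; simpl in H; [lia|].
  destruct i as [|i], x as [|x]; simpl; auto. apply IH. lia.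
Qed.

(* Registers 0..7 contain [l], and the first [c] input words (from the memory [m0])
   have been copied to the array area at [A]. *)
Definition copied (m0 : memory) (A c : nat) (m : memory) (l : list R) : Prop :=
  length l = 8%nat /\ (128 <= A)%nat /\
  (forall x, (x < 8)%nat -> m x = nth x l 0) /\
  (forall x, (8 <= x)%nat -> (x < A)%nat -> m x = m0 x) /\
  (forall d a, (a < 8)%nat ->
     m (A + 8 * d + a)%nat = if (a <? 3)%nat && (3 * d + a <? c)%nat then m0 (2 + (3 * d + a))%nat
       else 0).

Lemma copied_reg m0 A c m l i v :
  copied m0 A c m l -> (i < 8)%nat -> copied m0 A c (upd m i v) (setl l i v).
Proof.
  intros (H1 & H2 & H3 & H4 & H5) Hi. split; [|split; [|split; [|split]]]; auto.
  - now rewrite setl_length.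
  - intros x Hx. rewrite setl_nth by lia. unfold upd. destruct (Nat.eqb x i); auto.
  - intros x Hx Hx'. rewrite upd_other by lia. auto.
  - intros d a Ha. rewrite upd_other by lia. auto.
Qed.

Lemma copied_store m0 A c m l d a :
  copied m0 A c m l -> c = (3 * d + a)%nat -> (a < 3)%nat ->
  copied m0 A (S c) (upd m (A + 8 * d + a) (m0 (2 + c)%nat)) l.
Proof.
  intros (H1 & H2 & H3 & H4 & H5) Hc Ha. split; [|split; [|split; [|split]]]; auto.
  - intros x Hx. rewrite upd_other by lia. auto.
  - intros x Hx Hx'. rewrite upd_other by lia. auto.
  - intros d' a' Ha'. destruct (Nat.eq_dec (A + 8 * d' + a') (A + 8 * d + a)) as [E|E].
    + assert (d' = d /\ a' = a) as [-> ->] by lia. rewrite upd_same, Hc.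
      destruct (Nat.ltb_spec a 3), (Nat.ltb_spec (3 * d + a) (S (3 * d + a))); try lia. reflexivity.
    + rewrite upd_other, H5 by auto.
      destruct (Nat.ltb_spec a' 3), (Nat.ltb_spec (3 * d' + a') c),
        (Nat.ltb_spec (3 * d' + a') (S c)); auto; lia.
Qed.

Lemma ev_add P T pc m Post m0 A c l i j k :
  nth_error P pc = Some (IAdd i j k) -> copied m0 A c m l -> (i < 8)%nat -> (j < 8)%nat ->
    (k < 8)%nat ->
  (forall m', copied m0 A c m' (setl l i (nth j l 0 + nth k l 0)) -> ev P T (S pc) m' Post) ->
  ev P (S T) pc m Post.
Proof.
  intros E HC Hi Hj Hk H. eapply ev_step; [unfold step; rewrite E; reflexivity|]. apply H.
  pose proof HC as (_ & _ & H3 & _). rewrite !H3 by auto. now apply copied_reg.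
Qed.

Lemma ev_mul P T pc m Post m0 A c l i j k :
  nth_error P pc = Some (IMul i j k) -> copied m0 A c m l -> (i < 8)%nat -> (j < 8)%nat ->
    (k < 8)%nat ->
  (forall m', copied m0 A c m' (setl l i (nth j l 0 * nth k l 0)) -> ev P T (S pc) m' Post) ->
  ev P (S T) pc m Post.
Proof.
  intros E HC Hi Hj Hk H. eapply ev_step; [unfold step; rewrite E; reflexivity|]. apply H.
  pose proof HC as (_ & _ & H3 & _). rewrite !H3 by auto. now apply copied_reg.
Qed.

Lemma ev_const P T pc m Post m0 A c l i z :
  nth_error P pc = Some (IConst i z) -> copied m0 A c m l -> (i < 8)%nat ->
  (forall m', copied m0 A c m' (setl l i (IZR z)) -> ev P T (S pc) m' Post) ->
  ev P (S T) pc m Post.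
Proof.
  intros E HC Hi H. eapply ev_step; [unfold step; rewrite E; reflexivity|]. apply H.
  now apply copied_reg.
Qed.

Lemma ev_floor P T pc m Post m0 A c l i j :
  nth_error P pc = Some (IFloor i j) -> copied m0 A c m l -> (i < 8)%nat -> (j < 8)%nat ->
  (forall m', copied m0 A c m' (setl l i (IZR (floorZ (nth j l 0)))) -> ev P T (S pc) m' Post) ->
  ev P (S T) pc m Post.
Proof.
  intros E HC Hi Hj H. eapply ev_step; [unfold step; rewrite E; reflexivity|]. apply H.
  pose proof HC as (_ & _ & H3 & _). rewrite !H3 by auto. now apply copied_reg.
Qed.

Lemma ev_load (x : nat) P T pc m Post m0 A c l i j :
  nth_error P pc = Some (ILoad i j) -> copied m0 A c m l -> (i < 8)%nat -> (j < 8)%nat ->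
  nth j l 0 = INR x -> (8 <= x)%nat -> (x < A)%nat ->
  (forall m', copied m0 A c m' (setl l i (m0 x)) -> ev P T (S pc) m' Post) ->
  ev P (S T) pc m Post.
Proof.
  intros E HC Hi Hj Hx Hx1 Hx2 H. eapply ev_step; [unfold step; rewrite E; reflexivity|]. apply H.
  pose proof HC as (_ & _ & H3 & H4 & _). rewrite (H3 j), Hx, addr_INR, H4 by auto.
  now apply copied_reg.
Qed.

Lemma ev_store (d a : nat) P T pc m Post m0 A c l i j :
  nth_error P pc = Some (IStore i j) -> copied m0 A c m l -> (i < 8)%nat -> (j < 8)%nat ->
  nth i l 0 = INR (A + 8 * d + a) -> c = (3 * d + a)%nat -> (a < 3)%nat ->
    nth j l 0 = m0 (2 + c)%nat ->
  (forall m', copied m0 A (S c) m' l -> ev P T (S pc) m' Post) ->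
  ev P (S T) pc m Post.
Proof.
  intros E HC Hi Hj Hx Hc Ha Hv H. eapply ev_step; [unfold step; rewrite E; reflexivity|]. apply H.
  pose proof HC as (_ & _ & H3 & _). rewrite (H3 i), (H3 j), Hx, addr_INR, Hv by auto.
  now apply copied_store.
Qed.

Lemma INR_add_eq a b c : c = (a + b)%nat -> INR a + INR b = INR c.
Proof. intros ->. symmetry. apply plus_INR. Qed.


Ltac next lem :=
  eapply lem;
  [match goal with H : forall i x, nth_error relocation i = Some x -> _ |- _ => apply H;
    reflexivity end
  |eassumption|lia|..]; try lia; try reflexivity;
  match goal with H : copied _ _ _ _ _ |- _ => clear H end;
  let m := fresh "m" in let H := fresh "HC" in intros m H; cbn [setl nth] in H.

(** Register 1 points to the word written last, register 3 to the next word to read and register 4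
    to the end of the input. [rem] only bounds the number of disks left, since n may be smaller than
    the starting index 2. *)
Lemma relocation_loop P m0 A n :
  (forall i x, nth_error relocation i = Some x -> nth_error P i = Some x) -> (3 * n + 2 <= A)%nat ->
  forall rem i m p y5 y6 y7, (2 <= i)%nat -> (n <= i + rem)%nat ->
  copied m0 A (3 * i) m [p; INR (A + 8 * (i - 1) + 2); INR 1; INR (2 + 3 * i); INR (3 * n + 2); y5;
    y6; y7] ->
  ev P (15 * rem + 1) 31 m (fun pc m' => pc = 47%nat /\
    exists c l, (3 * n <= c)%nat /\ copied m0 A c m' l /\ nth 0 l 0 = p).
Proof.
  intros Hcode HA. induction rem as [|rem IH]; intros i m p y5 y6 y7 Hi Hn HC.
  - eapply ev_step.
    + unfold step. rewrite (Hcode 31%nat _ eq_refl). pose proof HC as (_ & _ & H3 & _).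
      rewrite !H3 by lia. cbn [nth]. destruct (Rle_dec (INR (3 * n + 2)) (INR (2 + 3 * i))) as
        [_|Hf]; [reflexivity|].
      exfalso. apply Hf, le_INR. lia.
    + apply ev_done. split; auto. exists (3 * i)%nat. eexists.
      split; [lia|split; [exact HC|reflexivity]].
  - destruct (Nat.le_gt_cases n i) as [Hle|Hgt].
    { destruct (IH i m p y5 y6 y7) as (t & pc' & m' & Ht & R); auto; [lia|].
      exists t, pc', m'. split; [lia|exact R]. }
    replace (15 * S rem + 1)%nat with (S (14 + (15 * rem + 1))) by lia.
    eapply ev_step.
    { unfold step. rewrite (Hcode 31%nat _ eq_refl). pose proof HC as (_ & _ & H3 & _).
      rewrite !H3 by lia. cbn [nth]. destruct (Rle_dec (INR (3 * n + 2)) (INR (2 + 3 * i))) as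
        [Hf|_]; [|reflexivity].
      exfalso. apply INR_le in Hf. lia. }
    (* 6 leads from the third word of cell i - 1, at A + 8 (i - 1) + 2, to the first word of cell
       i. *)
    next ev_const.
    change (IZR 6) with (IZR (Z.of_nat 6)) in HC. rewrite <- INR_IZR_INZ in HC.
    next ev_add.
    rewrite (INR_add_eq _ _ (A + 8 * i + 0)) in HC by lia.
    next (ev_load (2 + 3 * i)).
    next (ev_store i 0).
    next ev_add.
    rewrite (INR_add_eq _ _ (2 + S (3 * i))) in HC by lia.
    next ev_add.
    rewrite (INR_add_eq _ _ (A + 8 * i + 1)) in HC by lia.
    next (ev_load (2 + S (3 * i))).
    next (ev_store i 1).
    next ev_add.
    rewrite (INR_add_eq _ _ (2 + S (S (3 * i)))) in HC by lia.
    next ev_add.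
    rewrite (INR_add_eq _ _ (A + 8 * i + 2)) in HC by lia.
    next (ev_load (2 + S (S (3 * i)))).
    next (ev_store i 2).
    next ev_add.
    rewrite (INR_add_eq _ _ (2 + 3 * S i)) in HC by lia.
    eapply ev_step; [unfold step; rewrite (Hcode 45%nat _ eq_refl); reflexivity|].
    replace (S (S (S (3 * i)))) with (3 * S i)%nat in HC by lia.
    replace (A + 8 * i + 2)%nat with (A + 8 * (S i - 1) + 2)%nat in HC by lia.
    eapply IH; [| |exact HC]; lia.
Qed.

(** At first only register 1 is free, so 128 p is formed by doubling. The factor 128 places the base
    beyond variables and temporaries and also beyond the input, where memory is 0. For n = 1 the
    second block copied consists of zeros. *)
Lemma relocation_start P m0 n eps A : let p := INR n + INR n / (INR n + eps) in
  (forall i x, nth_error relocation i = Some x -> nth_error P i = Some x) ->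
  (1 <= n)%nat -> 0 < eps -> m0 0%nat = INR n -> m0 1%nat = eps ->
  (forall x, (3 * n + 2 <= x)%nat -> m0 x = 0) -> INR A = IZR (floorZ (128 * p)) ->
    (128 * n <= A)%nat ->
  ev P 31 0 m0 (fun pc m => pc = 31%nat /\ exists y5 y6 y7,
    copied m0 A 6 m [p; INR (A + 8 * 1 + 2); INR 1; INR 8; INR (3 * n + 2); y5; y6; y7]).
Proof.
  intros p Hcode Hn He E0 E1 Hz EA HA.
  assert (Hn' : 1 <= INR n) by (change 1 with (INR 1); now apply le_INR).
  assert (Hf : 0 < INR n / (INR n + eps) < 1).
  { split; [apply Rdiv_lt_0_compat; lra|]. apply (Rmult_lt_reg_r (INR n + eps)); [lra|].
    replace (INR n / (INR n + eps) * (INR n + eps)) with (INR n) by (field; lra). lra. }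
  assert (Hfl : floorZ p = Z.of_nat n) by (apply floorZ_unique; rewrite <- INR_IZR_INZ; unfold p;
    lra).
  assert (HC : copied m0 A 0 m0 [INR n; eps; m0 2%nat; m0 3%nat; m0 4%nat; m0 5%nat; m0 6%nat;
    m0 7%nat]).
  { split; [reflexivity|split; [lia|split; [|split]]]; auto.
    - intros x Hx. do 8 (destruct x as [|x]; [auto|]). lia.
    - intros d a Ha. rewrite andb_false_r. apply Hz. lia. }
  next ev_add.
  eapply ev_step; [unfold step; rewrite (Hcode 1%nat _ eq_refl); reflexivity|].
  apply (copied_reg _ _ _ _ _ 1 (rdiv (m 0%nat) (m 1%nat))) in HC as HC1; [|lia].
  change (if Req_EM_T (m 1%nat) 0 then 0 else m 0%nat / m 1%nat) with (rdiv (m 0%nat) (m 1%nat)).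
  set (m1 := upd m 1 _) in HC1 |- *. clearbody m1.
  pose proof HC as (_ & _ & H3 & _). rewrite !H3 in HC1 by lia. cbn [setl nth] in HC1.
  rewrite rdiv_div in HC1 by lra. clear HC H3.
  (* This jump is meant for the empty input: for n >= 1 the quotient n / (n + eps) is below 1 <=
     n. *)
  eapply ev_step.
  { unfold step; rewrite (Hcode 2%nat _ eq_refl). pose proof HC1 as (_ & _ & H3 & _).
    rewrite !H3 by lia. cbn [nth].
    destruct (Rle_dec (INR n) (INR n / (INR n + eps))); [exfalso; lra|reflexivity]. }
  next ev_add. fold p in HC.
  next ev_add. replace (p + p) with (2 * p) in HC by ring.
  next ev_add. replace (2 * p + 2 * p) with (4 * p) in HC by ring.
  next ev_add. replace (4 * p + 4 * p) with (8 * p) in HC by ring.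
  next ev_add. replace (8 * p + 8 * p) with (16 * p) in HC by ring.
  next ev_add. replace (16 * p + 16 * p) with (32 * p) in HC by ring.
  next ev_add. replace (32 * p + 32 * p) with (64 * p) in HC by ring.
  next ev_add. replace (64 * p + 64 * p) with (128 * p) in HC by ring.
  next ev_floor. rewrite <- EA in HC.
  replace (INR A) with (INR (A + 8 * 0 + 0)) in HC by (f_equal; lia).
  next (ev_store 0 0).
  next ev_const. change 1 with (INR 1) in HC.
  next ev_add. rewrite (INR_add_eq _ _ (A + 8 * 0 + 1)) in HC by lia.
  next (ev_store 0 1).
  next ev_add. rewrite (INR_add_eq _ _ (A + 8 * 0 + 2)) in HC by lia.
  next (ev_store 0 2).
  next ev_const. change (IZR 6) with (IZR (Z.of_nat 6)) in HC. rewrite <- INR_IZR_INZ in HC.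
  next ev_add. rewrite (INR_add_eq _ _ (A + 8 * 1 + 0)) in HC by lia.
  next (ev_store 1 0).
  next ev_add. rewrite (INR_add_eq _ _ (A + 8 * 1 + 1)) in HC by lia.
  next (ev_store 1 1).
  next ev_add. rewrite (INR_add_eq _ _ (A + 8 * 1 + 2)) in HC by lia.
  next (ev_store 1 2).
  next ev_const. change (IZR 8) with (IZR (Z.of_nat 8)) in HC. rewrite <- INR_IZR_INZ in HC.
  next ev_floor. rewrite Hfl, <- INR_IZR_INZ in HC.
  next ev_const. change (IZR 3) with (IZR (Z.of_nat 3)) in HC. rewrite <- (INR_IZR_INZ 3) in HC.
  next ev_mul. rewrite <- mult_INR in HC.
  next ev_add. rewrite (INR_add_eq _ _ (n * 3 + 1)) in HC by lia.
  next ev_add. rewrite (INR_add_eq _ _ (3 * n + 2)) in HC by lia.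
  apply ev_done. split; [reflexivity|]. eauto.
Qed.

(** Register [NV] may itself hold input words, so the base is recomputed from the packed number only
    after everything has been moved. *)
Lemma relocation_end P m :
  (forall i x, nth_error relocation i = Some x -> nth_error P i = Some x) ->
  ev P 8 47 m (fun pc m' => pc = 55%nat /\ m' NV = IZR (floorZ (128 * m 0%nat)) /\
    forall x, x <> NV -> m' x = m x).
Proof.
  intros Hcode.
  do 8 (eapply ev_step; [unfold step; erewrite Hcode by reflexivity; reflexivity|]).
  apply ev_done. split; [reflexivity|split].
  - rewrite !upd_same. do 2 f_equal. ring.
  - intros x Hx. now rewrite !upd_other.
Qed.

Lemma relocation_correct P m0 n eps : let p := INR n + INR n / (INR n + eps) in
  (forall i x, nth_error relocation i = Some x -> nth_error P i = Some x) ->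
  (1 <= n)%nat -> 0 < eps -> m0 0%nat = INR n -> m0 1%nat = eps ->
  (forall x, (3 * n + 2 <= x)%nat -> m0 x = 0) ->
  ev P (15 * n + 40) 0 m0 (fun pc m => pc = 55%nat /\ m 0%nat = p /\
    exists a, rel (Z.to_nat (floorZ (128 * p))) m a m /\
      (forall k d, (k < 3)%nat -> (d < n)%nat -> a k d = m0 (2 + (3 * d + k))%nat) /\
      (forall k d, (3 <= k < 8)%nat -> a k d = 0)).
Proof.
  intros p Hcode Hn He E0 E1 Hz. set (A := Z.to_nat (floorZ (128 * p))).
  assert (Hn' : 1 <= INR n) by (change 1 with (INR 1); now apply le_INR).
  assert (Hp : INR n <= p).
  { unfold p. assert (0 < INR n / (INR n + eps)) by (apply Rdiv_lt_0_compat; lra). lra. }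
  assert (HAz : (128 * Z.of_nat n <= floorZ (128 * p))%Z).
  { destruct (floorZ_spec (128 * p)) as [_ F]. apply Zlt_succ_le, lt_IZR.
    unfold Z.succ. rewrite plus_IZR, mult_IZR, <- INR_IZR_INZ. lra. }
  assert (EA : INR A = IZR (floorZ (128 * p))) by (apply INR_Z_to_nat; lia).
  assert (HA : (128 * n <= A)%nat) by (unfold A; lia).
  replace (15 * n + 40)%nat with (31 + (15 * n + 1 + 8))%nat by lia.
  eapply ev_bind; [apply (relocation_start P m0 n eps A); auto|].
  cbv beta. intros pc1 m1 (-> & y5 & y6 & y7 & HC1).
  eapply ev_bind; [apply (relocation_loop P m0 A n Hcode ltac:(lia) n 2 m1 p y5 y6 y7); auto; lia|].
  cbv beta. intros pc2 m2 (-> & c & l & Hc & (HC0 & HC128 & HC3 & HC4 & HC5) & Hl).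
  assert (E20 : m2 0%nat = p) by (rewrite HC3, Hl; auto; lia).
  destruct (relocation_end P m2 Hcode) as (t & pc3 & m3 & Ht & R3 & -> & ENV & Ho).
  exists t, 55%nat, m3. split; [auto|split; [auto|split; [auto|split]]].
  - rewrite Ho; [auto|discriminate].
  - exists (fun k d => m3 (A + 8 * d + k)%nat). split; [|split].
    + split; [auto|split; [auto|split; [|auto]]]. now rewrite ENV, E20.
    + intros k d Hk Hd. rewrite Ho, HC5 by (unfold NV; lia).
      destruct (Nat.ltb_spec k 3), (Nat.ltb_spec (3 * d + k) c); auto; lia.
    + intros k d Hk. rewrite Ho, HC5 by (unfold NV; lia). destruct (Nat.ltb_spec k 3); auto; lia.
Qed.

Lemma input_cell Ds eps d k : (d < length Ds)%nat -> (k < 3)%nat ->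
  input_memory Ds eps (2 + (3 * d + k))%nat =
  match k with
  | O => dcx (nth d Ds (0,0,0)) | S O => dcy (nth d Ds (0,0,0)) | _ => drad (nth d Ds (0,0,0))
  end.
Proof.
  intros Hd Hk. cbn [input_memory Nat.add]. 
  replace ((3 * d + k) / 3)%nat with d by (apply (Nat.div_unique _ 3 d k); lia).
  replace ((3 * d + k) mod 3)%nat with k by (apply (Nat.mod_unique _ 3 d k); lia).
  rewrite (nth_error_nth' Ds (0,0,0) Hd). destruct k as [|[|k]]; reflexivity.
Qed.

Lemma input_beyond Ds eps x : (3 * length Ds + 2 <= x)%nat -> input_memory Ds eps x = 0.
Proof.
  intros Hx. destruct x as [|[|x]]; [lia|lia|]. cbn [input_memory].
  assert (H : (length Ds <= x / 3)%nat) by (apply Nat.div_le_lower_bound; lia).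
  apply nth_error_None in H. now rewrite H.
Qed.

(** * The complete program and its running time *)

Definition prog : program := relocation ++ ccmd Cmain 55 ++ [IHalt].

Lemma prog_run Ds eps :
  let n := length Ds in
  (1 <= n)%nat -> 0 < eps -> (forall i, (i < n)%nat -> 0 < drad (nth i Ds (0,0,0))) ->
  let x i := dcx (nth i Ds (0,0,0)) in let y i := dcy (nth i Ds (0,0,0)) in
  let r i := drad (nth i Ds (0,0,0)) in
  ev prog (Z.to_nat (2000 * (Z.of_nat n + 1) + 900000 * (Z.of_nat (kappa eps) * Z.of_nat (kappa
    eps)) ^ 3))
    0 (input_memory Ds eps) (fun pc m => halted prog (pc, m) /\ 0 <= m 4%nat /\
      covered n x y r (m 0%nat) (m 1%nat) (m 2%nat) (m 3%nat) (m 4%nat) /\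
      (forall e1x e1y e2x e2y rho, covered n x y r e1x e1y e2x e2y rho ->
        m 4%nat <= (1 + eps) * rho)).
Proof.
  intros n Hn He Hpos x y r.
  assert (Hcode : forall i v, nth_error relocation i = Some v -> nth_error prog i = Some v).
  { intros i v H. unfold prog. rewrite nth_error_app1; auto. apply nth_error_Some. congruence. }
  assert (Hmain : code_at prog 55 (ccmd Cmain 55 ++ [IHalt])).
  { intros i v H. unfold prog. assert (HL : length relocation = 55%nat) by reflexivity.
    rewrite nth_error_app2, HL, Nat.add_comm, Nat.add_sub by lia. exact H. }
  apply code_at_app in Hmain as [Hmain Hhalt]. apply code_at_cons1 in Hhalt.
  destruct (relocation_correct prog (input_memory Ds eps) n eps Hcode Hn He eq_refl eq_refl)
    as (t1 & pc1 & m1 & Ht1 & R1 & -> & E1 & a & Hrel & Ha & Ha0).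
  { apply input_beyond. }
  assert (Ax : forall d, (d < n)%nat -> a acx d = x d) by (intros d Hd; rewrite Ha, input_cell;
    auto).
  assert (Ay : forall d, (d < n)%nat -> a acy d = y d) by (intros d Hd; rewrite Ha, input_cell;
    auto).
  assert (Ar : forall d, (d < n)%nat -> a acr d = r d) by (intros d Hd; rewrite Ha, input_cell;
    auto).
  assert (Hcov : forall b1 b2 b3 b4 b5, covered n (a acx) (a acy) (a acr) b1 b2 b3 b4 b5 <->
    covered n x y r b1 b2 b3 b4 b5).
  { intros. split; intros H i Hi; specialize (H i Hi); rewrite Ax, Ay, Ar in *; auto. }
  destruct (wp_main n eps m1 a (fun s' _ t => 0 <= s' 4%nat /\
      covered n x y r (s' 0%nat) (s' 1%nat) (s' 2%nat) (s' 3%nat) (s' 4%nat) /\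
      (forall e1x e1y e2x e2y rho, covered n x y r e1x e1y e2x e2y rho ->
        s' 4%nat <= (1 + eps) * rho) /\
      (Z.of_nat t <= 1500 * (Z.of_nat n + 1) + 900000 * (Z.of_nat (kappa eps) * Z.of_nat (kappa
        eps)) ^ 3)%Z))
    with (P := prog) (pc := 55%nat) (b := Z.to_nat (floorZ (128 * (INR n + INR n / (INR n +
      eps))))) (m := m1)
    as (t2 & m2 & s2 & a2 & R2 & Hrel2 & _ & H4 & Hc & Hopt & Ht2); auto.
  - intros i Hi. rewrite Ar by auto. now apply Hpos.
  - intros i. apply Ha0. lia.
  - intros i. apply Ha0. lia.
  - intros s' a' t P1 P2 P3 P4. split; [auto|split; [now apply Hcov|split; [|auto]]].
    intros e1x e1y e2x e2y rho H. apply (P3 e1x e1y e2x e2y rho). now apply Hcov.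
  - exists (t1 + t2)%nat, (55 + length (ccmd Cmain 55))%nat, m2. split; [|split].
    + assert (0 <= (Z.of_nat (kappa eps) * Z.of_nat (kappa eps)) ^ 3)%Z by (apply Z.pow_nonneg;
      lia).
      set (z := ((Z.of_nat (kappa eps) * Z.of_nat (kappa eps)) ^ 3)%Z) in *. lia.
    + now rewrite run_add, R1.
    + destruct Hrel2 as [Hv _]. rewrite !Hv by (unfold NV; lia). split; [|auto].
      unfold halted. cbn [fst]. now rewrite Hhalt.
Qed.

(** For eps < 1 the logarithm exceeds ln 2 > 1/2; for eps >= 1 the term 1 / e^3 = 1 is absorbed by n
    + 1. *)
Lemma time_bound_lower n eps : 0 < eps ->
  let e := if Rle_dec 1 eps then 1 else eps in
  INR n + 1 + / e ^ 3 <= 3 * time_bound n eps.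
Proof.
  intros He e. unfold time_bound. pose proof (pos_INR n).
  assert (H3 : 0 < / eps ^ 3) by (apply Rinv_0_lt_compat, pow_lt; auto).
  assert (Hi : 0 < / eps) by now apply Rinv_0_lt_compat.
  assert (Hln : 0 < ln (1 + / eps)) by (rewrite <- ln_1; apply ln_increasing; lra).
  unfold e. destruct (Rle_dec 1 eps) as [C|C].
  - rewrite pow1, Rinv_1. assert (0 < / eps ^ 3 * ln (1 + / eps)) by now apply Rmult_lt_0_compat.
    lra.
  - assert (1 < / eps) by (rewrite <- Rinv_1; apply Rinv_lt_contravar; lra).
    assert (/ 2 < ln (1 + / eps)).
    { apply Rlt_trans with (ln 2); [apply ln_lt_2|]. apply ln_increasing; lra. }
    assert (/ eps ^ 3 * / 2 <= / eps ^ 3 * ln (1 + / eps)) by (apply Rmult_le_compat_l; lra). lra.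
Qed.

(** K^2 <= 64 / e gives K^6 <= 64^3 / e^3; the factor 3 comes from [time_bound_lower]. *)
Lemma kappa_time n eps : 0 < eps ->
  IZR (2000 * (Z.of_nat n + 1) + 900000 * (Z.of_nat (kappa eps) * Z.of_nat (kappa eps)) ^ 3)
  <= 900000 * 64 ^ 3 * 3 * time_bound n eps.
Proof.
  intros He. destruct (kappa_spec eps He) as (He1 & _ & _ & _ & _ & H64).
  pose proof (time_bound_lower n eps He) as HT. cbv zeta in HT.
  set (e := if Rle_dec 1 eps then 1 else eps) in *. clearbody e.
  replace ((Z.of_nat (kappa eps) * Z.of_nat (kappa eps)) ^ 3)%Z with
    ((Z.of_nat (kappa eps) * Z.of_nat (kappa eps)) * (Z.of_nat (kappa eps) * Z.of_nat (kappa eps)) *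
     (Z.of_nat (kappa eps) * Z.of_nat (kappa eps)))%Z by ring.
  rewrite plus_IZR, !mult_IZR, plus_IZR, <- !INR_IZR_INZ.
  set (k := INR (kappa eps) * INR (kappa eps)) in *.
  assert (Hk : 0 <= k) by (unfold k; pose proof (pos_INR (kappa eps)); nra).
  assert (Hke : k <= 64 * / e).
  { apply (Rmult_le_reg_r e); [lra|]. rewrite Rmult_assoc, Rinv_l by lra. lra. }
  assert (Hk3 : k ^ 3 <= 64 ^ 3 * / e ^ 3).
  { rewrite <- pow_inv, <- Rpow_mult_distr. apply pow_incr. lra. }
  pose proof (pos_INR n).
  assert (0 < / e ^ 3) by (apply Rinv_0_lt_compat, pow_lt; lra).
  replace (k * k * k) with (k ^ 3) by ring.
  lra.
Qed.

(* There is a single real-RAM program P and a constant c such that, on every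
   valid input family Ds of n disks and every eps > 0, P halts within
   c * (n + 1 + eps^-3 ln(1 + 1/eps)) unit-cost steps and outputs two disks
   C1, C2 of common radius r >= 0 such that every D in Ds lies in C1 or C2,
   and r <= (1+eps) * rho for every feasible radius rho (i.e. r <= (1+eps) r*_res). *)
Theorem theorem8 :
  exists (P : program) (c : R),
    forall (Ds : list disk) (eps : R),
      valid_input Ds -> 0 < eps ->
      exists k : nat,
        INR k <= c * time_bound (length Ds) eps /\
        let fin := run P k (0%nat, input_memory Ds eps) in
        halted P fin /\
        let m := snd fin in
        0 <= out_r m /\
        (forall D, In D Ds -> disk_subset D (out_C1 m) \/ disk_subset D (out_C2 m)) /\
        (forall rho, feasible_radius Ds rho -> out_r m <= (1 + eps) * rho).
Proof.
  exists prog, (900000 * 64 ^ 3 * 3). intros Ds eps [Hpos _] He.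
  set (x := fun i => dcx (nth i Ds (0,0,0))). set (y := fun i => dcy (nth i Ds (0,0,0))).
  set (r := fun i => drad (nth i Ds (0,0,0))).
  destruct (Nat.eq_dec (length Ds) 0) as [E|E].
  (* Empty input: 0 <= 0 / (0 + eps) makes the third instruction jump to [IHalt]. Register 4 still
     holds 0, and feasible radii are nonnegative. *)
  - apply length_zero_iff_nil in E. subst Ds. exists 3%nat. split.
    + pose proof (time_bound_lower 0 eps He) as HT. cbv zeta in HT.
      destruct (kappa_spec eps He) as (He1 & _).
      assert (0 < / (if Rle_dec 1 eps then 1 else eps) ^ 3) by (apply Rinv_0_lt_compat, pow_lt;
        lra).
      simpl INR in *. cbn [length]. lra.
    + assert (R3 : run prog 3 (0%nat, input_memory [] eps) =
        (46%nat, upd (upd (input_memory [] eps) 1 (0 + eps)) 1 (rdiv 0 (0 + eps)))).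
      { change (run prog 3 (0%nat, input_memory [] eps)) with
          ((if Rle_dec 0 (rdiv 0 (0 + eps)) then 46%nat else 3%nat),
             upd (upd (input_memory [] eps) 1 (0 + eps)) 1 (rdiv 0 (0 + eps))).
        rewrite rdiv_div by lra. destruct (Rle_dec 0 (0 / (0 + eps))) as [|C]; auto.
        exfalso. apply C. unfold Rdiv. lra. }
      rewrite R3. split; [reflexivity|]. cbv zeta. cbn [snd].
      assert (E4 : out_r (upd (upd (input_memory [] eps) 1 (0 + eps)) 1 (rdiv 0 (0 + eps))) = 0) by
        reflexivity.
      rewrite E4. split; [lra|split].
      * intros D [].
      * intros rho [Hrho _]. nra.
  - assert (Hn : (1 <= length Ds)%nat) by (destruct (length Ds); [now elim E|lia]).
    destruct (prog_run Ds eps Hn He Hpos) as (k & pc & m & Hk & R & Hh & H4 & Hc & Hopt).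
    exists k. split.
    + eapply Rle_trans; [|now apply kappa_time].
      rewrite INR_IZR_INZ. apply IZR_le.
      assert (0 <= (Z.of_nat (kappa eps) * Z.of_nat (kappa eps)) ^ 3)%Z by (apply Z.pow_nonneg;
        lia).
      set (z := ((Z.of_nat (kappa eps) * Z.of_nat (kappa eps)) ^ 3)%Z) in *. unfold disk in *. lia.
    + rewrite R. split; [exact Hh|]. cbv zeta. cbn [snd]. unfold out_r, out_C1, out_C2.
      split; [exact H4|split].
      * intros D HD. destruct (In_nth Ds D (0,0,0) HD) as (i & Hi & <-).
        rewrite !disk_subset_hyp by (auto; now apply Hpos). cbn [fst snd]. exact (Hc i Hi).
      * intros rho (Hrho & [e1x e1y] & [e2x e2y] & Hf).
        apply (Hopt e1x e1y e2x e2y rho). intros i Hi.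
        specialize (Hf (nth i Ds (0,0,0)) (nth_In Ds (0,0,0) Hi)).
        rewrite !disk_subset_hyp in Hf by (auto; now apply Hpos). exact Hf.
Qed.
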